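(* For each $1\le j\le m$ let $(c^+_{f,j}(n))_{n\ge-n_0}$ and $(c^-_{f,j}(n))_{n+\kappa_j<0}$ be sequences of complex numbers with $c^+_{f,j}(n),c^-_{f,j}(n)=O(e^{C\sqrt{|n|}})$ as $|n|\to\infty$ for some $C>0$. For $\tau=u+iv\in\mathbb{H}$ set \[f(\tau):=\sum_{j=1}^m\sum_{n=-n_0}^\infty c^+_{f,j}(n)e^{2\pi i(n+\kappa_j)\tau}\mathbf{e}_j+\sum_{j=1}^m\sum_{n+\kappa_j<0}c^-_{f,j}(n)\Gamma(1-k,-4\pi(n+\kappa_j)v)e^{2\pi i(n+\kappa_j)\tau}\mathbf{e}_j.\] Suppose that for each $\varphi\in S_c(\mathbb{R}_+)$, \[L_f(\varphi)=i^k\rho(S)L_f(\varphi|_{2-k,\chi^{-1}}S)\quad\text{and}\quad L_{\delta_kf}(\varphi)=-i^k\rho(S)L_{\delta_kf}(\varphi|_{2-k,\chi^{-1}}S),\] where $(\varphi|_{2-k,\chi^{-1}}S)(x):=x^{k-2}\chi(S)\varphi(1/x)$. Then $f\in H_{k,\chi,\rho}$.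
   Context: Let $\Gamma=\mathrm{SL}_2(\mathbb{Z})$, $T=\left(\begin{smallmatrix}1&1\\0&1\end{smallmatrix}\right)$, $S=\left(\begin{smallmatrix}0&-1\\1&0\end{smallmatrix}\right)$, $k\in\frac12\mathbb{Z}$, $\chi$ a unitary multiplier system of weight $k$ on $\Gamma$ ($|\chi|=1$ and $\chi(\gamma_1\gamma_2)(c_3\tau+d_3)^k=\chi(\gamma_1)\chi(\gamma_2)(c_1\gamma_2\tau+d_1)^k(c_2\tau+d_2)^k$, where $\gamma_1\gamma_2=\left(\begin{smallmatrix}a_3&b_3\\c_3&d_3\end{smallmatrix}\right)$), $m\ge1$, $\rho:\Gamma\to\mathrm{GL}(m,\mathbb{C})$ a unitary representation, $\mathbf{e}_j$ the standard basis of $\mathbb{C}^m$, $(f|_{k,\chi,\rho}\gamma)(\tau):=(c\tau+d)^{-k}\chi(\gamma)^{-1}\rho(\gamma)^{-1}f(\gamma\tau)$. The numbers $\kappa_j\in[0,1)$ satisfy $\chi(T)\rho(T)\mathbf{e}_j=e^{2\pi i\kappa_j}\mathbf{e}_j$. $\Gamma(a,w)$ is the incomplete gamma function. $H_{k,\chi,\rho}$ is the space of real-analytic $f:\mathbb{H}\to\mathbb{C}^m$ with $f|_{k,\chi,\rho}\gamma=f$ for all $\gamma$, $\Delta_kf=0$ where $\Delta_k=-4v^2\partial_\tau\partial_{\bar\tau}+2kiv\partial_{\bar\tau}$, and having a Fourier expansion of the same shape as the displayed $f$. $S_c(\mathbb{R}_+)$ is a set of complex-valued, compactly supported, piecewise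 smooth functions on $(0,\infty)$ such that for every $y>0$ some $\varphi\in S_c(\mathbb{R}_+)$ has $\varphi(y)\ne0$. With $\mathcal{L}$ the Laplace transform and $\varphi_s(x):=\varphi(x)x^{s-1}$: $L_f(\varphi):=\sum_j\sum_nc^+_{f,j}(n)(\mathcal{L}\varphi)(2\pi(n+\kappa_j))\mathbf{e}_j+\sum_j\sum_{n+\kappa_j<0}c^-_{f,j}(n)(-4\pi(n+\kappa_j))^{1-k}\int_0^\infty\frac{(\mathcal{L}\varphi_{2-k})(-2\pi(n+\kappa_j)(2t+1))}{(1+t)^k}dt\,\mathbf{e}_j$, and $L_{\delta_kf}(\varphi):=\frac k2L_f(\varphi)-2\pi\sum_j\sum_nc^+_{f,j}(n)(n+\kappa_j)(\mathcal{L}\varphi_2)(2\pi(n+\kappa_j))\mathbf{e}_j-2\pi\sum_j\sum_{n+\kappa_j<0}c^-_{f,j}(n)(n+\kappa_j)(-4\pi(n+\kappa_j))^{1-k}\int_0^\infty\frac{(\mathcal{L}\varphi_{3-k})(-2\pi(n+\kappa_j)(2t+1))}{(1+t)^k}dt\,\mathbf{e}_j$ (these are the $L$-series of $f$ and of $\delta_kf:=\tau\partial_uf+\frac k2f$).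
   Formalization: The set S_c(R_+) is additionally assumed stable under φ ↦ φ_s, φ_s(x)=φ(x)x^{s-1}, for all real s (the claim fails for arbitrary pointwise nonvanishing sets), and a piecewise smooth φ takes at each jump one of its one-sided limits. *)

(* Defs.v *)
From HB Require Import structures.
From mathcomp Require Import all_boot all_order all_algebra.
From mathcomp Require Export complex.
From mathcomp Require Import all_classical all_reals all_analysis.
Set Implicit Arguments.
Unset Strict Implicit.
Unset Printing Implicit Defensive.
Import Order.TTheory GRing.Theory Num.Theory.
Import numFieldNormedType.Exports.
Local Open Scope classical_set_scope.
Local Open Scope ring_scope.
Local Open Scope complex_scope.

(* Real parts in R, not the R[i]-valued Num.Re and Num.Im. *)
Local Notation Re := complex.Re.
Local Notation Im := complex.Im.

Definition SL2Z := {g : 'M[int]_2 | \det g == 1}.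

Definition mx22 (a b c d : int) : 'M[int]_2 :=
  \matrix_(i, j) nth 0 (nth [::] [:: [:: a; b]; [:: c; d]] i) j.

Lemma det_mx22E a b c d : \det (mx22 a b c d) = a * d - b * c.
Proof.
by rewrite (expand_det_row _ 0) !big_ord_recl big_ord0 /cofactor !det_mx11 !mxE
           /= addr0 expr0 expr1 mul1r mulN1r mulrN.
Qed.

Lemma SL2Z1_subproof : \det (1%:M : 'M[int]_2) == 1.
Proof. by rewrite det1. Qed.
Lemma SL2ZM_subproof (g h : SL2Z) : \det (val g *m val h) == 1.
Proof. by rewrite det_mulmx (eqP (valP g)) (eqP (valP h)). Qed.
Lemma SL2ZT_subproof : \det (mx22 1 1 0 1) == 1.
Proof. by rewrite det_mx22E. Qed.
Lemma SL2ZS_subproof : \det (mx22 0 (-1) 1 0) == 1.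
Proof. by rewrite det_mx22E. Qed.

Definition SL2Z1 : SL2Z :=
  exist (fun g : 'M[int]_2 => \det g == 1) _ SL2Z1_subproof.
Definition SL2ZM (g h : SL2Z) : SL2Z :=
  exist (fun g : 'M[int]_2 => \det g == 1) _ (SL2ZM_subproof g h).
Definition SL2ZT : SL2Z :=
  exist (fun g : 'M[int]_2 => \det g == 1) _ SL2ZT_subproof.
Definition SL2ZS : SL2Z :=
  exist (fun g : 'M[int]_2 => \det g == 1) _ SL2ZS_subproof.

Section ComplexAnalysis.
Variable R : realType.
Implicit Types (z tau : R[i]) (a s w : R).

Definition cexp z : R[i] := (expR (Re z))%:C * (cos (Im z) +i* sin (Im z)).

(* The principal branch: -pi < carg z <= pi for z != 0. *)
Definition carg z : R :=
  let t := acos (Re z / Normc.normc z) in if 0 <= Im z then t else - t.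

Definition cpow z a : R[i] :=
  (Normc.normc z `^ a)%:C * (cos (a * carg z) +i* sin (a * carg z)).

(* Limits, integrals and derivatives of complex-valued functions are taken
   separately on real and imaginary parts. *)
Definition cseries_cvg (u : nat -> R[i]) (l : R[i]) : Prop :=
  (series (fun n => Re (u n)) @ \oo --> Re l) /\
  (series (fun n => Im (u n)) @ \oo --> Im l).

Definition cseries (u : nat -> R[i]) : R[i] :=
  limn (series (fun n => Re (u n))) +i* limn (series (fun n => Im (u n))).

Definition cintegral (D : set R) (g : R -> R[i]) : R[i] :=
  (\int[lebesgue_measure]_(x in D) Re (g x)) +i*
  (\int[lebesgue_measure]_(x in D) Im (g x)).

Definition laplace (phi : R -> R[i]) s : R[i] :=
  cintegral `]0, +oo[ (fun x => (expR (- (s * x)))%:C * phi x).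

Definition incomplete_gamma a w : R :=
  \int[lebesgue_measure]_(t in `[w, +oo[) (expR (- t) * t `^ (a - 1)).

Definition smooth (g : R -> R) : Prop := forall n x, derivable (derive1n n g) x 1.

(* (0, oo) is covered by finitely many nondegenerate intervals, on each of
   which phi is the restriction of a smooth function on R.  Jumps are allowed,
   but the value at a jump is one of the two one-sided limits. *)
Definition piecewise_smooth (phi : R -> R[i]) : Prop :=
  exists (N : nat) (I : 'I_N -> interval R) (g h : 'I_N -> R -> R),
    [/\ forall i, smooth (g i) /\ smooth (h i),
        forall i, exists x y, [/\ x < y, x \in I i & y \in I i],
        forall x, 0 < x -> exists i, x \in I i &
        forall i x, 0 < x -> x \in I i -> phi x = g i x +i* h i x].

(* Functions on (0, oo) are extended by zero to R. *)
Definition compactly_supported_pos (phi : R -> R[i]) : Prop :=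
  exists a b : R, 0 < a /\ forall x, ~ (a <= x <= b) -> phi x = 0.

Definition twist s (phi : R -> R[i]) (x : R) : R[i] := phi x * (x `^ (s - 1))%:C.

(* Stability under phi |-> phi_s = phi(x) x^(s-1) is what allows to pass from
   the vanishing of int g phi, for all test functions phi, to that of g (Mellin
   inversion applied to the phi_s).  Nonvanishing at each point does not suffice:
   the functions orthogonal to one or two given g's already form a class that is
   nonvanishing in this sense. *)
Definition test_functions (Sc : set (R -> R[i])) : Prop :=
  [/\ forall phi, Sc phi -> compactly_supported_pos phi /\ piecewise_smooth phi,
      forall phi s, Sc phi -> Sc (twist s phi) &
      forall y, 0 < y -> exists2 phi, Sc phi & phi y != 0].

Definition real_analytic_at (g : R -> R -> R) (u0 v0 : R) : Prop :=
  exists (r : R) (a : nat -> nat -> R), 0 < r /\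
    forall x y, `|x| < r -> `|y| < r ->
      summable [set: nat * nat] (fun p => (a p.1 p.2 * x ^+ p.1 * y ^+ p.2)%:E) /\
      (fun n : nat => \sum_(p < n) \sum_(q < n) a p q * x ^+ p * y ^+ q)
        @ \oo --> g (u0 + x) (v0 + y).

(* tau = u + iv *)
Definition partial_u (g : R[i] -> R[i]) tau : R[i] :=
  derive1 (fun u => Re (g (u +i* Im tau))) (Re tau) +i*
  derive1 (fun u => Im (g (u +i* Im tau))) (Re tau).

Definition partial_v (g : R[i] -> R[i]) tau : R[i] :=
  derive1 (fun v => Re (g (Re tau +i* v))) (Im tau) +i*
  derive1 (fun v => Im (g (Re tau +i* v))) (Im tau).

Definition partial_tau (g : R[i] -> R[i]) tau : R[i] :=
  (partial_u g tau - 'i%C * partial_v g tau) / 2.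

Definition partial_taubar (g : R[i] -> R[i]) tau : R[i] :=
  (partial_u g tau + 'i%C * partial_v g tau) / 2.

Definition Delta (k : R) (g : R[i] -> R[i]) tau : R[i] :=
  - 4 * (Im tau)%:C ^+ 2 * partial_tau (partial_taubar g) tau
  + 2 * k%:C * 'i%C * (Im tau)%:C * partial_taubar g tau.

End ComplexAnalysis.

Section ModularForms.
Variable R : realType.
Implicit Types (tau : R[i]) (k : R) (chi : SL2Z -> R[i]).

Definition autj (g : SL2Z) tau : R[i] :=
  (val g 1 0)%:~R * tau + (val g 1 1)%:~R.

Definition moebius (g : SL2Z) tau : R[i] :=
  ((val g 0 0)%:~R * tau + (val g 0 1)%:~R) / autj g tau.

Definition unitary_multiplier k chi : Prop :=
  (forall g, `|chi g| = 1) /\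
  forall g h tau, 0 < Im tau ->
    chi (SL2ZM g h) * cpow (autj (SL2ZM g h) tau) k =
    chi g * chi h * cpow (autj g (moebius h tau)) k * cpow (autj h tau) k.

Definition unitary_representation m (rho : SL2Z -> 'M[R[i]]_m) : Prop :=
  [/\ rho SL2Z1 = 1%:M,
      forall g h, rho (SL2ZM g h) = rho g *m rho h &
      forall g, rho g \is unitarymx].

Definition slash m k chi (rho : SL2Z -> 'M[R[i]]_m) (f : R[i] -> 'cV[R[i]]_m)
    (g : SL2Z) tau : 'cV[R[i]]_m :=
  (cpow (autj g tau) (- k) * (chi g)^-1) *: (invmx (rho g) *m f (moebius g tau)).

(* phi |_{2-k, chi^{-1}} S *)
Definition slash_test k chi (phi : R -> R[i]) (x : R) : R[i] :=
  (x `^ (k - 2))%:C * chi SL2ZS * phi x^-1.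

Section Expansions.
Variables (m : nat) (k : R) (kappa : 'I_m -> R) (n0 : int).
Variables cp cm : 'I_m -> int -> R[i].
Implicit Types (j : 'I_m) (n : int) (l : nat).

Definition freq j n : R := n%:~R + kappa j.

(* l |-> pos_index l enumerates the n >= - n0.  As 0 <= kappa j < 1, the
   condition n + kappa j < 0 means n <= -1, and l |-> neg_index l enumerates
   these n. *)
Definition pos_index l : int := l%:Z - n0.
Definition neg_index l : int := - (l.+1)%:Z.

Definition e2pi j n tau : R[i] := cexp ((2 * pi * freq j n)%:C * 'i%C * tau).

Definition holo_term j tau l : R[i] :=
  let n := pos_index l in cp j n * e2pi j n tau.

Definition nonholo_term j tau l : R[i] :=
  let n := neg_index l in
  cm j n * (incomplete_gamma (1 - k) (- 4 * pi * freq j n * Im tau))%:C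
    * e2pi j n tau.

Definition fourier_fun tau : 'cV[R[i]]_m :=
  \col_j (cseries (holo_term j tau) + cseries (nonholo_term j tau)).

Definition fourier_expands (f : R[i] -> 'cV[R[i]]_m) : Prop :=
  forall tau j, 0 < Im tau -> exists s1 s2,
    [/\ cseries_cvg (holo_term j tau) s1,
        cseries_cvg (nonholo_term j tau) s2 & f tau j 0 = s1 + s2].

(* int_0^oo (L phi_s)(-2 pi (n + kappa_j)(2t + 1)) / (1 + t)^k dt *)
Definition laplace_int j n (s : R) (phi : R -> R[i]) : R[i] :=
  cintegral `[0, +oo[ (fun t =>
    laplace (twist s phi) (- 2 * pi * freq j n * (2 * t + 1))
    / ((1 + t) `^ k)%:C).

Definition Lseries (phi : R -> R[i]) : 'cV[R[i]]_m :=
  \col_j (cseries (fun l => let n := pos_index l in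
            cp j n * laplace phi (2 * pi * freq j n))
        + cseries (fun l => let n := neg_index l in
            cm j n * ((- 4 * pi * freq j n) `^ (1 - k))%:C
            * laplace_int j n (2 - k) phi)).

Definition Lseries_delta (phi : R -> R[i]) : 'cV[R[i]]_m :=
  (k / 2)%:C *: Lseries phi
  - (2 * pi)%:C *: \col_j cseries (fun l => let n := pos_index l in
      cp j n * (freq j n)%:C * laplace (twist 2 phi) (2 * pi * freq j n))
  - (2 * pi)%:C *: \col_j cseries (fun l => let n := neg_index l in
      cm j n * (freq j n)%:C * ((- 4 * pi * freq j n) `^ (1 - k))%:C
      * laplace_int j n (3 - k) phi).

End Expansions.

(* c(n) = O(exp(C sqrt |n|)) as |n| -> oo with n in D *)
Definition exp_sqrt_growth (C : R) (D : set int) (c : int -> R[i]) : Prop :=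
  exists (A : R) (N : nat), forall n : int, D n -> (N <= absz n)%N ->
    `|c n| <= (A * expR (C * Num.sqrt (absz n)%:R))%:C.

Definition harmonic_space m k chi (rho : SL2Z -> 'M[R[i]]_m)
    (kappa : 'I_m -> R) (f : R[i] -> 'cV[R[i]]_m) : Prop :=
  [/\ forall tau j, 0 < Im tau ->
        real_analytic_at (fun u v => Re (f (u +i* v) j 0)) (Re tau) (Im tau) /\
        real_analytic_at (fun u v => Im (f (u +i* v) j 0)) (Re tau) (Im tau),
      forall g tau, 0 < Im tau -> slash k chi rho f g tau = f tau,
      forall tau j, 0 < Im tau -> Delta k (fun z => f z j 0) tau = 0 &
      exists n0 cp cm, fourier_expands k kappa n0 cp cm f].

End ModularForms.

(* Main.v *)
(* Write [tau = i e^zeta] with [zeta] in the strip [|Im zeta| < pi/2]; then [S]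
   acts by [zeta -> - zeta].  The incomplete gamma function is [w^(1-k) e^(-w)]
   times the Laplace transform of [(1+t)^(-k)], so that [L_f(phi)] and
   [L_{delta_k f}(phi)] are the integrals over [y > 0] of [f(iy) phi(y)] and
   [(delta_k f)(iy) phi(y)].  As the test functions are stable under
   [phi -> phi x^(s-1)], the functional equations are identities between all
   moments, and integration against the Landau kernels [(1 - ((x-x0)/r)^2)^n]
   turns them into the [S]-symmetry of [f] and of [delta_k f] on the imaginary
   axis, up to the sign for the latter.
   To leave the axis, put [W(zeta) = e^(k zeta/2) f(i e^zeta)].  Its derivative
   in the conjugate of [zeta] is [-1/2 cos(Im zeta)^(-k) V(conj zeta)], where [V]
   is holomorphic.  On the real line the two symmetries read
   [W(x) = A W(-x)] and [V(x) = - A V(-x)], [A = i^k chi(S) rho(S)].  The identity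
   theorem first gives the latter on the whole strip, so that
   [W(zeta) - A W(- zeta)] is holomorphic; as it vanishes on the real line, it
   vanishes on the strip.  This is invariance under [S]; invariance under [T] is
   visible on the Fourier expansion, and [S] and [T] generate the group. *)
Require Import Defs.
From HB Require Import structures.
From mathcomp Require Import all_boot all_order all_algebra.
From mathcomp Require Import all_classical all_reals all_analysis.
From mathcomp Require Import measurable_realfun ring lra zify.
Set Implicit Arguments.
Unset Strict Implicit.
Unset Printing Implicit Defensive.
Import Order.TTheory GRing.Theory Num.Theory.
Import numFieldNormedType.Exports.
Local Open Scope classical_set_scope.
Local Open Scope ring_scope.
Local Open Scope complex_scope.
Local Notation Re := complex.Re.
Local Notation Im := complex.Im.
Local Notation cabs := Normc.normc.

(** * Complex numbers and absolutely summable families *)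

(** Symmetry of [f] on the axis alone cannot be continued, because [f] is not holomorphic: along a
    line only the sum of the two Wirtinger derivatives is visible. The second functional equation
    supplies the missing relation. The derivative of [f] in the conjugate variable is
    [-(i/2) v^(-k) G(- conj tau)] with [G] holomorphic, so the derivative of [W] along the real line
    is [Z - V], where [Z(x) = e^(kx/2) (delta_k f)(i e^x)] and
    [V(zeta) = e^((1-k/2) zeta) G(i e^zeta)]. Differentiating [W(x) = A W(-x)] makes [W'] odd up to
    [A], the equation for [delta_k f] makes [Z] odd up to [A], hence so is [V]. Differentiation is
    done through expansions with explicit quadratic or cubic remainders, and the identity theorem
    comes from a maximum principle with Gaussian weights; no contour integral occurs. The
    coefficients enter only through being smaller than every exponential in the frequency. Test
    functions may jump, so equality on the axis is first obtained at their continuity points and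
    then extended by continuity of [f] and [delta_k f]. *)

Section ComplexBasics.
Variable R : realType.
Implicit Types (z w : R[i]) (a b x y : R).

Lemma cabsD z w : cabs (z + w) <= cabs z + cabs w.
Proof. exact: le_normcD. Qed.

Lemma cabsN z : cabs (- z) = cabs z.
Proof. exact: normcN. Qed.

Lemma cabsB z w : cabs (z - w) = cabs (w - z).
Proof. by rewrite -cabsN opprB. Qed.

Lemma cabs_ge0 z : 0 <= cabs z.
Proof. by case: z => a b; exact: sqrtr_ge0. Qed.

Lemma cabs_real x : cabs x%:C = `|x|.
Proof. by rewrite /= expr0n /= addr0 sqrtr_sqr. Qed.

Lemma cabs_i : cabs ('i%C : R[i]) = 1.
Proof. by rewrite /= expr0n expr1n add0r sqrtr1. Qed.

Lemma cabsX z n : cabs (z ^+ n) = cabs z ^+ n.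
Proof.
by elim: n => [|n IH]; rewrite ?expr0 ?Normc.normc1// !exprS Normc.normcM IH.
Qed.

Lemma cabs_conj z : cabs (z^*) = cabs z.
Proof. by case: z => a b /=; rewrite sqrrN. Qed.

Lemma realcD x y : (x + y)%:C = x%:C + y%:C :> R[i]. Proof. exact: rmorphD. Qed.
Lemma realcB x y : (x - y)%:C = x%:C - y%:C :> R[i]. Proof. exact: rmorphB. Qed.
Lemma realcN x : (- x)%:C = - x%:C :> R[i]. Proof. exact: rmorphN. Qed.
Lemma realcM x y : (x * y)%:C = x%:C * y%:C :> R[i]. Proof. exact: rmorphM. Qed.
Lemma realcX x n : (x ^+ n)%:C = x%:C ^+ n :> R[i]. Proof. exact: rmorphXn. Qed.
Lemma realcV x : (x^-1)%:C = x%:C^-1 :> R[i]. Proof. exact: fmorphV. Qed.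
Lemma realc_nat n : (n%:R)%:C = n%:R :> R[i]. Proof. exact: rmorph_nat. Qed.
Lemma realc_sum (I : Type) (s : seq I) (f : I -> R) :
  (\sum_(i <- s) f i)%:C = \sum_(i <- s) (f i)%:C :> R[i].
Proof. exact: rmorph_sum. Qed.
Lemma realc_eq0 x : (x%:C == 0 :> R[i]) = (x == 0).
Proof. by rewrite eq_complex /= eqxx andbT. Qed.

Lemma conjc_0 : (0 : R[i])^*%C = 0. Proof. exact: rmorph0. Qed.
Lemma conjcD z w : (z + w)^*%C = z^*%C + w^*%C. Proof. exact: rmorphD. Qed.
Lemma conjcB z w : (z - w)^*%C = z^*%C - w^*%C. Proof. exact: rmorphB. Qed.
Lemma conjcN z : (- z)^*%C = - z^*%C. Proof. exact: rmorphN. Qed.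
Lemma conjcM z w : (z * w)^*%C = z^*%C * w^*%C. Proof. exact: rmorphM. Qed.
Lemma conjci : ('i%C)^*%C = - 'i%C :> R[i].
Proof. by apply/eqP; rewrite eq_complex /= oppr0 !eqxx. Qed.
Lemma ic_neq0 : 'i%C != 0 :> R[i].
Proof. by rewrite eq_complex /= oner_eq0 andbF. Qed.
Lemma ic_ic : 'i%C * 'i%C = -1 :> R[i]. Proof. by rewrite -expr2 sqr_i. Qed.

Lemma ReD z w : Re (z + w) = Re z + Re w. Proof. by case: z; case: w. Qed.
Lemma ImD z w : Im (z + w) = Im z + Im w. Proof. by case: z; case: w. Qed.
Lemma ReN z : Re (- z) = - Re z. Proof. by case: z. Qed.
Lemma ImN z : Im (- z) = - Im z. Proof. by case: z. Qed.
Lemma ReB z w : Re (z - w) = Re z - Re w. Proof. by rewrite ReD ReN. Qed.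
Lemma ImB z w : Im (z - w) = Im z - Im w. Proof. by rewrite ImD ImN. Qed.
Lemma ReM z w : Re (z * w) = Re z * Re w - Im z * Im w.
Proof. by case: z; case: w. Qed.
Lemma ImM z w : Im (z * w) = Re z * Im w + Im z * Re w.
Proof. by case: z => a b; case: w => c d. Qed.

Lemma complex_ext z w : Re z = Re w -> Im z = Im w -> z = w.
Proof. by case: z => a b; case: w => c d /= -> ->. Qed.

Lemma Re_sum (I : Type) (s : seq I) (f : I -> R[i]) :
  Re (\sum_(i <- s) f i) = \sum_(i <- s) Re (f i).
Proof. by elim: s => [|i s IH]; rewrite ?big_nil// !big_cons ReD IH. Qed.

Lemma Im_sum (I : Type) (s : seq I) (f : I -> R[i]) :
  Im (\sum_(i <- s) f i) = \sum_(i <- s) Im (f i).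
Proof. by elim: s => [|i s IH]; rewrite ?big_nil// !big_cons ImD IH. Qed.

Lemma cabs_sum (I : Type) (s : seq I) (f : I -> R[i]) :
  cabs (\sum_(i <- s) f i) <= \sum_(i <- s) cabs (f i).
Proof.
elim: s => [|i s IH]; first by rewrite !big_nil Normc.normc0.
by rewrite !big_cons (le_trans (cabsD _ _))// lerD2l.
Qed.

Lemma cabs_sqr z : cabs z ^+ 2 = Re z ^+ 2 + Im z ^+ 2.
Proof. by case: z => a b /=; rewrite sqr_sqrtr// addr_ge0// sqr_ge0. Qed.

Lemma normr_Re_le z : `|Re z| <= cabs z.
Proof.
case: z => a b /=; rewrite -sqrtr_sqr ler_wsqrtr//.
by rewrite lerDl sqr_ge0.
Qed.

Lemma normr_Im_le z : `|Im z| <= cabs z.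
Proof.
case: z => a b /=; rewrite -sqrtr_sqr ler_wsqrtr//.
by rewrite lerDr sqr_ge0.
Qed.

Lemma cabs_le_ReIm z : cabs z <= `|Re z| + `|Im z|.
Proof.
rewrite {1}(complexE z) (le_trans (cabsD _ _))// cabs_real Normc.normcM cabs_i.
by rewrite mul1r cabs_real.
Qed.

Lemma cabs_dist z w : `|cabs z - cabs w| <= cabs (z - w).
Proof.
rewrite ler_norml lerBlDr; apply/andP; split; last first.
  by rewrite -{1}(subrK w z) cabsD.
have := cabsD (w - z) z; rewrite subrK cabsB => h; rewrite lerNl opprB lerBlDr.
exact: h.
Qed.

Lemma cabs0_eq z : cabs z = 0 -> z = 0.
Proof. exact: Normc.eq0_normc. Qed.

Lemma cabs_le0_eq z : (forall e, 0 < e -> cabs z < e) -> z = 0.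
Proof.
move=> h; apply: cabs0_eq; apply/eqP; rewrite eq_le cabs_ge0 andbT leNgt.
by apply/negP => h0; have := h _ h0; rewrite ltxx.
Qed.

Lemma cexpD z w : cexp (z + w) = cexp z * cexp w.
Proof.
case: z => a b; case: w => c d; rewrite /cexp /= expRD cosD sinD.
by apply: complex_ext; rewrite /=; ring.
Qed.

Lemma cexp0 : cexp 0 = 1 :> R[i].
Proof. by rewrite /cexp/= expR0 cos0 sin0 mul1r. Qed.

Lemma cexp_neq0 z : cexp z != 0.
Proof.
apply/eqP => h; have := cexpD z (- z); rewrite h mul0r subrr cexp0.
by move/eqP; rewrite oner_eq0.
Qed.

Lemma cexpN z : cexp (- z) = (cexp z)^-1.
Proof.
apply: (mulfI (cexp_neq0 z)); rewrite -cexpD subrr cexp0 divff//.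
exact: cexp_neq0.
Qed.

Lemma cexp_real x : cexp x%:C = (expR x)%:C.
Proof. by rewrite /cexp /= cos0 sin0 mulr1. Qed.

Lemma cabs_cexp z : cabs (cexp z) = expR (Re z).
Proof.
rewrite /cexp Normc.normcM cabs_real ger0_norm ?expR_ge0//=.
by rewrite cos2Dsin2 sqrtr1 mulr1.
Qed.

Lemma Re_cexp z : Re (cexp z) = expR (Re z) * cos (Im z).
Proof. by rewrite /cexp /= mul0r subr0. Qed.

Lemma Im_cexp z : Im (cexp z) = expR (Re z) * sin (Im z).
Proof. by rewrite /cexp /= mul0r addr0. Qed.

Lemma cexp_conj z : cexp (z^*) = (cexp z)^*.
Proof.
case: z => a b; rewrite /cexp /= cosN sinN.
by apply: complex_ext; rewrite /=; ring.
Qed.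

Lemma cexpMn z n : cexp (n%:R * z) = cexp z ^+ n.
Proof.
elim: n => [|n IH]; first by rewrite mul0r cexp0 expr0.
by rewrite -natr1 mulrDl mul1r cexpD IH exprS mulrC.
Qed.

End ComplexBasics.

(** * Unordered summation of complex families *)

Section HasSum.
Variable R : realType.

(** Convergence along the net of finite subsets, represented by duplicate-free lists. Being
    independent of any order, it survives reindexing, grouping into fibres and interchange of double
    sums; along initial segments it gives back the ordered limits of [cseries_cvg]. *)
Definition has_sum (I : eqType) (f : I -> R[i]) (s : R[i]) :=
  forall e : R, 0 < e -> exists s0 : seq I, forall s1, uniq s1 ->
    {subset s0 <= s1} -> cabs (\sum_(i <- s1) f i - s) < e.

(** A uniform bound on the finite partial sums; [abs_le] below is absolute convergence in this form.
    The bound [M] is kept explicit because families of series are summed again later, with their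
    bounds as the terms. *)
Definition sum_le (I : eqType) (g : I -> R) (M : R) :=
  forall s : seq I, uniq s -> \sum_(i <- s) g i <= M.

Definition abs_le (I : eqType) (f : I -> R[i]) (M : R) :=
  sum_le (fun i => cabs (f i)) M.

Section Basic.
Variable I : eqType.
Implicit Types (f g : I -> R[i]) (s : seq I).

Lemma has_sum_unique f A B : has_sum f A -> has_sum f B -> A = B.
Proof.
move=> hA hB; apply/eqP; rewrite -subr_eq0; apply/eqP.
apply: cabs_le0_eq => e e0; have e2 : 0 < e / 2 by rewrite divr_gt0.
have [s0 h0] := hA _ e2; have [s1 h1] := hB _ e2.
have h2 : uniq (undup (s0 ++ s1)) by exact: undup_uniq.
have h3 : {subset s0 <= undup (s0 ++ s1)}.
  by move=> x xs; rewrite mem_undup mem_cat xs.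
have h4 : {subset s1 <= undup (s0 ++ s1)}.
  by move=> x xs; rewrite mem_undup mem_cat xs orbT.
rewrite (_ : A - B = (A - \sum_(i <- undup (s0 ++ s1)) f i)
   + (\sum_(i <- undup (s0 ++ s1)) f i - B)); last by ring.
rewrite (le_lt_trans (cabsD _ _))// (splitr e) ltrD ?h1//.
by rewrite cabsB h0.
Qed.

Lemma has_sum_ext f g A : f =1 g -> has_sum f A -> has_sum g A.
Proof.
move=> fg h e e0; have [s0 hs] := h _ e0; exists s0 => s1 u1 h1.
by under eq_bigr do rewrite -fg; exact: hs.
Qed.

Lemma has_sumD f g A B : has_sum f A -> has_sum g B ->
  has_sum (fun i => f i + g i) (A + B).
Proof.
move=> hA hB e e0; have e2 : 0 < e / 2 by rewrite divr_gt0.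
have [s0 h0] := hA _ e2; have [s1 h1] := hB _ e2.
exists (s0 ++ s1) => s2 u2 h2; rewrite big_split /= opprD addrACA.
rewrite (le_lt_trans (cabsD _ _))// (splitr e) ltrD//.
  by apply: h0 => // x xs; apply: h2; rewrite mem_cat xs.
by apply: h1 => // x xs; apply: h2; rewrite mem_cat xs orbT.
Qed.

Lemma has_sumZ f A c : has_sum f A -> has_sum (fun i => c * f i) (c * A).
Proof.
move=> hA e e0; have c1 : 0 < cabs c + 1 by rewrite ltr_wpDl ?cabs_ge0.
have [s0 h0] := hA _ (divr_gt0 e0 c1).
exists s0 => s1 u1 h1; rewrite -mulr_sumr -mulrBr Normc.normcM.
have := h0 s1 u1 h1; rewrite ltr_pdivlMr// => h2.
apply: le_lt_trans h2; rewrite mulrC ler_wpM2l ?cabs_ge0//.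
by rewrite lerDl.
Qed.

Lemma has_sumN f A : has_sum f A -> has_sum (fun i => - f i) (- A).
Proof.
move=> /(has_sumZ (-1)); rewrite mulN1r; apply: has_sum_ext => i.
by rewrite mulN1r.
Qed.

Lemma has_sum_fin f s : uniq s -> (forall i, i \notin s -> f i = 0) ->
  has_sum f (\sum_(i <- s) f i).
Proof.
move=> us hs e e0; exists s => s1 u1 h1.
rewrite (bigID (mem s)) /= (@big1 _ _ _ _ _ (fun i => i \notin s)); last by move=> i /hs.
rewrite -big_filter addr0.
rewrite (perm_big s) ?subrr ?Normc.normc0//.
apply: uniq_perm => //; first exact: filter_uniq.
by move=> x; rewrite mem_filter; case: (boolP (x \in s)) => // /h1 ->.
Qed.

Lemma sum_le_subset (g : I -> R) s s1 : (forall i, 0 <= g i) -> uniq s -> uniq s1 ->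
  {subset s <= s1} -> \sum_(i <- s) g i <= \sum_(i <- s1) g i.
Proof.
move=> g0 us u1 h1; rewrite [leRHS](bigID (mem s)) /=.
rewrite -[X in _ <= X + _]big_filter.
rewrite (@perm_big _ _ _ _ [seq i <- s1 | i \in s] s) ?lerDl ?sumr_ge0//.
apply: uniq_perm => //; first exact: filter_uniq.
by move=> x; rewrite mem_filter /=; case: (boolP (x \in s)) => // /h1 ->.
Qed.

(** For nonnegative terms the sum is the supremum of the finite partial sums: by monotonicity every
    larger partial sum is trapped between one near the supremum and the supremum. *)
Lemma ge0_has_sum (g : I -> R) M : (forall i, 0 <= g i) -> sum_le g M ->
  exists s : R, has_sum (fun i => (g i)%:C) s%:C.
Proof.
move=> g0 gM; pose E := [set x | exists2 s : seq I, uniq s & x = \sum_(i <- s) g i].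
have hE : has_sup E.
  split; first by exists 0; exists [::] => //; rewrite big_nil.
  by exists M => x [s us ->]; exact: gM.
exists (sup E) => e e0.
have [_ [s0 u0 ->] hs] := sup_adherent e0 hE.
exists s0 => s1 u1 h1.
rewrite -(rmorph_sum (real_complex R)) -rmorphB cabs_real ltr_norml.
have h2 : \sum_(i <- s1) g i <= sup E by apply: ub_le_sup; [exact: hE.2|exists s1].
have h3 := sum_le_subset g0 u0 u1 h1.
by apply/andP; split; lra.
Qed.

(** [g] is the difference of the two nonnegative families [|g| + g] and [|g|], bounded by [2M] and
    [M]. *)
Lemma real_has_sum (g : I -> R) M : sum_le (fun i => `|g i|) M ->
  exists s : R, has_sum (fun i => (g i)%:C) s%:C.
Proof.
move=> gM.
have h1 : sum_le (fun i => (`|g i| + g i)) (M + M).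
  move=> s us; rewrite big_split lerD ?gM//= (le_trans _ (gM s us))//.
  by apply: ler_sum => i _; exact: ler_norm.
have [] := ge0_has_sum _ h1.
  by move=> i; rewrite -lerBlDr sub0r -normrN ler_norm.
move=> A hA; have [] := ge0_has_sum (fun i => normr_ge0 (g i)) gM.
move=> B hB; exists (A - B); rewrite rmorphB.
apply: has_sum_ext (has_sumD hA (has_sumN hB)) => i /=.
by rewrite rmorphD /=; ring.
Qed.

Lemma abs_le_ge0 f M : abs_le f M -> 0 <= M.
Proof. by move=> /(_ [::] isT); rewrite big_nil. Qed.

Lemma has_sum_le f A M : abs_le f M -> has_sum f A -> cabs A <= M.
Proof.
move=> fM fA; apply/ler_addgt0Pr => e e0; have [s0 hs] := fA _ e0.
have := hs (undup s0) (undup_uniq _); rewrite cabsB => /(_ _)/ltW.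
have h0 : {subset s0 <= undup s0} by move=> x; rewrite mem_undup.
move=> /(_ h0) => h.
rewrite -(subrK (\sum_(i <- undup s0) f i) A) (le_trans (cabsD _ _))//.
rewrite addrC lerD// (le_trans (cabs_sum _ _))//.
by apply: fM; exact: undup_uniq.
Qed.

Lemma abs_has_sum f M : abs_le f M -> exists2 A, has_sum f A & cabs A <= M.
Proof.
move=> fM.
have [s us|A hA] := @real_has_sum (fun i => Re (f i)) M.
  by rewrite (le_trans _ (fM s us))// ler_sum// => i _; exact: normr_Re_le.
have [s us|B hB] := @real_has_sum (fun i => Im (f i)) M.
  by rewrite (le_trans _ (fM s us))// ler_sum// => i _; exact: normr_Im_le.
have h : has_sum f (A%:C + 'i%C * B%:C).
  by apply: has_sum_ext (has_sumD hA (has_sumZ 'i%C hB)) => i; rewrite -complexE.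
by exists (A%:C + 'i%C * B%:C) => //; exact: has_sum_le h.
Qed.

Lemma abs_le_leq f (g : I -> R) M : (forall i, cabs (f i) <= g i) ->
  sum_le g M -> abs_le f M.
Proof.
by move=> h hM s us; rewrite (le_trans _ (hM s us))// ler_sum// => i _.
Qed.

Lemma sum_leZ (g : I -> R) M c : 0 <= c -> sum_le g M ->
  sum_le (fun i => c * g i) (c * M).
Proof. by move=> c0 h s us; rewrite -mulr_sumr ler_wpM2l ?h. Qed.

Lemma sum_leZr (g : I -> R) M c : 0 <= c -> sum_le g M ->
  sum_le (fun i => g i * c) (M * c).
Proof. by move=> c0 h s us; rewrite -mulr_suml ler_wpM2r ?h. Qed.

Lemma sum_leD (g h : I -> R) M N : sum_le g M -> sum_le h N ->
  sum_le (fun i => g i + h i) (M + N).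
Proof. by move=> h1 h2 s us; rewrite big_split lerD ?h1 ?h2. Qed.

Lemma has_sum_Re f A : has_sum f A -> has_sum (fun i => (Re (f i))%:C) (Re A)%:C.
Proof.
move=> h e e0; have [s0 h0] := h _ e0; exists s0 => s1 u1 h1.
rewrite -(rmorph_sum (real_complex R)) -rmorphB cabs_real.
apply: le_lt_trans (h0 s1 u1 h1); rewrite -Re_sum -ReN -ReD.
exact: normr_Re_le.
Qed.

Lemma has_sum_Im f A : has_sum f A -> has_sum (fun i => (Im (f i))%:C) (Im A)%:C.
Proof.
move=> h e e0; have [s0 h0] := h _ e0; exists s0 => s1 u1 h1.
rewrite -(rmorph_sum (real_complex R)) -rmorphB cabs_real.
apply: le_lt_trans (h0 s1 u1 h1); rewrite -Im_sum -ImN -ImD.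
exact: normr_Im_le.
Qed.

End Basic.

(** Summation by packets. Finitely many packets can be approximated simultaneously by finite pieces
    of [f]; adding to these a finite set that already approximates the total, and discarding the
    other packets, leaves a finite sum close both to [A] and to the sum of the packets. *)
Lemma has_sum_fiber (I J : eqType) (f : I -> R[i]) (p : I -> J) g M A :
  abs_le f M -> has_sum f A ->
  (forall j, has_sum (fun i => if p i == j then f i else 0) (g j)) ->
  has_sum g A.
Proof.
move=> fM fA fg e e0; have e2 : 0 < e / 2 by rewrite divr_gt0.
have [s0 h0] := fA _ e2; exists (map p s0) => s1 u1 h1.
(* The error [e / 2] is shared among the packets in [s1]; the added [1] keeps [n] positive when [s1]
   is empty. *)
pose n := (size s1)%:R + 1 : R.
have n0 : 0 < n by rewrite ltr_wpDl.
have /choice [t ht] : forall j, exists t : seq I, forall s, uniq s -> {subset t <= s} ->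
  cabs (\sum_(i <- s) (if p i == j then f i else 0) - g j) < e / 2 / n.
  by move=> j; exact: fg (divr_gt0 e2 n0).
pose s := undup (s0 ++ flatten (map t s1)).
pose s' := [seq i <- s | p i \in s1].
have us' : uniq s' by rewrite filter_uniq// undup_uniq.
have h2 : cabs (\sum_(i <- s') f i - A) < e / 2.
  apply: h0 => // x xs; rewrite mem_filter mem_undup mem_cat xs andbT.
  by apply: h1; apply: map_f.
have h3 : \sum_(i <- s') f i =
   \sum_(j <- s1) \sum_(i <- s') (if p i == j then f i else 0).
  rewrite exchange_big /= big_seq [RHS]big_seq; apply: eq_bigr => i.
  rewrite mem_filter => /andP[pi _].
  rewrite (bigD1_seq (p i)) //= eqxx big1 ?addr0// => j.
  by rewrite eq_sym => /negbTE ->.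
have h4 : cabs (\sum_(j <- s1) g j - \sum_(i <- s') f i) <= e / 2.
  rewrite h3 -sumrB (le_trans (cabs_sum _ _))//.
  apply: (@le_trans _ _ (\sum_(j <- s1) (e / 2 / n))); last first.
    rewrite big_const_seq count_predT iter_addr addr0.
    apply: (@le_trans _ _ (e / 2 / n * n)); last by rewrite divfK ?lt0r_neq0.
    by rewrite -[leLHS]mulr_natr ler_wpM2l ?lerDl// ltW// divr_gt0.
  rewrite big_seq [leRHS]big_seq; apply: ler_sum => j js1.
  rewrite cabsB ltW//.
  suff -> : \sum_(i <- s') (if p i == j then f i else 0) =
    \sum_(i <- s) (if p i == j then f i else 0).
    apply: ht; first exact: undup_uniq.
    move=> x xt; rewrite mem_undup mem_cat; apply/orP; right.
    by apply/flattenP; exists (t j) => //; exact: map_f.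
  rewrite /s' big_filter big_mkcond /=; apply: eq_bigr => i _.
  by case: ifP => // ps; case: eqP => // pij; rewrite pij js1 in ps.
rewrite -(subrK (\sum_(i <- s') f i) (\sum_(j <- s1) g j)) -addrA.
by rewrite (le_lt_trans (cabsD _ _))// (splitr e) ler_ltD.
Qed.

(** The partial inverse [k] pulls a finite list in [J] back by [pmap k]; the elements that it drops
    are those outside the image of [i], where [f] vanishes. *)
Lemma has_sum_inj (I J : eqType) (f : J -> R[i]) (i : I -> J) (k : J -> option I) A :
  pcancel i k -> ocancel k i -> (forall j, k j = None -> f j = 0) ->
  has_sum (f \o i) A -> has_sum f A.
Proof.
move=> ik ki f0 h e e0; have [s0 h0] := h _ e0.
exists (map i s0) => s1 u1 h1.
rewrite (_ : \sum_(j <- s1) f j = \sum_(j <- pmap k s1) (f \o i) j); last first.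
  elim: s1 {u1 h1} => [|j s1 IH]; first by rewrite !big_nil.
  rewrite big_cons /= IH; case E: (k j) => [x|] /=.
    by rewrite big_cons /=; have := ki j; rewrite E /= => ->.
  by rewrite f0// add0r.
apply: h0; first exact: (pmap_uniq ki).
move=> x /(map_f i) /h1 hx; rewrite mem_pmap; apply/mapP.
by exists (i x) => //; rewrite ik.
Qed.

(** A finite set of pairs lies in the product of its two projections, so the double sum can be
    bounded row by row. *)
Lemma sum_le_prod (I J : eqType) (f : I * J -> R[i]) (B : I -> R) M :
  (forall i, abs_le (fun j => f (i, j)) (B i)) -> sum_le B M -> abs_le f M.
Proof.
move=> h hB s us; pose s1 := undup (map fst s); pose s2 := undup (map snd s).
have h1 : \sum_(i <- s) cabs (f i) <= \sum_(i <- s1) \sum_(j <- s2) cabs (f (i, j)).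
  rewrite -(big_allpairs (F := fun q => cabs (f q))) /=.
  apply: (@sum_le_subset _ (fun i => cabs (f i))) => //.
  - by move=> i; exact: cabs_ge0.
  - by rewrite allpairs_uniq ?undup_uniq// => -[a b] [c d] _ _ /= [-> ->].
  - move=> [a b] hab; apply/allpairsP; exists (a, b); split => //=.
      by rewrite mem_undup; exact: (map_f fst hab).
    by rewrite mem_undup; exact: (map_f snd hab).
rewrite (le_trans h1)//; apply: le_trans (hB s1 (undup_uniq _)).
by apply: ler_sum => i _; apply: h; exact: undup_uniq.
Qed.

Lemma sum_le_prod_swap (I J : eqType) (f : I * J -> R[i]) M :
  abs_le f M -> abs_le (fun p : J * I => f (p.2, p.1)) M.
Proof.
move=> h s us; pose s' := map (fun p : J * I => (p.2, p.1)) s.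
have := h s'; rewrite /s' big_map /=; apply.
by rewrite map_inj_uniq// => -[a b] [c d] /= [-> ->].
Qed.

Lemma has_sum_pair1 (I J : eqType) (f : I * J -> R[i]) i A :
  has_sum (fun j => f (i, j)) A ->
  has_sum (fun q => if q.1 == i then f q else 0) A.
Proof.
move=> h; pose k (q : I * J) := if q.1 == i then Some q.2 else None.
apply: (@has_sum_inj _ _ _ (fun j => (i, j)) k).
- by move=> j; rewrite /k /= eqxx.
- by move=> [a b]; rewrite /k /=; case: eqP => //= ->.
- by move=> [a b]; rewrite /k /=; case: eqP.
- by apply: has_sum_ext h => j /=; rewrite eqxx.
Qed.

Lemma has_sum_prod (I J : eqType) (f : I * J -> R[i]) (g : I -> R[i]) M A :
  abs_le f M -> has_sum f A -> (forall i, has_sum (fun j => f (i, j)) (g i)) ->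
  has_sum g A.
Proof.
move=> fM fA fg; apply: (has_sum_fiber (p := fst) fM fA) => i.
exact: has_sum_pair1.
Qed.

Lemma has_sum_swap (I J : eqType) (f : I * J -> R[i]) A :
  has_sum f A -> has_sum (fun p : J * I => f (p.2, p.1)) A.
Proof.
move=> h; apply: (@has_sum_inj _ _ _ (fun p : I * J => (p.2, p.1))
   (fun p : J * I => Some (p.2, p.1))) => //; first by case.
  by case.
by apply: has_sum_ext h => -[].
Qed.

Lemma has_sum_prod2 (I J : eqType) (f : I * J -> R[i]) (g : J -> R[i]) M A :
  abs_le f M -> has_sum f A -> (forall j, has_sum (fun i => f (i, j)) (g j)) ->
  has_sum g A.
Proof.
move=> /sum_le_prod_swap fM /has_sum_swap fA fg.
exact: has_sum_prod fM fA fg.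
Qed.

(** The triangle inequality inside each fibre gives [|g j| <= h j], with [h j] the fibre sum of
    [|f|]; a finite sum of the [h j] is the sum of a subfamily of [|f|], hence at most [M]. *)
Lemma abs_le_fiber (I J : eqType) (f : I -> R[i]) (p : I -> J) g M :
  abs_le f M -> (forall j, has_sum (fun i => if p i == j then f i else 0) (g j)) ->
  abs_le g M.
Proof.
move=> fM fg s us.
have /choice [h hh] : forall j : J, exists h : R,
    has_sum (fun i => (if p i == j then cabs (f i) else 0)%:C) h%:C.
  move=> j; apply: (@ge0_has_sum _ _ M).
    by move=> i; case: ifP => // _; exact: cabs_ge0.
  move=> t ut; apply: le_trans (fM t ut); apply: ler_sum => i _.
  by case: ifP => // _; exact: cabs_ge0.
have gh j : cabs (g j) <= h j.
  apply: has_sum_le (fg j) => t ut.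
  have h1 : \sum_(i <- t) cabs (if p i == j then f i else 0) =
     \sum_(i <- t) (if p i == j then cabs (f i) else 0).
    by apply: eq_bigr => i _; case: ifP => // _; rewrite Normc.normc0.
  rewrite h1; apply/ler_addgt0Pr => e e0; have [s0 h0] := hh j _ e0.
  have := h0 (undup (s0 ++ t)) (undup_uniq _).
  rewrite -(rmorph_sum (real_complex R)) -rmorphB cabs_real => /(_ _)/ltW.
  have hs0 : {subset s0 <= undup (s0 ++ t)}.
    by move=> x xs; rewrite mem_undup mem_cat xs.
  move=> /(_ hs0); rewrite ler_norml => /andP[_ h2].
  apply: (@le_trans _ _ (\sum_(i <- undup (s0 ++ t)) (if p i == j then cabs (f i) else 0))).
    apply: (@sum_le_subset _ (fun i => if p i == j then cabs (f i) else 0)) => //.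
    - by move=> i; case: ifP => // _; exact: cabs_ge0.
    - exact: undup_uniq.
    - by move=> x xs; rewrite mem_undup mem_cat xs orbT.
  by rewrite addrC -lerBlDr.
apply: (@le_trans _ _ (\sum_(j <- s) h j)); first exact: ler_sum.
have hf : has_sum (fun i : I => \sum_(j <- s) (if p i == j then cabs (f i) else 0)%:C)
    (\sum_(j <- s) h j)%:C.
  elim: s {us} => [|j s IH].
    rewrite big_nil => e e0; exists [::] => s1 _ _; rewrite big1 ?subrr ?Normc.normc0//.
    by move=> i _; rewrite big_nil.
  rewrite big_cons rmorphD; apply: has_sum_ext (has_sumD (hh j) IH) => i.
  by rewrite big_cons.
have := has_sum_le _ hf; rewrite cabs_real => /(_ M) h1; apply: le_trans (h1 _); first exact: ler_norm.
  move=> t ut; apply: le_trans (fM t ut); apply: ler_sum => i _.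
  have [pis|pis] := boolP (p i \in s).
    rewrite (bigD1_seq (p i))//= eqxx big1 ?addr0 ?cabs_real ?ger0_norm ?cabs_ge0//.
    by move=> j; rewrite eq_sym => /negbTE ->.
  rewrite big1_seq ?Normc.normc0 ?cabs_ge0// => j /andP[_ js].
  by case: eqP => // pij; move: pis; rewrite pij js.
Qed.

Lemma abs_le_prod2 (I J : eqType) (f : I * J -> R[i]) (g : J -> R[i]) M :
  abs_le f M -> (forall j, has_sum (fun i => f (i, j)) (g j)) -> abs_le g M.
Proof.
move=> /sum_le_prod_swap fM fg; apply: (abs_le_fiber (p := fst) fM) => j.
exact: (has_sum_pair1 (f := fun p : J * I => f (p.2, p.1)) (fg j)).
Qed.

(** Row [i] of the product family has absolute bound [|f i| N], which makes the family summable; its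
    sum is then computed by rows. *)
Lemma has_sumM (I J : eqType) (f : I -> R[i]) (g : J -> R[i]) M N A B :
  abs_le f M -> abs_le g N -> has_sum f A -> has_sum g B ->
  abs_le (fun q : I * J => f q.1 * g q.2) (M * N) /\
  has_sum (fun q : I * J => f q.1 * g q.2) (A * B).
Proof.
move=> fM gN fA gB; have h : abs_le (fun q : I * J => f q.1 * g q.2) (M * N).
  apply: (@sum_le_prod _ _ _ (fun i => cabs (f i) * N)).
    move=> i s us /=; under eq_bigr do rewrite Normc.normcM.
    by apply: (sum_leZ _ gN) => //; exact: cabs_ge0.
  by apply: sum_leZr fM; exact: abs_le_ge0 gN.
split => //; have [C hC _] := abs_has_sum h.
have h2 := has_sum_prod h hC (fun i => has_sumZ (f i) gB).
rewrite (_ : A * B = C)//; apply: has_sum_unique h2.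
rewrite mulrC; apply: has_sum_ext (has_sumZ B fA) => i.
by rewrite mulrC.
Qed.

End HasSum.

(** * Power series *)

Section SeriesNat.
Variable R : realType.

Lemma has_sum_nat (u : nat -> R[i]) s : has_sum u s ->
  forall e, 0 < e -> exists N, forall n, (N <= n)%N ->
    cabs (\sum_(0 <= k < n) u k - s) < e.
Proof.
move=> h e e0; have [s0 h0] := h e e0; exists (\max_(k <- s0) k).+1 => n hn.
apply: h0; first exact: iota_uniq.
move=> x xs; rewrite mem_index_iota /= (leq_trans _ hn)// ltnS.
by rewrite (big_rem x)//= leq_maxl.
Qed.

Lemma has_sum_cseries_cvg (u : nat -> R[i]) s : has_sum u s -> cseries_cvg u s.
Proof.
move=> h; split; apply/cvgrPdist_lt => e e0; have [N hN] := has_sum_nat h e0;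
  exists N => // n /= hn; apply: le_lt_trans (hN n hn); rewrite /series/= distrC.
  by rewrite -Re_sum -ReN -ReD normr_Re_le.
by rewrite -Im_sum -ImN -ImD normr_Im_le.
Qed.

Lemma cseries_cvgE (u : nat -> R[i]) s : cseries_cvg u s -> cseries u = s.
Proof.
move=> [h1 h2]; rewrite /cseries (cvg_lim _ h1)// (cvg_lim _ h2)//.
by case: s {h1 h2}.
Qed.

Lemma has_sum_cseries (u : nat -> R[i]) s : has_sum u s -> cseries u = s.
Proof. by move=> /has_sum_cseries_cvg /cseries_cvgE. Qed.

Lemma abs_le_cseries (u : nat -> R[i]) M : abs_le u M -> has_sum u (cseries u).
Proof. by move=> /abs_has_sum[A uA _]; rewrite (has_sum_cseries uA). Qed.

(** The squares [p, q < n] eventually contain any finite set of pairs; they index the partial sums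
    in [real_analytic_at]. *)
Lemma has_sum_squares (f : nat * nat -> R[i]) s : has_sum f s ->
  forall e, 0 < e -> exists N, forall n, (N <= n)%N ->
    cabs (\sum_(p < n) \sum_(q < n) f (p : nat, q : nat) - s) < e.
Proof.
move=> h e e0; have [s0 h0] := h e e0.
exists (\max_(k <- s0) maxn k.1 k.2).+1 => n hn.
rewrite (_ : \sum_(p < n) _ = \sum_(i <- [seq (i, j) | i <- iota 0 n, j <- iota 0 n]) f i).
  apply: h0; first by rewrite allpairs_uniq ?iota_uniq// => -[a b] [c d] _ _ /= [-> ->].
  move=> [x y] xs; apply/allpairsP; exists (x, y); rewrite !mem_iota /=.
  have : (maxn x y <= \max_(k <- s0) maxn k.1 k.2)%N.
    by rewrite (big_rem (x, y))//= leq_maxl.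
  rewrite geq_max => /andP[h1 h2].
  by rewrite add0n; split => //; apply: leq_trans hn; rewrite ltnS.
have E : iota 0 n = index_iota 0 n by rewrite /index_iota subn0.
rewrite big_allpairs E big_mkord.
by apply: eq_bigr => i _; rewrite big_mkord.
Qed.

Lemma abs_le_summable (f : nat * nat -> R) M : abs_le (fun p => (f p)%:C) M ->
  summable [set: nat * nat] (fun p => (f p)%:E).
Proof.
move=> h; rewrite /summable (@le_lt_trans _ _ M%:E) ?ltry//.
apply: ge_ereal_sup => _ [A [finA _] <-]; rewrite fsbig_finite//=.
rewrite sumEFin lee_fin (le_trans _ (h _ (finmap.fset_uniq (fset_set A))))//.
by apply: ler_sum => i _; rewrite cabs_real.
Qed.

End SeriesNat.

Section PowerSeries.
Variable R : realType.

(** A power series in a real variable, absolutely convergent for [|y| <= r]. The bound [B] at radius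
    [r] is part of the data: for series depending on a Fourier frequency it must be summed over the
    frequencies. *)
Definition ps (r : R) (b : nat -> R[i]) (B : R) (Y : R -> R[i]) :=
  abs_le (fun q => b q * (r ^+ q)%:C) B /\
  forall y, `|y| <= r -> has_sum (fun q => b q * (y ^+ q)%:C) (Y y).

Lemma ps_abs_le r b B Y y : ps r b B Y -> `|y| <= r ->
  abs_le (fun q => b q * (y ^+ q)%:C) B.
Proof.
move=> [h _] yr; apply: abs_le_leq h => q.
rewrite !Normc.normcM ler_wpM2l ?cabs_ge0// !cabs_real !normrX.
by rewrite lerXn2r ?nnegrE// (le_trans yr)// ler_norm.
Qed.

Lemma ps_ge0 r b B Y : ps r b B Y -> 0 <= B.
Proof. by move=> [/abs_le_ge0]. Qed.

Lemma ps_sub r r' b B Y : 0 <= r' -> r' <= r -> ps r b B Y -> ps r' b B Y.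
Proof.
move=> r0 rr h; split; first by apply: (ps_abs_le h); rewrite ger0_norm.
by move=> y yr; apply: h.2; exact: le_trans rr.
Qed.

Lemma ps_ext r b B Y Z : (forall y, `|y| <= r -> Y y = Z y) ->
  ps r b B Y -> ps r b B Z.
Proof. by move=> YZ [h1 h2]; split => // y yr; rewrite -YZ//; exact: h2. Qed.

Lemma ps_le r b B B' Y : B <= B' -> ps r b B Y -> ps r b B' Y.
Proof. by move=> BB [h1 h2]; split => // s us; rewrite (le_trans (h1 s us)). Qed.

(** Grouping the pairs by the value of [i + j] is the Cauchy product. *)
Lemma has_sum_diag (f : nat * nat -> R[i]) M A : abs_le f M -> has_sum f A ->
  abs_le (fun n => \sum_(i < n.+1) f (i : nat, (n - i)%N)) M /\
  has_sum (fun n => \sum_(i < n.+1) f (i : nat, (n - i)%N)) A.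
Proof.
move=> fM fA; pose p (q : nat * nat) := (q.1 + q.2)%N.
have h n : has_sum (fun q => if p q == n then f q else 0)
    (\sum_(i < n.+1) f (i : nat, (n - i)%N)).
  pose s := [seq (i, (n - i)%N) | i <- iota 0 n.+1].
  have -> : \sum_(i < n.+1) f (i : nat, (n - i)%N) =
      \sum_(q <- s) (if p q == n then f q else 0).
    rewrite big_map -[iota 0 n.+1]/(index_iota 0 n.+1) big_mkord.
    by apply: eq_bigr => i _; rewrite /p /= subnKC ?eqxx// -ltnS.
  apply: has_sum_fin.
    by rewrite map_inj_uniq ?iota_uniq// => a b [].
  move=> [a b] /negP hab; case: eqP => // pab; exfalso; apply: hab.
  apply/mapP; exists a; first by rewrite mem_iota /= add0n -pab /p /= ltnS leq_addr.
  by rewrite -pab /p /= addKn.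
by split; [exact: abs_le_fiber h|exact: has_sum_fiber fM fA h].
Qed.

Lemma ps_mul r b1 b2 B1 B2 Y1 Y2 : 0 <= r -> ps r b1 B1 Y1 -> ps r b2 B2 Y2 ->
  exists b, ps r b (B1 * B2) (fun y => Y1 y * Y2 y).
Proof.
move=> r0 h1 h2; exists (fun n => \sum_(i < n.+1) b1 i * b2 (n - i)%N).
have key y n : \sum_(i < n.+1) (b1 i * (y ^+ i)%:C) * (b2 (n - i)%N * (y ^+ (n - i))%:C) =
   (\sum_(i < n.+1) b1 i * b2 (n - i)%N) * (y ^+ n)%:C.
  rewrite mulr_suml; apply: eq_bigr => i _.
  have -> : (y ^+ n)%:C = (y ^+ i)%:C * (y ^+ (n - i))%:C.
    by rewrite -rmorphM -exprD subnKC// -ltnS.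
  by ring.
have hh y (yr : `|y| <= r) := has_sumM (ps_abs_le h1 yr) (ps_abs_le h2 yr)
   (h1.2 y yr) (h2.2 y yr).
have rr : `|r| <= r by rewrite ger0_norm.
split.
  have [h _] := has_sum_diag (hh r rr).1 (hh r rr).2.
  move=> s us; apply: le_trans (h s us); apply: ler_sum => n _.
  by rewrite /= key.
move=> y yr; have [_ h] := has_sum_diag (hh y yr).1 (hh y yr).2.
by apply: has_sum_ext h => n /=; rewrite key.
Qed.

Lemma ps_scale r b B Y c : ps r b B Y ->
  ps r (fun q => c * b q) (cabs c * B) (fun y => c * Y y).
Proof.
move=> [h1 h2]; split.
  apply: (abs_le_leq (g := fun q => cabs c * cabs (b q * (r ^+ q)%:C))).
    by move=> q; rewrite -Normc.normcM mulrA.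
  by apply: sum_leZ h1; exact: cabs_ge0.
move=> y yr; apply: has_sum_ext (has_sumZ c (h2 y yr)) => q.
by rewrite mulrA.
Qed.

Lemma sum_le_nat (g : nat -> R) M : (forall q, 0 <= g q) ->
  (forall n, \sum_(0 <= k < n) g k <= M) -> sum_le g M.
Proof.
move=> g0 h s us; have [n hn] : exists n, {subset s <= iota 0 n}.
  exists (\max_(k <- s) k).+1 => k ks; rewrite mem_iota /= add0n ltnS.
  by rewrite (big_rem k)//= leq_maxl.
apply: (le_trans (sum_le_subset g0 us (iota_uniq 0 n) hn)).
by rewrite (le_trans _ (h n))// /index_iota subn0.
Qed.

Lemma sum_le_geometric (x : R) : 0 <= x -> x < 1 ->
  sum_le (fun q : nat => x ^+ q) (1 - x)^-1.
Proof.
move=> x0 x1; apply: sum_le_nat => [q|n]; first exact: exprn_ge0.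
rewrite big_mkord -[leRHS]mul1r ler_pdivlMr ?subr_gt0// mulrC.
by rewrite -(opprB x 1) mulNr -subrX1 opprB lerBlDr lerDl exprn_ge0.
Qed.

Lemma sum_inv_fact_le (x : R) : 0 <= x ->
  sum_le (fun q : nat => x ^+ q / q`!%:R) (expR x).
Proof.
move=> x0; have g0 q : 0 <= x ^+ q / q`!%:R by rewrite divr_ge0// exprn_ge0.
apply: sum_le_nat => // n.
have := @nondecreasing_cvgn_le _ (series (exp_coeff x)).
move=> /(_ _ (is_cvg_series_exp_coeff x) n); apply; apply/nondecreasing_seqP => m; rewrite /series /= big_nat_recr//= lerDl.
exact: g0.
Qed.

Lemma has_sum_of_series (u : nat -> R[i]) M s : abs_le u M -> cseries_cvg u s ->
  has_sum u s.
Proof. by move=> /abs_le_cseries h /cseries_cvgE <-. Qed.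

Lemma ps_expR (a r : R) : 0 <= r ->
  ps r (fun q => (a ^+ q / q`!%:R)%:C) (expR (`|a| * r)) (fun y => (expR (a * y))%:C).
Proof.
move=> r0; have h y : `|y| <= r ->
    abs_le (fun q => (a ^+ q / q`!%:R)%:C * (y ^+ q)%:C) (expR (`|a| * r)).
  move=> yr; apply: (abs_le_leq (g := fun q => (`|a| * r) ^+ q / q`!%:R)).
    move=> q; rewrite -rmorphM cabs_real mulrAC -exprMn normrM normrX normrM.
    rewrite [X in _ * X <= _]ger0_norm ?invr_ge0// ler_wpM2r ?invr_ge0//.
    by rewrite lerXn2r ?nnegrE ?mulr_ge0// ler_wpM2l.
  by apply: sum_inv_fact_le; rewrite mulr_ge0.
split; first by apply: h; rewrite ger0_norm.
move=> y yr; apply: (has_sum_of_series (h y yr)); split => /=.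
  rewrite (_ : series _ = series (exp_coeff (a * y))).
    exact: is_cvg_series_exp_coeff.
  congr (series _); apply/funext => n /=.
  by rewrite /exp_coeff /= mul0r subr0 exprMn mulrAC.
rewrite (_ : series _ = cst 0); first exact: cvg_cst.
apply/funext => n; rewrite /series /= big1// => i _.
by rewrite mulr0 mul0r addr0.
Qed.

Lemma ps_cis (a r : R) : 0 <= r ->
  ps r (fun q => (a%:C * 'i%C) ^+ q / q`!%:R) (expR (`|a| * r))
    (fun y => cexp ((a * y)%:C * 'i%C)).
Proof.
move=> r0; have h y : `|y| <= r ->
    abs_le (fun q => (a%:C * 'i%C) ^+ q / q`!%:R * (y ^+ q)%:C) (expR (`|a| * r)).
  move=> yr; apply: (abs_le_leq (g := fun q => (`|a| * r) ^+ q / q`!%:R)).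
    move=> q; rewrite !Normc.normcM cabsX Normc.normcM cabs_i mulr1 Normc.normcV.
    rewrite -(rmorph_nat (real_complex R)) !cabs_real normrX mulrAC -exprMn.
    rewrite [X in _ * X <= _](_ : _ = q`!%:R^-1); last by rewrite ger0_norm.
    rewrite ler_wpM2r ?invr_ge0//.
    by rewrite lerXn2r ?nnegrE ?mulr_ge0// ler_wpM2l.
  by apply: sum_inv_fact_le; rewrite mulr_ge0.
split; first by apply: h; rewrite ger0_norm.
move=> y yr; apply: (has_sum_of_series (h y yr)).
have key q : (a%:C * 'i%C) ^+ q / q`!%:R * (y ^+ q)%:C =
    (cos_coeff (a * y) q) +i* (sin_coeff (a * y) q) :> R[i].
  rewrite /cos_coeff /sin_coeff /= exprMn.
  (* Powers of [i] split by the parity of [q] into exactly the signs of [cos_coeff] and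
     [sin_coeff]. *)
  have -> : ('i%C : R[i]) ^+ q = ((~~ odd q)%:R * (-1) ^+ q./2) +i*
     ((odd q)%:R * (-1) ^+ q.-1./2).
    rewrite -{1}(odd_double_half q) exprD -mul2n exprM sqr_i.
    rewrite -(rmorphN1 (real_complex R)) -rmorphXn.
    case: (boolP (odd q)) => oq /=.
      have -> : q.-1./2 = q./2 by rewrite -{1}(odd_double_half q) oq add1n /= doubleK.
      by rewrite expr1; apply: complex_ext => /=; ring.
    by rewrite expr0; apply: complex_ext => /=; ring.
  rewrite -rmorphXn -(rmorph_nat (real_complex R)) -fmorphV.
  rewrite -(exprnP (-1) q./2) exprMn.
  by apply: complex_ext; rewrite /=; ring.
have E : (fun q => (a%:C * 'i%C) ^+ q / q`!%:R * (y ^+ q)%:C) =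
   (fun q => (cos_coeff (a * y) q) +i* (sin_coeff (a * y) q) :> R[i]).
  by apply/funext.
rewrite E (_ : (a * y)%:C * 'i%C = 0 +i* (a * y)); last first.
  by apply: complex_ext => /=; ring.
rewrite /cexp /= expR0 mul1r; split => /=.
  by rewrite unlock; exact: is_cvg_series_cos_coeff.
by rewrite unlock; exact: is_cvg_series_sin_coeff.
Qed.

End PowerSeries.

(** * Derivatives from quadratic error terms *)

Section QuadDerive.
Variable R : realType.
Implicit Types f : R -> R.

Lemma quad_is_derive f (x d r C : R) : 0 < r ->
  (forall h, `|h| < r -> `|f (x + h) - f x - d * h| <= C * h ^+ 2) ->
  is_derive x 1 f d.
Proof.
move=> r0 hf.
have h : (fun h : R => h^-1 *: (f (h *: (1 : R) + x) - f x)) @ 0^' --> d.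
  apply/cvgrPdist_lt => e e0.
  have C0 : 0 < `|C| + 1 by rewrite ltr_wpDl.
  near=> t.
  have t0 : t != 0 by near: t; exact: nbhs_dnbhs_neq.
  have tr : `|t| < r.
    by near: t; apply: dnbhs0_lt.
  have te : `|t| < e / (`|C| + 1).
    by near: t; apply: dnbhs0_lt; rewrite divr_gt0.
  have := hf t tr.
  rewrite /= [t *: 1]mulr1 [t + x]addrC.
  have -> : d - t^-1 *: (f (x + t) - f x) = t^-1 * - (f (x + t) - f x - d * t).
    by rewrite /GRing.scale /=; field.
  move=> h1; rewrite normrM normrN normfV mulrC ltr_pdivrMr ?normr_gt0//.
  apply: (le_lt_trans h1); rewrite -normr_gt0 in t0.
  rewrite -(real_normK (num_real t)) expr2 mulrA ltr_pM2r//.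
  move: te; rewrite ltr_pdivlMr// mulrC; apply: le_lt_trans.
  rewrite ler_wpM2r// (le_trans (ler_norm _))// lerDl ler01//.
by apply: DeriveDef; [apply/cvg_ex; exists d|apply: cvg_lim].
Unshelve. all: by end_near. Qed.

Lemma is_derive_unique f (x d d' : R) : is_derive x 1 f d -> is_derive x 1 f d' ->
  d = d'.
Proof. by move=> h1 h2; rewrite -(@derive_val _ _ _ _ _ _ _ h1) (@derive_val _ _ _ _ _ _ _ h2). Qed.

Lemma is_derive0_cst f (a b t u : R) :
  (forall x, a < x < b -> is_derive x 1 f 0) -> a < t < b -> a < u < b -> f t = f u.
Proof.
move=> h; wlog tu : t u / t < u.
  move=> H ht hu; case: (ltgtP t u) => [tu|ut|->//]; first exact: H.
  by apply/esym; exact: H.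
move=> /andP[at_ tb] /andP[au ub].
have [||c _] := @MVT _ f (fun=> 0) t u tu.
- by move=> x; rewrite in_itv /= => /andP[tx xu]; apply: h; rewrite (lt_trans at_)// (lt_trans xu).
- apply: derivable_within_continuous => x; rewrite in_itv /= => /andP[tx xu].
  by have [] := h x; rewrite // (lt_le_trans at_)// (le_lt_trans xu).
by rewrite mul0r => /eqP; rewrite subr_eq0 => /eqP ->.
Qed.

End QuadDerive.

Section PsDerive.
Variable R : realType.

Lemma ps_0 r b B (Y : R -> R[i]) : 0 <= r -> ps r b B Y -> Y 0 = b 0%N.
Proof.
move=> r0 [_ h]; have := h 0; rewrite normr0 => /(_ r0) h1.
apply: has_sum_unique h1 _.
have := @has_sum_fin R nat (fun q => b q * (0 ^+ q)%:C) [:: 0%N] isT.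
rewrite big_seq1 expr0 mulr1; apply => i; rewrite inE => i0.
by rewrite expr0n (negbTE i0) mulr0.
Qed.

(** [f] without its part on [s] is dominated termwise by [d] times [g]. With [g] the same series at
    the largest radius this is the Taylor remainder estimate. *)
Lemma abs_le_tail (I : eqType) (f g : I -> R[i]) A M (s : seq I) (d : R) : uniq s ->
  has_sum f A -> abs_le g M -> 0 <= d ->
  (forall i, i \notin s -> cabs (f i) <= d * cabs (g i)) ->
  cabs (A - \sum_(i <- s) f i) <= d * M.
Proof.
move=> us fA gM d0 h.
pose f' i := if i \in s then 0 else f i.
have h1 : has_sum f' (A - \sum_(i <- s) f i).
  have hs : has_sum (fun i => if i \in s then f i else 0) (\sum_(i <- s) f i).
    have -> : \sum_(i <- s) f i = \sum_(i <- s) (if i \in s then f i else 0).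
      by rewrite big_seq [RHS]big_seq; apply: eq_bigr => i ->.
    by apply: has_sum_fin => // i /negbTE ->.
  apply: has_sum_ext (has_sumD fA (has_sumN hs)) => i /=.
  by rewrite /f'; case: ifP; rewrite ?subrr// subr0.
apply: has_sum_le h1; apply: (abs_le_leq (g := fun i => d * cabs (g i))).
  move=> i; rewrite /f'; case: ifPn; last exact: h.
  by rewrite Normc.normc0 mulr_ge0// cabs_ge0.
exact: sum_leZ.
Qed.

(** For [q >= 2] and [|y| <= r] one has [|y|^q <= (y/r)^2 r^q], so all terms beyond the linear one
    together cost at most [(y/r)^2 B]. *)
Lemma ps_quad r b B (Y : R -> R[i]) y : 0 < r -> ps r b B Y -> `|y| <= r ->
  cabs (Y y - Y 0 - b 1%N * y%:C) <= B / r ^+ 2 * y ^+ 2.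
Proof.
move=> r0 h yr.
have := @abs_le_tail _ _ _ _ _ [:: 0%N; 1%N] (y ^+ 2 / r ^+ 2) isT (h.2 y yr) h.1.
rewrite !big_cons big_nil addr0 !expr0 mulr1 -(ps_0 (ltW r0) h) expr1 opprD addrA.
have -> : B / r ^+ 2 * y ^+ 2 = y ^+ 2 / r ^+ 2 * B by ring.
move=> H; apply: H; first by rewrite divr_ge0 ?sqr_ge0.
move=> q; rewrite !inE; case: q => [|[|q]]//= _.
rewrite !Normc.normcM !cabs_real mulrCA ler_wpM2l ?cabs_ge0// !normrX.
rewrite (gtr0_norm r0) -[y ^+ 2]real_normK ?num_real//.
rewrite -addn2 !exprD.
have -> : `|y| ^+ 2 / r ^+ 2 * (r ^+ q * r ^+ 2) = r ^+ q * `|y| ^+ 2.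
  by field; rewrite lt0r_neq0.
rewrite ler_wpM2r ?sqr_ge0//.
by rewrite lerXn2r ?nnegrE// ltW.
Qed.

Lemma ps_is_derive_Re r b B (Y : R -> R[i]) : 0 < r -> ps r b B Y ->
  is_derive (0 : R) 1 (fun y => Re (Y y)) (Re (b 1%N)).
Proof.
move=> r0 h; apply: (@quad_is_derive _ _ _ _ r (B / r ^+ 2) r0) => y yr.
have := ps_quad r0 h (ltW yr); rewrite add0r; apply: le_trans.
apply: le_trans (normr_Re_le _); rewrite !ReD !ReN ReM /= mulr0 subr0.
exact: lexx.
Qed.

Lemma ps_is_derive_Im r b B (Y : R -> R[i]) : 0 < r -> ps r b B Y ->
  is_derive (0 : R) 1 (fun y => Im (Y y)) (Im (b 1%N)).
Proof.
move=> r0 h; apply: (@quad_is_derive _ _ _ _ r (B / r ^+ 2) r0) => y yr.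
have := ps_quad r0 h (ltW yr); rewrite add0r; apply: le_trans.
apply: le_trans (normr_Im_le _); rewrite !ImD !ImN ImM /= mulr0 add0r.
exact: lexx.
Qed.

(** Identifies the linear coefficient by an independent computation of the derivative, in situations
    where the coefficients are known only through existence statements such as [ps_mul]. *)
Lemma ps_real_coef1 r b B (g : R -> R) d : 0 < r -> ps r b B (fun y => (g y)%:C) ->
  is_derive (0 : R) 1 g d -> b 1%N = d%:C.
Proof.
move=> r0 h hd; apply: complex_ext => /=.
  exact: is_derive_unique (ps_is_derive_Re r0 h) hd.
apply: is_derive_unique (ps_is_derive_Im r0 h) _ => /=.
exact: is_derive_cst.
Qed.

End PsDerive.

(** * The binomial series *)

Section Binomial.
Variables (R : realType) (s : R).

(** The generalised binomial coefficients, that is, the Taylor coefficients of [(1 + y)^s] at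
    [0]. *)
Let c (q : nat) : R := \prod_(i < q) ((s - i%:R) / i.+1%:R).
Let L : R := `|s| + 1.
(** Consecutive coefficients have ratio at most [L], and two termwise differentiations cost at most
    a factor [2 * 4^q]. For [|x| <= K] the bound [(4L)^q] leaves a geometric series of ratio [1/2],
    both for the series and for its first two derivatives. *)
Let K : R := (8 * L)^-1.

Let L1 : 1 <= L. Proof. by rewrite lerDr. Qed.
Let L0 : 0 < L. Proof. exact: lt_le_trans ltr01 L1. Qed.
Let K0 : 0 < K. Proof. by rewrite invr_gt0 mulr_gt0. Qed.

Let c_le q : `|c q| <= L ^+ q.
Proof.
elim: q => [|q IH]; first by rewrite /c big_ord0 normr1 expr0.
rewrite /c big_ord_recr /= -/(c q) normrM exprSr ler_pM//.
rewrite normrM normfV normr_nat ler_pdivrMr// /L mulrDl mul1r.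
rewrite (le_trans (ler_normB _ _))// normr_nat.
rewrite -natr1 mulrDr mulr1; have := normr_ge0 s; have : 0 <= q%:R :> R by [].
by move=> q0 s0; have := mulr_ge0 s0 q0; lra.
Qed.

Let cS q : q.+1%:R * c q.+1 = (s - q%:R) * c q.
Proof.
rewrite /c big_ord_recr /= mulrCA mulrC; congr (_ * _).
by rewrite mulrC divfK.
Qed.

Let pow_bound (d : nat -> R) C x : (forall q, `|d q| <= C * (4 * L) ^+ q) ->
  `|x| <= K -> abs_le (fun q => (d q * x ^+ q)%:C) (C * 2).
Proof.
move=> hd xK; have C0 : 0 <= C.
  by have := le_trans (normr_ge0 _) (hd 0%N); rewrite expr0 mulr1.
apply: (abs_le_leq (g := fun q => C * (1 / 2) ^+ q)).
  move=> q; rewrite cabs_real normrM normrX.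
  apply: (@le_trans _ _ (C * (4 * L) ^+ q * K ^+ q)).
    by rewrite ler_pM// lerXn2r// ?nnegrE// ltW.
  rewrite -mulrA -exprMn /K; have -> : 4 * L * (8 * L)^-1 = 1 / 2 :> R.
    by field; rewrite lt0r_neq0.
  exact: lexx.
apply: sum_leZ => //.
have := @sum_le_geometric R (1 / 2); rewrite (_ : (1 - 1 / 2)^-1 = 2 :> R); last by field.
by apply; lra.
Qed.

Let nat_le2 q : (q.+1%:R : R) <= 2 ^+ q.
Proof. by rewrite -natrX ler_nat ltn_expl. Qed.

Let b0 q : `|c q| <= 1 * (4 * L) ^+ q.
Proof.
rewrite mul1r (le_trans (c_le q))// lerXn2r ?nnegrE ?mulr_ge0 ?(ltW L0)//.
by rewrite ler_peMl ?(ltW L0)//; lra.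
Qed.

Let b1 q : `|pseries_diffs c q| <= L * (4 * L) ^+ q.
Proof.
rewrite /pseries_diffs normrM normr_nat.
apply: (@le_trans _ _ (2 ^+ q * L ^+ q.+1)); first by rewrite ler_pM// ?nat_le2 ?c_le.
rewrite exprS mulrCA exprMn ler_wpM2l ?(ltW L0)// ler_wpM2r ?exprn_ge0 ?(ltW L0)//.
by rewrite lerXn2r ?nnegrE//; lra.
Qed.

Let b2 q : `|pseries_diffs (pseries_diffs c) q| <= (2 * L ^+ 2) * (4 * L) ^+ q.
Proof.
rewrite /pseries_diffs !normrM !normr_nat.
apply: (@le_trans _ _ (2 ^+ q * (2 ^+ q.+1 * L ^+ q.+2))).
  by rewrite ler_pM ?mulr_ge0 ?nat_le2// ler_pM ?nat_le2 ?c_le.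
have -> : 2 ^+ q * (2 ^+ q.+1 * L ^+ q.+2) = 2 * L ^+ 2 * ((2 * 2 * L) ^+ q).
  by rewrite !exprMn exprS -[q.+2]addn2 exprD; ring.
by have -> : 2 * 2 * L = 4 * L by ring.
Qed.

Let pcvg (d : nat -> R) C : (forall q, `|d q| <= C * (4 * L) ^+ q) ->
  forall x, `|x| <= K ->
  has_sum (fun q => (d q * x ^+ q)%:C) (limn (pseries d x))%:C /\ cvgn (pseries d x).
Proof.
move=> hd x xK; have h := pow_bound hd xK.
have hh : sum_le (fun q => `|d q * x ^+ q|) (C * 2).
  by move=> t ut; have := h t ut; under eq_bigr do rewrite cabs_real.
have [A hA] := real_has_sum hh.
have [h1 _] := has_sum_cseries_cvg hA.
have h2 : pseries d x @ \oo --> A by [].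
by split; [rewrite (cvg_lim _ h2)|apply/cvg_ex; exists A].
Qed.

(** The sum [S] of the binomial series satisfies [(1 + t) S' = s S], so [S(t) (1 + t)^(-s)] has
    derivative zero and keeps its value [1] at [0]. *)
Lemma ps_powR1 : exists r b B, 0 < r < 1 /\
  ps r b B (fun y : R => ((1 + y) `^ s)%:C).
Proof.
have L8 : 1 < 8 * L.
  by apply: (@lt_le_trans _ _ 8); [rewrite ltr1n|rewrite ler_peMr].
have K1 : K < 1 by rewrite invf_lt1// (lt_trans ltr01).
pose S (t : R) : R := limn (pseries c t); pose D (t : R) : R := limn (pseries (pseries_diffs c) t).
have KK : `|K| <= K by rewrite gtr0_norm.
have hS (t : R) : `|t| < K -> is_derive t 1 S (D t).
  move=> tK; apply: (@pseries_snd_diffs _ c K).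
  - exact: (pcvg b0 KK).2.
  - exact: (pcvg b1 KK).2.
  - exact: (pcvg b2 KK).2.
  - by rewrite (gtr0_norm K0).
(* Comparison of coefficients through [cS], that is [(q+1) c_(q+1) = (s - q) c_q]; the series of
   [t D(t)] is that of [D] shifted by one place. *)
have ode t : `|t| <= K -> (1 + t) * D t = s * S t.
  move=> tK; have h0 := (pcvg b0 tK).1; have h1 := (pcvg b1 tK).1.
  have h2 : has_sum (fun q => (q%:R * c q * t ^+ q)%:C) (t * D t)%:C.
    apply: (@has_sum_inj _ _ _ _ succn (fun n => if n is m.+1 then Some m else None)) => //.
    - by case.
    - by case=> //= _; rewrite !mul0r.
    - rewrite realcM; apply: has_sum_ext (has_sumZ t%:C h1) => q /=.
      by rewrite -realcM /pseries_diffs exprS; congr (_%:C); ring.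
  apply: (@complexI R); rewrite mulrDl mul1r realcD.
  apply: (has_sum_unique (has_sumD h1 h2)); rewrite realcM.
  apply: has_sum_ext (has_sumZ s%:C h0) => q.
  by rewrite -realcM -realcD /pseries_diffs cS; congr (_%:C); ring.
have hphi (t : R) : `|t| < K -> S t = (1 + t) `^ s.
  move=> tK; pose phi (t : R) : R := S t * (1 + t) `^ (- s).
  have hd (x : R) : - K < x < K -> is_derive x 1 phi 0.
    move=> hx; have xK : `|x| < K by rewrite ltr_norml.
    have x1 : 0 < 1 + x by move: hx => /andP[]; lra.
    have hp : is_derive x 1 (fun t : R => (1 + t) `^ (- s)) (- s * (1 + x) `^ (- s - 1)).
      have := @is_derive1_comp _ (fun y => y `^ (- s)) (fun t : R => 1 + t) x _ _
        (is_derive1_powR (- s) x1) _.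
      move=> H; rewrite -[X in is_derive _ _ _ X]mulr1; apply: H.
      by rewrite -[X in is_derive _ _ _ X]add0r; apply: is_deriveD.
    have := is_deriveM (hS x xK) hp.
    set v := (X in is_derive _ _ _ X); have -> : v = 0.
      rewrite /v /GRing.scale /= [(1 + x) `^ (- s)](_ : _ = (1 + x) `^ (- s - 1) * (1 + x)).
        move: (ode x (ltW xK)); move: ((1 + x) `^ (- s - 1)) => P o.
        rewrite -[P * _ * _]mulrA o; move: (S x) => u.
        by rewrite -[LHS]/(u * (- s * P) + P * (s * u)); ring.
      rewrite -{3}[1 + x]powRr1 ?ltW// -powRD; last by rewrite (gt_eqF x1) implybT.
      by congr (_ `^ _); ring.
    by [].
  have t1 : 0 < 1 + t by move: tK; rewrite ltr_norml => /andP[]; lra.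
  have -> : S t = phi t * (1 + t) `^ s.
    rewrite /phi -mulrA -powRD; last by rewrite (gt_eqF t1) implybT.
    by rewrite addNr powRr0 mulr1.
  rewrite (@is_derive0_cst _ phi (- K) K t 0 hd); last 2 first.
  - by rewrite -ltr_norml.
  - by rewrite oppr_lt0 K0.
  have -> : phi 0 = 1.
    have K00 : `|0 : R| <= K by rewrite normr0 ltW.
    rewrite /phi addr0 powR1 mulr1 /S; have h1 := (pcvg b0 K00).1.
    apply: (@complexI R); apply: has_sum_unique h1 _.
    have := @has_sum_fin R nat (fun q => (c q * 0 ^+ q)%:C) [:: 0%N] isT.
    rewrite big_seq1 /c big_ord0 expr0 mulr1; apply => i; rewrite inE => i0.
    by rewrite expr0n (negbTE i0) mulr0.
  by rewrite mul1r.
have half (z : R) : 0 < z -> z < 1 -> [/\ 0 < z / 2 < 1, `|z / 2| <= z & z / 2 < z].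
  by move=> z0 z1; rewrite ger0_norm; [split; lra|lra].
have [K2' K2 K2''] := half K K0 K1.
exists (K / 2), (fun q => (c q)%:C), (1 * 2); split=> //.
split; first by have := pow_bound b0 K2; apply: abs_le_leq => q; rewrite -rmorphM.
move=> y yK; have yK' : `|y| < K := le_lt_trans yK K2''.
rewrite -(hphi y yK').
by apply: has_sum_ext (pcvg b0 (ltW yK')).1 => q; rewrite -rmorphM.
Qed.

End Binomial.

(** Rescaling [v + y = v (1 + y/v)]; the radius stays below [v], so the base is positive. *)
Lemma ps_powR (R : realType) (s v : R) : 0 < v -> exists r b B, [/\ 0 < r, r < v &
  ps r b B (fun y : R => ((v + y) `^ s)%:C)].
Proof.
move=> v0; have [r [b [B [/andP[r0 r1] [h1 h2]]]]] := ps_powR1 s.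
exists (r * v), (fun q => (v `^ s)%:C * (b q * (v^-1 ^+ q)%:C)), (cabs (v `^ s)%:C * B).
split; [exact: mulr_gt0|by rewrite -[ltRHS]mul1r ltr_pM2r|split].
  apply: (abs_le_leq (g := fun q => cabs (v `^ s)%:C * cabs (b q * (r ^+ q)%:C))).
    move=> q; rewrite -Normc.normcM -!mulrA -rmorphM -exprMn.
    by rewrite [v^-1 * _]mulrCA mulVf ?lt0r_neq0// mulr1.
  by apply: sum_leZ => //; exact: cabs_ge0.
move=> y yr; have := h2 (y / v).
rewrite normrM normfV (gtr0_norm v0) ler_pdivrMr// => /(_ yr)/(has_sumZ (v `^ s)%:C).
rewrite -rmorphM -powRM ?ltW//; last first.
  have : `|y / v| < 1 by rewrite normrM normfV (gtr0_norm v0) ltr_pdivrMr// (le_lt_trans yr)// ltr_pM2r.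
  by rewrite ltr_norml => /andP[]; lra.
have -> : v * (1 + y / v) = v + y by field; rewrite lt0r_neq0.
apply: has_sum_ext => q; rewrite -!mulrA -rmorphM -exprMn.
by rewrite [v^-1 * y]mulrC.
Qed.

(** * Real analyticity *)

Section DoublePowerSeries.
Variable R : realType.
Implicit Types (a : nat * nat -> R[i]) (g : R -> R -> R[i]).

Definition dps (r : R) a (M : R) g :=
  abs_le (fun p => a p * (r ^+ p.1 * r ^+ p.2)%:C) M /\
  forall x y, `|x| <= r -> `|y| <= r ->
    has_sum (fun p => a p * (x ^+ p.1 * y ^+ p.2)%:C) (g x y).

Lemma dps_abs_le r a M g x y : dps r a M g -> `|x| <= r -> `|y| <= r ->
  abs_le (fun p => a p * (x ^+ p.1 * y ^+ p.2)%:C) M.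
Proof.
move=> [h _] xr yr; have r0 : 0 <= r by exact: le_trans xr.
apply: abs_le_leq h => p; rewrite !Normc.normcM ler_wpM2l ?cabs_ge0//.
rewrite !cabs_real !normrM !normrX (ger0_norm r0) ler_pM ?exprn_ge0//.
  by rewrite lerXn2r ?nnegrE.
by rewrite lerXn2r ?nnegrE.
Qed.

Lemma dps_sub r r' a M g : 0 <= r' -> r' <= r -> dps r a M g -> dps r' a M g.
Proof.
move=> r0 rr h; split; first by apply: (dps_abs_le h); rewrite ger0_norm.
by move=> x y xr yr; apply: h.2; apply: le_trans rr.
Qed.

Lemma dps_add r a1 a2 M1 M2 g1 g2 : dps r a1 M1 g1 -> dps r a2 M2 g2 ->
  dps r (fun p => a1 p + a2 p) (M1 + M2) (fun x y => g1 x y + g2 x y).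
Proof.
move=> [h1 k1] [h2 k2]; split.
  have := sum_leD h1 h2; apply: abs_le_leq => p.
  by rewrite mulrDl cabsD.
move=> x y xr yr; apply: has_sum_ext (has_sumD (k1 x y xr yr) (k2 x y xr yr)) => p.
by rewrite mulrDl.
Qed.

Lemma dps_00 r a M g : 0 <= r -> dps r a M g -> a (0, 0)%N = g 0 0.
Proof.
move=> r0 [_ h]; have := h 0 0; rewrite normr0 => /(_ r0 r0) h1.
apply: has_sum_unique _ h1.
have := @has_sum_fin R (nat * nat)%type (fun p => a p * (0 ^+ p.1 * 0 ^+ p.2)%:C) [:: (0, 0)%N] isT.
rewrite big_seq1 /= !expr0 !mulr1; apply => -[p q]; rewrite inE => i0 /=.
have : (p != 0)%N || (q != 0)%N.
  by rewrite -negb_and; apply: contra i0 => /andP[/eqP -> /eqP ->].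
by rewrite !expr0n; case/orP => /negbTE ->; rewrite ?mul0r ?mulr0.
Qed.

(** With [m = max(|x|, |y|)], every monomial of degree at least two is at most [(m/r)^2] times its
    value at [(r, r)], and [m^2 <= x^2 + y^2]. *)
Lemma dps_quad r a M g x y : 0 < r -> dps r a M g -> `|x| <= r -> `|y| <= r ->
  cabs (g x y - g 0 0 - (a (1, 0)%N * x%:C + a (0, 1)%N * y%:C)) <=
    M / r ^+ 2 * (x ^+ 2 + y ^+ 2).
Proof.
move=> r0 h xr yr; pose m := Num.max `|x| `|y|.
have mr : m <= r by rewrite ge_max xr.
have m0 : 0 <= m by rewrite le_max normr_ge0.
have M0 : 0 <= M := abs_le_ge0 h.1.
apply: (@le_trans _ _ (m ^+ 2 / r ^+ 2 * M)); last first.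
  rewrite mulrAC [leRHS]mulrC mulrA [leRHS]mulrC mulrC ler_wpM2r// ?invr_ge0 ?sqr_ge0//.
  rewrite ler_wpM2r//.
  rewrite /m; case: (leP `|x| `|y|) => _; rewrite real_normK ?num_real//.
    by rewrite lerDr sqr_ge0.
  by rewrite lerDl sqr_ge0.
have -> : g x y - g 0 0 - (a (1, 0)%N * x%:C + a (0, 1)%N * y%:C) =
  g x y - \sum_(p <- [:: (0, 0); (1, 0); (0, 1)]%N) a p * (x ^+ p.1 * y ^+ p.2)%:C.
  rewrite !big_cons big_nil /= !expr0 !expr1 !mul1r !mulr1 (dps_00 (ltW r0) h).
  by ring.
apply: (abs_le_tail _ (h.2 x y xr yr) h.1) => //.
  by rewrite divr_ge0 ?sqr_ge0.
move=> [p q]; rewrite !inE /= => hpq.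
have pq2 : (2 <= p + q)%N.
  by case: p hpq => [|[|p]]; case: q => [|[|q]].
rewrite !Normc.normcM mulrCA ler_wpM2l ?cabs_ge0// !cabs_real !normrM !normrX.
rewrite (gtr0_norm r0) -exprD.
apply: (@le_trans _ _ (m ^+ p * m ^+ q)).
  by rewrite ler_pM ?exprn_ge0// lerXn2r ?nnegrE// /m le_max lexx ?orbT.
rewrite -exprD -(subnK pq2) !exprD.
have -> : m ^+ 2 / r ^+ 2 * (r ^+ (p + q - 2) * r ^+ 2) = r ^+ (p + q - 2) * m ^+ 2.
  by field; rewrite lt0r_neq0.
by rewrite ler_wpM2r ?sqr_ge0// lerXn2r ?nnegrE// ltW.
Qed.

(** The products [BX l * BY l] make the family over triples [(l, p, q)] absolutely summable; summing
    over [l] first yields the coefficients, summing over [(p, q)] first yields the terms of the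
    given series. The second conclusion amounts to termwise differentiation, as [a (1, 0)] and
    [a (0, 1)] are the partial derivatives at the centre. *)
Lemma dps_series (I : eqType) (c : I -> R[i]) (aX aY : I -> nat -> R[i])
    (BX BY : I -> R) (X Y : I -> R -> R[i]) r M g : 0 < r ->
  (forall l, ps r (aX l) (BX l) (X l)) -> (forall l, ps r (aY l) (BY l) (Y l)) ->
  sum_le (fun l => cabs (c l) * (BX l * BY l)) M ->
  (forall x y, `|x| <= r -> `|y| <= r ->
    has_sum (fun l => c l * (X l x * Y l y)) (g x y)) ->
  exists a, dps r a M g /\
    forall p q, has_sum (fun l => c l * (aX l p * aY l q)) (a (p, q)).
Proof.
move=> rgt0 hX hY hM hg; have r0 := ltW rgt0.
pose F x y (t : I * (nat * nat)) := c t.1 *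
  ((aX t.1 t.2.1 * (x ^+ t.2.1)%:C) * (aY t.1 t.2.2 * (y ^+ t.2.2)%:C)).
have hXY l x y (xr : `|x| <= r) (yr : `|y| <= r) := has_sumM (ps_abs_le (hX l) xr)
  (ps_abs_le (hY l) yr) ((hX l).2 x xr) ((hY l).2 y yr).
have FM x y : `|x| <= r -> `|y| <= r -> abs_le (F x y) M.
  move=> xr yr; apply: sum_le_prod hM => l s us.
  under eq_bigr do rewrite Normc.normcM.
  rewrite /= -mulr_sumr ler_wpM2l ?cabs_ge0//.
  exact: (hXY l x y xr yr).1.
have rr : `|r| <= r by rewrite ger0_norm.
have Fr l p q : cabs (F r r (l, (p, q))) = cabs (c l * (aX l p * aY l q)) * (r ^+ p * r ^+ q).
  rewrite /F /= !Normc.normcM !cabs_real !normrX (ger0_norm r0); ring.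
have FE x y l p q : F x y (l, (p, q)) = c l * (aX l p * aY l q) * (x ^+ p * y ^+ q)%:C.
  by rewrite /F /= realcM; ring.

have /choice [a ha] : forall p : nat * nat, exists A,
    has_sum (fun l => c l * (aX l p.1 * aY l p.2)) A.
  move=> [p q] /=.
  have : abs_le (fun l => c l * (aX l p * aY l q)) (M / (r ^+ p * r ^+ q)).
    move=> s us; rewrite ler_pdivlMr ?mulr_gt0 ?exprn_gt0// mulr_suml.
    have := FM r r rr rr [seq (l, (p, q)) | l <- s].
    rewrite big_map; under eq_bigr do rewrite Fr.
    by apply; rewrite map_inj_uniq// => u v [].
  by move=> /abs_has_sum[A hA _]; exists A.
exists a; split; last by move=> p q; exact: (ha (p, q)).
have hs x y p : has_sum (fun l => F x y (l, p)) (a p * (x ^+ p.1 * y ^+ p.2)%:C).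
  case: p => p q; rewrite mulrC; apply: has_sum_ext (has_sumZ _ (ha (p, q))) => l.
  by rewrite FE mulrC.
split; first exact: abs_le_prod2 (FM r r rr rr) (hs r r).
move=> x y xr yr; have [A hA _] := abs_has_sum (FM x y xr yr).
suff -> : g x y = A by exact: has_sum_prod2 (FM x y xr yr) hA (hs x y).
apply: has_sum_unique (hg x y xr yr) _.
apply: has_sum_prod (FM x y xr yr) hA _ => l.
exact: (has_sumZ (c l) (hXY l x y xr yr).2).
Qed.

(** At real arguments the monomials are real, so the real and imaginary parts of the coefficients
    expand those of the function. *)
Lemma dps_real_analytic r a M (f : R -> R -> R[i]) u v : 0 < r ->
  dps r a M (fun x y => f (u + x) (v + y)) ->
  real_analytic_at (fun u v => Re (f u v)) u v /\
  real_analytic_at (fun u v => Im (f u v)) u v.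
Proof.
move=> r0 h; split.
- exists r, (fun p q => Re (a (p, q))); split=> // x y xr yr; split.
    apply: (abs_le_summable (M := M)).
    apply: abs_le_leq (dps_abs_le h (ltW xr) (ltW yr)) => -[p q].
    rewrite cabs_real -mulrA normrM Normc.normcM cabs_real ler_wpM2r//.
    exact: normr_Re_le.
  apply/cvgrPdist_lt => e e0.
  have [N hN] := has_sum_squares (has_sum_Re (h.2 x y (ltW xr) (ltW yr))) e0.
  exists N => // n /= /hN; rewrite distrC -cabs_real; congr (cabs _ < _).
  rewrite realcB; congr (_ - _); rewrite realc_sum; apply: eq_bigr => p _.
  rewrite realc_sum; apply: eq_bigr => q _; congr (_%:C).
  by rewrite ReM /= mulr0 subr0 mulrA.
- exists r, (fun p q => Im (a (p, q))); split=> // x y xr yr; split.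
    apply: (abs_le_summable (M := M)).
    apply: abs_le_leq (dps_abs_le h (ltW xr) (ltW yr)) => -[p q].
    rewrite cabs_real -mulrA normrM Normc.normcM cabs_real ler_wpM2r//.
    exact: normr_Im_le.
  apply/cvgrPdist_lt => e e0.
  have [N hN] := has_sum_squares (has_sum_Im (h.2 x y (ltW xr) (ltW yr))) e0.
  exists N => // n /= /hN; rewrite distrC -cabs_real; congr (cabs _ < _).
  rewrite realcB; congr (_ - _); rewrite realc_sum; apply: eq_bigr => p _.
  rewrite realc_sum; apply: eq_bigr => q _; congr (_%:C).
  by rewrite ImM /= mulr0 add0r mulrA.
Qed.

End DoublePowerSeries.

(** * Wirtinger derivatives *)

Section QDiff.
Variable R : realType.
Implicit Types (F G : R[i] -> R[i]) (z h p q : R[i]).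

(* [p] and [q] are the Wirtinger derivatives of [F] at [z]; the quadratic error
   term avoids limits altogether. *)
Definition qdiff F z p q := exists r M : R, [/\ 0 < r, 0 <= M &
  forall h, cabs h < r -> cabs (F (z + h) - F z - (p * h + q * h^*%C)) <= M * cabs h ^+ 2].

Lemma qdiff_near F G z p q (r : R) : 0 < r -> (forall h, cabs h < r -> F (z + h) = G (z + h)) ->
  qdiff F z p q -> qdiff G z p q.
Proof.
move=> r0 FG [s [M [s0 M0 hM]]]; exists (Num.min r s), M; split => //.
  by rewrite lt_min r0.
move=> h; rewrite lt_min => /andP[hr hs]; rewrite -FG// -[G z](_ : F z = _); first exact: hM.
by rewrite -[z]addr0 FG// Normc.normc0.
Qed.

Lemma qdiff_ext F G z p q : F =1 G -> qdiff F z p q -> qdiff G z p q.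
Proof. by move=> FG; apply: (@qdiff_near _ _ _ _ _ 1). Qed.

Lemma qdiff_cst c z : qdiff (fun=> c) z 0 0.
Proof.
exists 1, 0; split => // h _.
by rewrite subrr !mul0r addr0 subr0 Normc.normc0.
Qed.

Lemma qdiff_id z : qdiff id z 1 0.
Proof.
exists 1, 0; split => // h _; rewrite mul1r !mul0r addr0.
by rewrite [z + h]addrC addrK subrr Normc.normc0.
Qed.

Lemma qdiff_conj z : qdiff (fun z => z^*%C) z 0 1.
Proof.
exists 1, 0; split => // h _; rewrite mul1r !mul0r add0r rmorphD /=.
by rewrite [z^*%C + _]addrC addrK subrr Normc.normc0.
Qed.

Lemma qdiffD F G z p q p' q' : qdiff F z p q -> qdiff G z p' q' ->
  qdiff (fun z => F z + G z) z (p + p') (q + q').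
Proof.
move=> [r [M [r0 M0 hM]]] [s [N [s0 N0 hN]]]; exists (Num.min r s), (M + N); split.
- by rewrite lt_min r0.
- exact: addr_ge0.
- move=> h; rewrite lt_min => /andP[hr hs].
  rewrite (_ : _ - _ = (F (z + h) - F z - (p * h + q * h^*%C)) +
    (G (z + h) - G z - (p' * h + q' * h^*%C))); last by ring.
  by rewrite (le_trans (cabsD _ _))// mulrDl lerD ?hM ?hN.
Qed.

Lemma qdiffZ c F z p q : qdiff F z p q -> qdiff (fun z => c * F z) z (c * p) (c * q).
Proof.
move=> [r [M [r0 M0 hM]]]; exists r, (cabs c * M); split => //.
  by rewrite mulr_ge0// cabs_ge0.
move=> h hr; rewrite (_ : _ - _ = c * (F (z + h) - F z - (p * h + q * h^*%C))); last by ring.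
by rewrite Normc.normcM -mulrA ler_wpM2l ?cabs_ge0// hM.
Qed.

Lemma qdiffN F z p q : qdiff F z p q -> qdiff (fun z => - F z) z (- p) (- q).
Proof.
move=> /(qdiffZ (-1)); rewrite !mulN1r; apply: qdiff_ext => w.
by rewrite mulN1r.
Qed.

Lemma qdiffB F G z p q p' q' : qdiff F z p q -> qdiff G z p' q' ->
  qdiff (fun z => F z - G z) z (p - p') (q - q').
Proof. by move=> hF /qdiffN; exact: qdiffD. Qed.

Lemma qdiff_sum (I : Type) (s : seq I) (F : I -> R[i] -> R[i]) z (p q : I -> R[i]) :
  (forall i, qdiff (F i) z (p i) (q i)) ->
  qdiff (fun z => \sum_(i <- s) F i z) z (\sum_(i <- s) p i) (\sum_(i <- s) q i).
Proof.
move=> h; elim: s => [|i s IH].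
  rewrite !big_nil; apply: qdiff_ext (qdiff_cst 0 z) => w.
  by rewrite big_nil.
rewrite !big_cons; apply: qdiff_ext (qdiffD (h i) IH) => w.
by rewrite big_cons.
Qed.

Lemma qdiff_lip F z p q : qdiff F z p q -> exists r L : R, [/\ 0 < r, 0 <= L &
  forall h, cabs h < r -> cabs (F (z + h) - F z) <= L * cabs h].
Proof.
move=> [r [M [r0 M0 hM]]]; exists r, (M * r + (cabs p + cabs q)); split => //.
  by rewrite !addr_ge0 ?mulr_ge0 ?cabs_ge0// ltW.
move=> h hr; rewrite -(subrK (p * h + q * h^*%C) (F (z + h) - F z)).
rewrite (le_trans (cabsD _ _))// mulrDl lerD//.
  apply: le_trans (hM h hr) _; rewrite expr2 mulrA ler_wpM2r ?cabs_ge0//.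
  by rewrite ler_wpM2l// ltW.
by rewrite (le_trans (cabsD _ _))// !Normc.normcM cabs_conj mulrDl.
Qed.

Lemma qdiffM F G z p q p' q' : qdiff F z p q -> qdiff G z p' q' ->
  qdiff (fun z => F z * G z) z (p * G z + F z * p') (q * G z + F z * q').
Proof.
move=> hF hG; have [r1 [L1 [r10 L10 h1]]] := qdiff_lip hF.
have [r2 [L2 [r20 L20 h2]]] := qdiff_lip hG.
move: hF hG => [r [M [r0 M0 hM]]] [s [N [s0 N0 hN]]].
exists (Num.min (Num.min r s) (Num.min r1 r2)),
  (M * cabs (G z) + cabs (F z) * N + L1 * L2); split.
- by rewrite !lt_min r0 s0 r10.
- by rewrite !addr_ge0 ?mulr_ge0 ?cabs_ge0.
- move=> h; rewrite !lt_min => /andP[/andP[hr hs] /andP[hr1 hr2]].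
  rewrite (_ : _ - _ = (F (z + h) - F z - (p * h + q * h^*%C)) * G z +
    F z * (G (z + h) - G z - (p' * h + q' * h^*%C)) +
    (F (z + h) - F z) * (G (z + h) - G z)); last by ring.
  rewrite (le_trans (cabsD _ _))// [leRHS]mulrDl lerD//.
    rewrite (le_trans (cabsD _ _))// [leRHS]mulrDl lerD// Normc.normcM.
      by rewrite mulrAC ler_wpM2r ?cabs_ge0// hM.
    by rewrite -mulrA ler_wpM2l ?cabs_ge0// hN.
  rewrite Normc.normcM expr2 mulrACA ler_pM ?cabs_ge0 ?h1 ?h2//.
Qed.

(** Conjugating the inner increment exchanges the roles of [p] and [q], which explains the mixed
    terms. Dividing [s] by [L + 1] keeps the inner increment in the disc where [F] is expanded. *)
Lemma qdiff_comp F G z p q p' q' : qdiff G z p q -> qdiff F (G z) p' q' ->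
  qdiff (fun z => F (G z)) z (p' * p + q' * q^*%C) (p' * q + q' * p^*%C).
Proof.
move=> hG [s [N [s0 N0 hN]]]; have [r1 [L [r10 L0 h1]]] := qdiff_lip hG.
move: hG => [r [M [r0 M0 hM]]].
have L1 : 0 < L + 1 by rewrite ltr_wpDl.
exists (Num.min (Num.min r r1) (s / (L + 1))), (N * L ^+ 2 + (cabs p' + cabs q') * M); split.
- by rewrite !lt_min r0 r10 divr_gt0.
- by rewrite addr_ge0 ?mulr_ge0 ?sqr_ge0 ?addr_ge0 ?cabs_ge0.
- move=> h; rewrite !lt_min => /andP[/andP[hr hr1] hs].
  pose k := G (z + h) - G z.
  have hk : cabs k <= L * cabs h by exact: h1.
  have ks : cabs k < s.
    apply: le_lt_trans hk _; move: hs; rewrite ltr_pdivlMr// mulrC; apply: le_lt_trans.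
    by rewrite ler_wpM2r ?cabs_ge0// lerDl.
  have := hN k ks; have -> : G z + k = G (z + h) by rewrite /k addrC subrK.
  move=> hF; pose e := k - (p * h + q * h^*%C).
  have he : cabs e <= M * cabs h ^+ 2 by exact: hM.
  rewrite (_ : _ - _ = (F (G (z + h)) - F (G z) - (p' * k + q' * k^*%C)) +
      (p' * e + q' * e^*%C)); last first.
    have -> : e^*%C = k^*%C - (p^*%C * h^*%C + q^*%C * h).
      apply: (etrans (conjcB _ _)); congr (_ - _).
      by rewrite conjcD !conjcM conjcK.
    rewrite /e; move: (k^*%C) => kc; ring.
  rewrite (le_trans (cabsD _ _))// mulrDl lerD//.
    apply: le_trans hF _; rewrite -mulrA ler_wpM2l// -exprMn.
    by rewrite lerXn2r ?nnegrE ?cabs_ge0 ?mulr_ge0 ?cabs_ge0.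
  rewrite (le_trans (cabsD _ _))// !Normc.normcM cabs_conj -mulrDl -mulrA.
  by rewrite ler_wpM2l ?addr_ge0 ?cabs_ge0.
Qed.

Lemma qdiff_shift F z p q : qdiff (fun h => F (z + h)) 0 p q -> qdiff F z p q.
Proof.
move=> [r [M [r0 M0 hM]]]; exists r, M; split => // h hr.
by have := hM h hr; rewrite add0r addr0.
Qed.

Lemma ReE h : (Re h)%:C = (h + h^*%C) / 2 :> R[i].
Proof. exact: ReJ_add. Qed.

Lemma ImE h : (Im h)%:C = (h - h^*%C) / (2 * 'i%C) :> R[i].
Proof.
have i0 : ('i%C : R[i]) != 0 by rewrite eq_complex /= oner_eq0 andbF.
case: h => a b /=; apply: (mulfI i0); rewrite mulrA.
apply: (@mulIf _ (2 : R[i])); first by rewrite pnatr_eq0.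
have -> : 'i%C * (a +i* b - (a -i* b)) / (2 * 'i%C) * 2 = a +i* b - (a -i* b).
  by field.
by apply: complex_ext => /=; rewrite ?mulr2n; ring.
Qed.

Lemma qdiff_ps_Re r b (B : R) (Y : R -> R[i]) : 0 < r -> ps r b B Y ->
  qdiff (fun h => Y (Re h)) 0 (b 1%N / 2) (b 1%N / 2).
Proof.
move=> r0 h; exists r, (B / r ^+ 2); split => //.
  by rewrite divr_ge0 ?(ps_ge0 h) ?sqr_ge0.
move=> k kr; rewrite add0r.
have kr' : `|Re k| <= r by rewrite (le_trans (normr_Re_le _))// ltW.
rewrite (_ : b 1%N / 2 * k + b 1%N / 2 * k^*%C = b 1%N * (Re k)%:C); last first.
  by rewrite ReE; ring.
apply: le_trans (ps_quad r0 h kr') _.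
rewrite ler_wpM2l ?divr_ge0 ?(ps_ge0 h) ?sqr_ge0// cabs_sqr.
by rewrite lerDl sqr_ge0.
Qed.

Lemma qdiff_ps_Im r b (B : R) (Y : R -> R[i]) : 0 < r -> ps r b B Y ->
  qdiff (fun h => Y (Im h)) 0 (b 1%N / (2 * 'i%C)) (- (b 1%N / (2 * 'i%C))).
Proof.
move=> r0 h; exists r, (B / r ^+ 2); split => //.
  by rewrite divr_ge0 ?(ps_ge0 h) ?sqr_ge0.
move=> k kr; rewrite add0r.
have kr' : `|Im k| <= r by rewrite (le_trans (normr_Im_le _))// ltW.
rewrite (_ : b 1%N / (2 * 'i%C) * k + - (b 1%N / (2 * 'i%C)) * k^*%C = b 1%N * (Im k)%:C); last first.
  by rewrite ImE; ring.
apply: le_trans (ps_quad r0 h kr') _.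
rewrite ler_wpM2l ?divr_ge0 ?(ps_ge0 h) ?sqr_ge0// cabs_sqr.
by rewrite lerDr sqr_ge0.
Qed.

(** At [0] the function is the product of [e^(Re h)] and [e^(i Im h)], whose conjugate derivatives
    [1/2] and [-1/2] cancel; the addition law moves this to any point. *)
Lemma qdiff_cexp z : qdiff (@cexp R) z (cexp z) 0.
Proof.
have h1 := qdiff_ps_Re ltr01 (ps_expR 1 ler01).
have h2 := qdiff_ps_Im ltr01 (ps_cis 1 ler01).
have i0 : ('i%C : R[i]) != 0 by rewrite eq_complex /= oner_eq0 andbF.
have h3 : qdiff (@cexp R) 0 1 0.
  have := qdiffM h1 h2; rewrite /= !mulr0 expR0 !expr1 mul1r.
  have -> : (0 : R)%:C * 'i%C = 0 :> R[i] by rewrite mul0r.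
  have -> : 1`!%N = 1%N by [].
  rewrite cexp0 !mulr1 !divr1 !mul1r invr1 !mul1r.
  have -> : 2^-1 + 'i%C / (2 * 'i%C) = 1 :> R[i] by field.
  have -> : 2^-1 + - ('i%C / (2 * 'i%C)) = 0 :> R[i] by field.
  apply: qdiff_ext => w; rewrite !mul1r -cexp_real -cexpD mulrC -complexE.
  by [].
apply: qdiff_shift; have := qdiffZ (cexp z) h3; rewrite mulr1 mulr0.
by apply: qdiff_ext => w; rewrite cexpD.
Qed.

Lemma qdiff_dps r a M (f : R -> R -> R[i]) z : 0 < r ->
  dps r a M (fun x y => f (Re z + x) (Im z + y)) ->
  qdiff (fun z => f (Re z) (Im z)) z
    ((a (1, 0)%N - 'i%C * a (0, 1)%N) / 2) ((a (1, 0)%N + 'i%C * a (0, 1)%N) / 2).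
Proof.
move=> r0 h; exists r, (M / r ^+ 2); split => //.
  by rewrite divr_ge0 ?(abs_le_ge0 h.1) ?sqr_ge0.
move=> k kr; have kr1 : `|Re k| <= r by rewrite (le_trans (normr_Re_le _))// ltW.
have kr2 : `|Im k| <= r by rewrite (le_trans (normr_Im_le _))// ltW.
have := dps_quad r0 h kr1 kr2; rewrite !addr0 -ReD -ImD -cabs_sqr.
congr (cabs (_ - _) <= _).
have ii : ('i%C : R[i]) * 'i%C = -1 by rewrite -expr2 sqr_i.
have i0 : ('i%C : R[i]) != 0 by rewrite eq_complex /= oner_eq0 andbF.
have -> : (Im k)%:C = - 'i%C * (k - k^*%C) / 2 :> R[i].
  rewrite ImE; apply: (mulfI i0).
  have -> : 'i%C * (- 'i%C * (k - k^*%C) / 2) = - ('i%C * 'i%C) * (k - k^*%C) / 2 by ring.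
  by rewrite ii; field.
by rewrite ReE; field.
Qed.

Lemma cquad_is_derive (g : R -> R[i]) (t r M : R) (c : R[i]) : 0 < r ->
  (forall s, `|s| < r -> cabs (g (t + s) - g t - c * s%:C) <= M * s ^+ 2) ->
  is_derive t 1 (fun t => Re (g t)) (Re c) /\ is_derive t 1 (fun t => Im (g t)) (Im c).
Proof.
move=> r0 h; split; apply: (@quad_is_derive _ _ _ _ r M r0) => s /h; apply: le_trans.
  by apply: le_trans (normr_Re_le _); rewrite !ReD !ReN ReM /= mulr0 subr0.
by apply: le_trans (normr_Im_le _); rewrite !ImD !ImN ImM /= mulr0 add0r.
Qed.

Lemma qdiff_is_derive F z p q d (g : R -> R[i]) (x : R) : qdiff F z p q -> cabs d = 1 ->
  (forall t, g (x + t) = F (z + t%:C * d)) ->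
  is_derive x 1 (fun t => Re (g t)) (Re (p * d + q * d^*%C)) /\
  is_derive x 1 (fun t => Im (g t)) (Im (p * d + q * d^*%C)).
Proof.
move=> [r [M [r0 M0 hM]]] d1 hg.
have key t : `|t| < r ->
    cabs (g (x + t) - g x - (p * d + q * d^*%C) * t%:C) <= M * t ^+ 2.
  move=> tr; have := hM (t%:C * d); rewrite Normc.normcM d1 mulr1 cabs_real => /(_ tr).
  rewrite -hg real_normK ?num_real//.
  have -> : F z = g x by rewrite -[x in RHS]addr0 hg mul0r addr0.
  by rewrite conjcM conjc_real; congr (cabs (_ - _) <= _); ring.
exact: cquad_is_derive r0 key.
Qed.

Lemma qdiff_partial_u F z p q : qdiff F z p q -> partial_u F z = p + q.
Proof.
move=> h; have [|h1 h2] := @qdiff_is_derive F z p q 1 (fun u => F (u +i* Im z)) (Re z) h (Normc.normc1 R).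
  by move=> t; rewrite mulr1; congr F; apply: complex_ext; rewrite ?ReD ?ImD //= addr0.
rewrite /partial_u !derive1E (@derive_val _ _ _ _ _ _ _ h1) (@derive_val _ _ _ _ _ _ _ h2).
by rewrite conjc1 !mulr1; case: (p + q).
Qed.

Lemma qdiff_partial_v F z p q : qdiff F z p q -> partial_v F z = 'i%C * (p - q).
Proof.
move=> h; have [|h1 h2] := @qdiff_is_derive F z p q 'i%C (fun v => F (Re z +i* v)) (Im z) h (cabs_i R).
  move=> t; congr F; apply: complex_ext; rewrite ?ReD ?ImD ?ReM ?ImM /=; ring.
rewrite /partial_v !derive1E (@derive_val _ _ _ _ _ _ _ h1) (@derive_val _ _ _ _ _ _ _ h2).
have -> : 'i%C^* = - 'i%C :> R[i] by apply: complex_ext; rewrite /= ?oppr0.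
have -> : 'i%C * (p - q) = p * 'i%C + q * - 'i%C by ring.
by case: (_ + _).
Qed.

Lemma qdiff_partial_tau F z p q : qdiff F z p q -> partial_tau F z = p.
Proof.
move=> h; rewrite /partial_tau (qdiff_partial_u h) (qdiff_partial_v h) mulrA -expr2 sqr_i.
by field.
Qed.

Lemma qdiff_partial_taubar F z p q : qdiff F z p q -> partial_taubar F z = q.
Proof.
move=> h; rewrite /partial_taubar (qdiff_partial_u h) (qdiff_partial_v h) mulrA -expr2 sqr_i.
by field.
Qed.

(** The derivative in the direction [1] is [p + q]. Agreement on a horizontal line determines only
    this sum, not [p] and [q] separately. *)
Lemma qdiff_real_line F G z p q p' q' : qdiff F z p q -> qdiff G z p' q' ->
  (forall t : R, F (z + t%:C) = G (z + t%:C)) -> p + q = p' + q'.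
Proof.
move=> hF hG FG; rewrite -(qdiff_partial_u hF) -(qdiff_partial_u hG) /partial_u.
have E u : F (u +i* Im z) = G (u +i* Im z).
  have -> : u +i* Im z = z + (u - Re z)%:C by apply: complex_ext; rewrite ?ReD ?ImD /=; ring.
  exact: FG.
by congr (_ +i* _); congr (derive1 _ _); apply/funext => u; rewrite E.
Qed.

End QDiff.

(** * Identity theorem on the strip *)

Section HolomorphicDerivative.
Variable R : realType.
Implicit Types (F D H : R[i] -> R[i]) (z p q h k : R[i]).

(** The mean value theorem is applied to the real and imaginary parts separately, whence the factor
    [2]. *)
Lemma cabs_mvt (g dg : R -> R[i]) (M : R) :
  (forall t, 0 <= t <= 1 -> is_derive (t : R) 1 (fun t => Re (g t)) (Re (dg t)) /\
     is_derive (t : R) 1 (fun t => Im (g t)) (Im (dg t))) ->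
  (forall t, 0 <= t <= 1 -> cabs (dg t) <= M) -> cabs (g 1 - g 0) <= 2 * M.
Proof.
move=> hd hM.
have key (f df : R -> R) : (forall t, 0 <= t <= 1 -> is_derive (t : R) 1 f (df t)) ->
    (forall t, 0 <= t <= 1 -> `|df t| <= M) -> `|f 1 - f 0| <= M.
  move=> h1 h2; have [||c] := @MVT _ f df 0 1 ltr01.
  - by move=> x; rewrite in_itv /= => /andP[? ?]; apply: h1; rewrite !ltW.
  - apply: derivable_within_continuous => x; rewrite in_itv /= => /h1.
    by case.
  by rewrite in_itv /= => /andP[c0 c1] ->; rewrite subr0 mulr1 h2// !ltW.
rewrite (le_trans (cabs_le_ReIm _))// mulr2n mulrDl mul1r !ReD !ImD !ReN !ImN lerD//.
  apply: (key (fun t => Re (g t)) (fun t => Re (dg t))) => t /[dup] ht.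
    by move=> /hd[].
  by move=> /hM; apply: le_trans; exact: normr_Re_le.
apply: (key (fun t => Im (g t)) (fun t => Im (dg t))) => t /[dup] ht.
  by move=> /hd[].
by move=> /hM; apply: le_trans; exact: normr_Im_le.
Qed.

Lemma qdiff_along F z p q d (x t : R) : qdiff F (z + t%:C * d) p q ->
  is_derive (t : R) 1 (fun t : R => Re (F (z + t%:C * d))) (Re (p * d + q * d^*%C)) /\
  is_derive (t : R) 1 (fun t : R => Im (F (z + t%:C * d))) (Im (p * d + q * d^*%C)).
Proof.
move=> [r [M [r0 M0 hM]]]; have d1 : 0 < cabs d + 1 by rewrite ltr_wpDl ?cabs_ge0.
have key s : `|s| < r / (cabs d + 1) ->
    cabs (F (z + (t + s)%:C * d) - F (z + t%:C * d) - (p * d + q * d^*%C) * s%:C) <=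
    (M * cabs d ^+ 2) * s ^+ 2.
  move=> sr; have := hM (s%:C * d); rewrite Normc.normcM cabs_real => H.
  have /H : `|s| * cabs d < r.
    move: sr; rewrite ltr_pdivlMr//; apply: le_lt_trans.
    by rewrite ler_wpM2l// lerDl.
  rewrite exprMn real_normK ?num_real// [s ^+ 2 * _]mulrC [M * (_ * _)]mulrA.
  rewrite conjcM conjc_real realcD mulrDl addrA.
  by rewrite (_ : p * (s%:C * d) + q * (s%:C * d^*%C) = (p * d + q * d^*%C) * s%:C); last by ring.
exact: cquad_is_derive (divr_gt0 r0 d1) key.
Qed.

(** On the segment from [z + h] to [z + h + k], the linear approximation of [D] integrates to the
    polynomial subtracted from [F]; the derivative of the difference is the quadratic error of [D]
    times [k], and [cabs_mvt] applies. *)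
Lemma taylor_path F D z p q : forall r : R, 0 < r ->
  (forall h, cabs h < r -> qdiff F (z + h) (D (z + h)) 0) -> qdiff D z p q ->
  exists s C : R, [/\ 0 < s, 0 <= C & forall h k, cabs h + cabs k < s ->
    cabs (F (z + h + k) - F (z + h) -
      ((D z + p * h + q * h^*%C) * k + (p * k ^+ 2 + q * (k * k^*%C)) / 2)) <=
    C * (cabs h + cabs k) ^+ 3].
Proof.
move=> r r0 hF [r1 [M [r10 M0 hM]]].
exists (Num.min r r1), (2 * M); split; [by rewrite lt_min r0|exact: mulr_ge0|].
move=> h k; rewrite lt_min => /andP[hkr hkr1].
pose P (t : R) := t%:C * ((D z + p * h + q * h^*%C) * k) +
  (t ^+ 2)%:C * ((p * k ^+ 2 + q * (k * k^*%C)) / 2).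
pose dP (t : R) := (D z + p * h + q * h^*%C) * k + t%:C * (p * k ^+ 2 + q * (k * k^*%C)).
pose g (t : R) := F (z + h + t%:C * k) - P t.
pose dg (t : R) := D (z + h + t%:C * k) * k - dP t.
have tk t : 0 <= t <= 1 -> cabs (h + t%:C * k) <= cabs h + cabs k.
  move=> /andP[t0 t1]; rewrite (le_trans (cabsD _ _))// lerD2l Normc.normcM cabs_real.
  by rewrite ger0_norm// ler_piMl// cabs_ge0.
have -> : F (z + h + k) - F (z + h) -
      ((D z + p * h + q * h^*%C) * k + (p * k ^+ 2 + q * (k * k^*%C)) / 2) = g 1 - g 0.
  by rewrite /g /P expr1n expr0n /= !mul0r !mul1r !addr0; ring.
rewrite -mulrA; apply: (@cabs_mvt g dg).
  move=> t ht; have hq : qdiff F (z + h + t%:C * k) (D (z + h + t%:C * k)) 0.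
    by rewrite -addrA; apply: hF; rewrite (le_lt_trans (tk t ht)).
  have [d1 d2] := qdiff_along 0 hq.
  have hP : cabs 1 = 1 :> R by rewrite Normc.normc1.
  have qP (s : R) : cabs (P (t + s) - P t - dP t * s%:C) <= cabs ((p * k ^+ 2 + q * (k * k^*%C)) / 2) * s ^+ 2.
    rewrite (_ : _ - _ = (s ^+ 2)%:C * ((p * k ^+ 2 + q * (k * k^*%C)) / 2)).
      by rewrite Normc.normcM cabs_real ger0_norm ?sqr_ge0// mulrC.
    by rewrite /P /dP !realcX realcD; field.
  have [e1 e2] : is_derive (t : R) 1 (fun t => Re (P t)) (Re (dP t)) /\
      is_derive (t : R) 1 (fun t => Im (P t)) (Im (dP t)).
    by apply: (cquad_is_derive ltr01) => s _; exact: qP.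
  rewrite mul0r addr0 in d1 d2.
  split.
    rewrite [X in is_derive _ _ _ X]ReB.
    rewrite (_ : (fun u => Re (g u)) = (fun t : R => Re (F (z + h + t%:C * k))) - (fun t => Re (P t))).
      exact: is_deriveB.
    by apply/funext => u; exact: ReB.
  rewrite [X in is_derive _ _ _ X]ImB.
  rewrite (_ : (fun u => Im (g u)) = (fun t : R => Im (F (z + h + t%:C * k))) - (fun t => Im (P t))).
    exact: is_deriveB.
  by apply/funext => u; exact: ImB.
move=> t ht; have tr : cabs (h + t%:C * k) < r1 by rewrite (le_lt_trans (tk t ht)).
have := hM _ tr; rewrite addrA.
have -> : dg t = (D (z + h + t%:C * k) - D z - (p * (h + t%:C * k) + q * (h + t%:C * k)^*%C)) * k.
  by rewrite /dg /dP conjcD conjcM conjc_real; ring.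
move=> hh; rewrite Normc.normcM [_ ^+ 3]exprSr mulrA ler_pM ?cabs_ge0 ?lerDr ?cabs_ge0//.
apply: le_trans hh _; rewrite ler_wpM2l// lerXn2r ?nnegrE ?addr_ge0 ?cabs_ge0//.
exact: tk.
Qed.

(* Comparing the two paths [z -> z + h -> z + h + ih] and [z -> z + (1 + i) h]
   shows that the derivative of a holomorphic function is holomorphic. *)
Lemma qdiff_symm F D z p q (r : R) : 0 < r ->
  (forall h, cabs h < r -> qdiff F (z + h) (D (z + h)) 0) ->
  qdiff D z p q -> q = 0.
Proof.
move=> r0 hF hD; have [s [C [s0 C0 hC]]] := taylor_path r0 hF hD.
apply: cabs_le0_eq => e e0.
(* The three remainders below are at most [8 C t^3], [C t^3] and [8 C t^3], so [32 C t^3] is a safe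
   total; after division by [t^2], the second bound on [t] brings it below [e]. *)
pose t := Num.min (s / 4) (e / (C * 32 + 1)) / 2.
have C1 : 0 < C * 32 + 1 by rewrite ltr_wpDl// mulr_ge0.
have m0 : 0 < Num.min (s / 4) (e / (C * 32 + 1)) by rewrite lt_min !divr_gt0.
have t0 : 0 < t by rewrite divr_gt0.
have tm : t < Num.min (s / 4) (e / (C * 32 + 1)) by rewrite ltr_pdivrMr// ltr_pMr// ltr1n.
move: tm; rewrite lt_min => /andP[ts te].
pose h : R[i] := t%:C; pose k : R[i] := t%:C * 'i%C.
have ah : cabs h = t by rewrite cabs_real gtr0_norm.
have ak : cabs k = t by rewrite Normc.normcM cabs_i mulr1.
have hk : cabs (h + k) <= t + t by rewrite (le_trans (cabsD _ _))// ah ak.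
have c0 : cabs (0 : R[i]) = 0 by exact: Normc.normc0.
have ts4 : t * 4 < s by move: ts; rewrite ltr_pdivlMr.
have H1 := hC 0 (h + k); have H2 := hC 0 h; have H3 := hC h k.
rewrite c0 !add0r ?addr0 in H1 H2; rewrite ah ak in H2 H3.
have {}H1 := H1 (le_lt_trans hk _); have {}H2 := H2 _; have {}H3 := H3 _.
have l1 : t + t < s by lra.
have l2 : t < s by lra.
have {}H1 := H1 l1; have {}H2 := H2 l2; have {}H3 := H3 l1.
have E0 : D z + p * 0 + q * 0^*%C = D z by rewrite conjc_0 !mulr0 !addr0.
rewrite E0 in H1 H2.
(* The values of [F] telescope and the terms in [D z] and [p] cancel. Among the conjugate terms the
   cross term [q conj(h) k = q t^2 i] survives. *)
have key : q * (t ^+ 2)%:C * 'i%C = 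
  (F (z + (h + k)) - F z - (D z * (h + k) + (p * (h + k) ^+ 2 + q * ((h + k) * (h + k)^*%C)) / 2))
  - (F (z + h) - F z - (D z * h + (p * h ^+ 2 + q * (h * h^*%C)) / 2))
  - (F (z + h + k) - F (z + h) - ((D z + p * h + q * h^*%C) * k + (p * k ^+ 2 + q * (k * k^*%C)) / 2)).
  rewrite (addrA z h k) conjcD /k /h conjcM conjc_real conjci realcX.
  have ii := ic_ic R; move: (F (z + t%:C + t%:C * 'i%C)) (F (z + t%:C)) => B A.
  have -> : t%:C * 'i%C * (t%:C * - 'i%C) = t%:C * t%:C :> R[i].
    have -> : t%:C * 'i%C * (t%:C * - 'i%C) = - (t%:C * t%:C * ('i%C * 'i%C)) :> R[i] by ring.
    by rewrite ii; ring.
  have -> : (t%:C + t%:C * 'i%C) * (t%:C + t%:C * - 'i%C) = 2 * (t%:C * t%:C) :> R[i].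
    have -> : (t%:C + t%:C * 'i%C) * (t%:C + t%:C * - 'i%C) =
      t%:C * t%:C - t%:C * t%:C * ('i%C * 'i%C) :> R[i] by ring.
    by rewrite ii; ring.
  by field.
have q2 : cabs q * t ^+ 2 <= C * 32 * t ^+ 3.
  have -> : cabs q * t ^+ 2 = cabs (q * (t ^+ 2)%:C * 'i%C).
    by rewrite !Normc.normcM cabs_i mulr1 cabs_real ger0_norm ?sqr_ge0.
  rewrite key (le_trans (cabsD _ _))// cabsN.
  have : C * cabs (h + k) ^+ 3 <= C * (t + t) ^+ 3.
    by rewrite ler_wpM2l// lerXn2r ?nnegrE ?cabs_ge0// addr_ge0 ?ltW.
  move=> H4; have t3 : 0 <= C * t ^+ 3 by rewrite mulr_ge0// exprn_ge0// ltW.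
  have t33 : C * (t + t) ^+ 3 = 8 * (C * t ^+ 3) by ring.
  have H5 := cabsD (F (z + (h + k)) - F z - (D z * (h + k) + (p * (h + k) ^+ 2 + q * ((h + k) * (h + k)^*%C)) / 2))
   (- (F (z + h) - F z - (D z * h + (p * h ^+ 2 + q * (h * h^*%C)) / 2))).
  rewrite cabsN in H5.
  have -> : C * 32 * t ^+ 3 = 32 * (C * t ^+ 3) by ring.
  by rewrite t33 in H3 H4; lra.
have : cabs q <= C * 32 * t.
  rewrite -(ler_pM2r (exprn_gt0 2 t0)); apply: le_trans q2 _.
  by rewrite [t ^+ 3]exprS mulrA.
move=> /le_lt_trans; apply; move: te; rewrite ltr_pdivlMr// mulrC; apply: le_lt_trans.
by rewrite ler_wpM2r ?lerDl// ltW.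
Qed.

(** A second order expansion in [h] alone, without conjugate terms. Cubic precision is what the
    maximum principle needs, as it compares with a quadratic perturbation. *)
Definition taylor2 F z := exists r C : R, exists a b : R[i], [/\ 0 < r, 0 <= C &
  forall h, cabs h < r -> cabs (F (z + h) - F z - (a * h + b * h ^+ 2)) <= C * cabs h ^+ 3].

Lemma qdiff_taylor2 F D z p q (r : R) : 0 < r ->
  (forall h, cabs h < r -> qdiff F (z + h) (D (z + h)) 0) ->
  qdiff D z p q -> taylor2 F z.
Proof.
move=> r0 hF hD; have q0 := qdiff_symm r0 hF hD.
have [s [C [s0 C0 hC]]] := taylor_path r0 hF hD.
exists s, C, (D z), (p / 2); split => // h hs; have := hC 0 h.
rewrite Normc.normc0 add0r addr0 => /(_ hs).
rewrite q0 mulr0 mul0r addr0 mul0r !addr0.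
by rewrite (_ : p * h ^+ 2 / 2 = p / 2 * h ^+ 2); last by ring.
Qed.

End HolomorphicDerivative.

(** * Maximum principle on rectangles *)

Section MaxPrinciple.
Variable R : realType.
Implicit Types (F D H : R[i] -> R[i]) (z p q h k : R[i]).

(** The increments [d], [-d], [id], [-id] sum to zero, and so do their squares; the linear and
    quadratic terms cancel, which leaves one side of the mean value property up to [C d^3]. *)
Let four_points H (z : R[i]) : taylor2 H z -> exists r C : R, [/\ 0 < r, 0 <= C &
  forall d, 0 < d -> d < r -> 4 * Re (H z) <= Re (H (z + d%:C)) + Re (H (z + (- d)%:C)) +
    (Re (H (z + (0 +i* d))) + Re (H (z + (0 -i* d)))) + 4 * (C * d ^+ 3)].
Proof.
move=> [r [C [a [b [r0 C0 hC]]]]]; exists r, C; split => // d d0 dr.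
have hG h : cabs h = d ->
    Re (H z) + Re (a * h + b * h ^+ 2) - C * d ^+ 3 <= Re (H (z + h)).
  move=> hd; have := hC h; rewrite hd => /(_ dr).
  move/(le_trans (normr_Re_le _)); rewrite ler_norml => /andP[+ _].
  by rewrite !ReB; lra.
have n1 : cabs d%:C = d by rewrite cabs_real gtr0_norm.
have n2 : cabs (- d)%:C = d by rewrite cabs_real normrN gtr0_norm.
have n3 : cabs (0 +i* d) = d by rewrite /= expr0n add0r sqrtr_sqr gtr0_norm.
have n4 : cabs (0 -i* d) = d by rewrite /= expr0n add0r sqrrN sqrtr_sqr gtr0_norm.
have := hG _ n1; have := hG _ n2; have := hG _ n3; have := hG _ n4.
have : Re (a * d%:C + b * d%:C ^+ 2) + Re (a * (- d)%:C + b * (- d)%:C ^+ 2) +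
   (Re (a * (0 +i* d) + b * (0 +i* d) ^+ 2) + Re (a * (0 -i* d) + b * (0 -i* d) ^+ 2)) = 0.
  by case: (a) => a1 a2; case: (b) => b1 b2; rewrite !expr2 /=; ring.
set E1 := Re (a * _ + _); set E2 := Re (a * _ + _).
set E3 := Re (a * _ + _); set E4 := Re (a * _ + _).
move: E1 E2 E3 E4 (Re (H _)) (Re (H _)) (Re (H _)) (Re (H _)) (Re (H _)) => *; lra.
Qed.

Let in_between (l u v w : R) : 0 < w -> w < v - l -> w < u - v ->
  l <= v + w <= u /\ l <= v - w <= u.
Proof. by move=> w0 h1 h2; split; apply/andP; split; lra. Qed.

Let cont2 H (P : R * R -> R) (A : set (R * R)) :
  (forall x y, A (x, y) -> exists r L : R, 0 < r /\ forall x' y', `|x' - x| < r -> `|y' - y| < r ->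
     `|P (x', y') - P (x, y)| <= L * (`|x' - x| + `|y' - y|)) ->
  {within A, continuous P}.
Proof.
move=> h; apply: continuous_in_subspaceT => -[x y] /set_mem /h [r [L [r0 hL]]].
apply/cvgrPdist_lt => e e0.
have L1 : 0 < `|L| + 1 by rewrite ltr_wpDl.
have d0 : 0 < Num.min r (e / (2 * (`|L| + 1))) by rewrite lt_min r0 divr_gt0// mulr_gt0.
exists (ball x (Num.min r (e / (2 * (`|L| + 1)))), ball y (Num.min r (e / (2 * (`|L| + 1))))).
  by split; exact: nbhsx_ballx.
move=> [x' y'] [/= bx by_].
move: bx by_; rewrite /ball /= !lt_min => /andP[x1 x2] /andP[y1 y2].
rewrite distrC in x1 x2; rewrite distrC in y1 y2; rewrite distrC.
apply: (le_lt_trans (hL x' y' x1 y1)).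
move: x2 y2; rewrite !ltr_pdivlMr ?mulr_gt0// => x2 y2.
have x3 : 0 <= `|x' - x| by []. have y3 : 0 <= `|y' - y| by [].
apply: (@le_lt_trans _ _ ((`|L| + 1) * (`|x' - x| + `|y' - y|))).
  by rewrite ler_wpM2r ?addr_ge0// (le_trans (ler_norm _))// lerDl.
move: x2 y2; rewrite mulrA mulrA => x2 y2.
by rewrite mulrDr; lra.
Qed.

Let re_cont H (A : set (R * R)) (f : R[i] -> R) :
  (forall z w, `|f z - f w| <= cabs (z - w)) ->
  (forall x y, A (x, y) -> exists p q, qdiff H (x +i* y) p q) ->
  {within A, continuous (fun t : R * R => f (H (t.1 +i* t.2)))}.
Proof.
move=> hf hA; apply: (cont2 H) => x y /hA [p [q /qdiff_lip [r [L [r0 L0 hL]]]]].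
exists (r / 2), L; split; first by rewrite divr_gt0.
move=> x' y' xr yr /=; apply: le_trans (hf _ _) _.
have E : x' +i* y' = (x +i* y) + ((x' - x) +i* (y' - y)) by apply: complex_ext => /=; ring.
have le1 : cabs ((x' - x) +i* (y' - y)) <= `|x' - x| + `|y' - y| := cabs_le_ReIm _.
rewrite E; apply: le_trans (hL _ _) _; last by rewrite ler_wpM2l.
by apply: le_lt_trans le1 _; lra.
Qed.

Definition rect (x1 x2 y1 y2 : R) : set (R * R) := `[x1, x2] `*` `[y1, y2].

Lemma rect_compact (x1 x2 y1 y2 : R) : compact (rect x1 x2 y1 y2).
Proof. by apply: compact_setX; exact: segment_compact. Qed.

Lemma rectE (x1 x2 y1 y2 x y : R) :
  rect x1 x2 y1 y2 (x, y) <-> (x1 <= x <= x2) /\ (y1 <= y <= y2).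
Proof. by rewrite /rect /= !in_itv /=. Qed.

Lemma qdiff_bounded H (x1 x2 y1 y2 : R) : x1 <= x2 -> y1 <= y2 ->
  (forall x y, x1 <= x <= x2 -> y1 <= y <= y2 -> exists p q, qdiff H (x +i* y) p q) ->
  exists M, forall x y, x1 <= x <= x2 -> y1 <= y <= y2 -> cabs (H (x +i* y)) <= M.
Proof.
move=> hx hy hH.
have [||c _ hc] := @compact_EVT_max _ _ (fun t : R * R => cabs (H (t.1 +i* t.2)))
  (rect x1 x2 y1 y2) _ (@rect_compact x1 x2 y1 y2).
- by exists (x1, y1); apply/rectE; rewrite !lexx.
- by apply: re_cont => [z w|x y /rectE[]]; [exact: cabs_dist|exact: hH].
exists (cabs (H (c.1 +i* c.2))) => x y xr yr.
by apply: (hc (x, y)); apply/mem_set/rectE.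
Qed.

(** Adding [ep] times the squared distance to a corner makes the real part strictly subharmonic: at
    an interior maximum of [Q] the four neighbours at distance [t] would give [4 ep t^2 <= 4 C t^3],
    impossible for small [t]. Hence [Q] is maximal on the boundary, and [ep] is so small that the
    perturbation never exceeds [e]. *)
Lemma max_principle H (x1 x2 y1 y2 m : R) : x1 <= x2 -> y1 <= y2 ->
  (forall x y, x1 <= x <= x2 -> y1 <= y <= y2 -> exists p q, qdiff H (x +i* y) p q) ->
  (forall x y, x1 < x < x2 -> y1 < y < y2 -> taylor2 H (x +i* y)) ->
  (forall x y, x1 <= x <= x2 -> y1 <= y <= y2 ->
     x = x1 \/ x = x2 \/ y = y1 \/ y = y2 -> Re (H (x +i* y)) <= m) ->
  forall x y, x1 <= x <= x2 -> y1 <= y <= y2 -> Re (H (x +i* y)) <= m.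
Proof.
move=> hx hy hH hT hb x y xr yr; apply/ler_addgt0Pr => e e0.
pose B := (x2 - x1) ^+ 2 + (y2 - y1) ^+ 2 + 1.
have B0 : 0 < B by rewrite ltr_wpDl ?addr_ge0 ?sqr_ge0.
pose ep : R := e / B; have ep0 : 0 < ep by rewrite divr_gt0.
pose Q (t : R * R) := Re (H (t.1 +i* t.2)) + ep * ((t.1 - x1) ^+ 2 + (t.2 - y1) ^+ 2).
have Qc : {within rect x1 x2 y1 y2, continuous Q}.
  move=> t; apply: (@continuousD _ R _ (fun t : subspace (rect x1 x2 y1 y2) => Re (H (t.1 +i* t.2)))).
    apply: re_cont => [z w|u v /rectE[]]; last exact: hH.
    by rewrite -ReB normr_Re_le.
  apply: cont2 => // u v /rectE[hu hv].
  exists 1, (ep * (2 * (x2 - x1) + 2 * (y2 - y1) + 2)); split => // x' y' h1 h2 /=.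
  have -> : ep * ((x' - x1) ^+ 2 + (y' - y1) ^+ 2) - ep * ((u - x1) ^+ 2 + (v - y1) ^+ 2) =
    ep * ((x' - u) * ((x' - u) + 2 * (u - x1)) + (y' - v) * ((y' - v) + 2 * (v - y1))) by ring.
  rewrite normrM (gtr0_norm ep0) -[leRHS]mulrA ler_wpM2l ?(ltW ep0)//.
  rewrite (le_trans (ler_normD _ _))// [leRHS]mulrDr lerD// normrM mulrC ler_wpM2r//.
    move: h1; rewrite ltr_norml ler_norml => /andP[? ?]; move/andP: hu => [? ?].
    by apply/andP; split; lra.
  move: h2; rewrite ltr_norml ler_norml => /andP[? ?]; move/andP: hv => [? ?].
  by apply/andP; split; lra.
have [|[c d] /set_mem/rectE[hc hd] hmax] := @compact_EVT_max _ _ Q (rect x1 x2 y1 y2) _ (@rect_compact x1 x2 y1 y2) Qc.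
  by exists (x1, y1); apply/rectE; rewrite !lexx.
have hmax' u v : x1 <= u <= x2 -> y1 <= v <= y2 -> Q (u, v) <= Q (c, d).
  by move=> h1 h2; apply: hmax; apply/mem_set/rectE.
have bd : c = x1 \/ c = x2 \/ d = y1 \/ d = y2.
  have [->|c1] := eqVneq c x1; first by left.
  have [->|c2] := eqVneq c x2; first by right; left.
  have [->|d1] := eqVneq d y1; first by right; right; left.
  have [->|d2] := eqVneq d y2; first by right; right; right.
  exfalso; move/andP: (hc) => [hc1 hc2]; move/andP: (hd) => [hd1 hd2].
  have lc1 : x1 < c by rewrite lt_neqAle eq_sym c1.
  have lc2 : c < x2 by rewrite lt_neqAle c2.
  have ld1 : y1 < d by rewrite lt_neqAle eq_sym d1.
  have ld2 : d < y2 by rewrite lt_neqAle d2.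
  have T : taylor2 H (c +i* d) by apply: hT; apply/andP.
  have [r [C [r0 C0 hC]]] := four_points T.
  pose m1 := Num.min (Num.min (c - x1) (x2 - c)) (Num.min (d - y1) (y2 - d)).
  have C1 : 0 < C + 1 by rewrite ltr_wpDl.
  (* [t] stays inside the rectangle and inside the radius of expansion, and [t < ep / (C + 1)]
     forces [C t^3 < ep t^2]. *)
  pose m2 := Num.min m1 (Num.min r (ep / (C + 1))).
  have m20 : 0 < m2 by rewrite !lt_min !subr_gt0 lc1 lc2 ld1 ld2 r0 divr_gt0.
  pose t := m2 / 2; have t0 : 0 < t by rewrite divr_gt0.
  have : t < m2 by rewrite ltr_pdivrMr// ltr_pMr// ltr1n.
  rewrite !lt_min => /andP[/andP[/andP[t1 t2] /andP[t3 t4]] /andP[tr te]].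
  have := hC t t0 tr; clearbody t.
  have := hmax' (c + t) d; have := hmax' (c - t) d.
  have := hmax' c (d + t); have := hmax' c (d - t).
  rewrite /Q /= hc hd; move=> h1 h2 h3 h4.
  have [a1 a2] := in_between t0 t1 t2.
  have [a3 a4] := in_between t0 t3 t4.
  have {}h1 := h1 isT a4; have {}h2 := h2 isT a3.
  have {}h3 := h3 a2 isT; have {}h4 := h4 a1 isT.
  have -> : (c +i* d) + t%:C = (c + t) +i* d by apply: complex_ext => /=; ring.
  have -> : (c +i* d) + (- t)%:C = (c - t) +i* d by apply: complex_ext => /=; ring.
  have -> : (c +i* d) + (0 +i* t) = c +i* (d + t) by apply: complex_ext => /=; ring.
  have -> : (c +i* d) + (0 -i* t) = c +i* (d - t) by apply: complex_ext => /=; ring.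
  have Ct : C * t ^+ 3 < ep * t ^+ 2.
    rewrite exprS mulrA ltr_pM2r ?exprn_gt0//.
    move: te; rewrite ltr_pdivlMr// mulrC; apply: le_lt_trans.
    by rewrite ler_wpM2r ?lerDl// ltW.
  have e1 : ep * ((c + t - x1) ^+ 2 + (d - y1) ^+ 2) + ep * ((c - t - x1) ^+ 2 + (d - y1) ^+ 2) +
     (ep * ((c - x1) ^+ 2 + (d + t - y1) ^+ 2) + ep * ((c - x1) ^+ 2 + (d - t - y1) ^+ 2)) =
     4 * (ep * ((c - x1) ^+ 2 + (d - y1) ^+ 2)) + 4 * (ep * t ^+ 2) by ring.
  move: h1 h2 h3 h4 e1 Ct; move: (Re (H _)) (Re (H _)) (Re (H _)) (Re (H _)) (Re (H _)) (ep * (_ + _)) (ep * (_ + _)) (ep * (_ + _)) (ep * (_ + _)) (ep * (_ + _)) => *.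
  lra.
have : Q (x, y) <= Q (c, d) by exact: hmax'.
have := hb c d hc hd bd; rewrite /Q /=.
move=> h1 h2; have h3 : 0 <= ep * ((x - x1) ^+ 2 + (y - y1) ^+ 2).
  by rewrite mulr_ge0 ?addr_ge0 ?sqr_ge0// ltW.
have h4 : ep * ((c - x1) ^+ 2 + (d - y1) ^+ 2) <= e.
  rewrite -[leRHS](divfK (lt0r_neq0 B0)) -/ep ler_wpM2l ?(ltW ep0)//.
  move/andP: hc => [? ?]; move/andP: hd => [? ?].
  rewrite /B -[leLHS]addr0 lerD// lerD// lerXn2r ?nnegrE; lra.
lra.
Qed.

End MaxPrinciple.

(** * Identity theorem by Gaussian weights *)

Section Continuation.
Variable R : realType.
Implicit Types (F D H : R[i] -> R[i]) (z p q h k : R[i]).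

Definition strip z : bool := - (pi / 2) < Im z < pi / 2.

Lemma strip_open z : strip z -> exists2 r : R, 0 < r & forall h, cabs h < r -> strip (z + h).
Proof.
move=> /andP[h1 h2]; exists (Num.min (Im z + pi / 2) (pi / 2 - Im z)).
  by rewrite lt_min; apply/andP; split; lra.
move=> h; rewrite lt_min => /andP[r1 r2]; have := normr_Im_le h.
by rewrite ler_norml => /andP[i1 i2]; rewrite /strip ImD; apply/andP; split; lra.
Qed.

(* The weight [exp (lam * ((Im z - a)^2 - (Re z - s)^2))] is at most 1 on the
   part of the boundary of the rectangle where [F] need not vanish, and is
   exponentially large at the given point. *)
Let continuation_up F D z : (forall z, strip z -> qdiff F z (D z) 0) ->
  (forall z, strip z -> exists p q, qdiff D z p q) ->
  (forall x : R, F x%:C = 0) -> strip z -> 0 < Im z -> F z = 0.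
Proof.
move=> hF hD hR zs z0; case: z zs z0 => s t; rewrite /strip /= => /andP[_ t1] t0.
pose a := (t + pi / 2) / 2; have ta : t < a by rewrite /a; lra.
have ap : a < pi / 2 by rewrite /a; lra.
have a0 : 0 < a by lra.
clearbody a.
have in_strip x y : 0 <= y <= a -> strip (x +i* y).
  by move=> /andP[y0 ya]; rewrite /strip /=; apply/andP; split; lra.
(* The rectangle [[s - a, s + a] x [0, a]] has half-width equal to its height: on the vertical sides
   [(x - s)^2 = a^2 >= (y - a)^2], which keeps the weight at most 1 there. *)
have hx : s - a <= s + a by lra.
have [M hM] := @qdiff_bounded _ F _ _ _ _ hx (ltW a0) (fun x y _ hy =>
  ex_intro _ _ (ex_intro _ _ (hF _ (in_strip x y hy)))).
(* Multiplication by the conjugate of the value turns the real part at the point into [|F|^2] times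
   the weight, so a bound on real parts suffices. *)
pose c := (F (s +i* t))^*%C.
pose w : R[i] := s +i* a.
(* The exponential gain at the point is used only through [e^x >= 1 + x]; growth linear in [n]
   already contradicts a fixed bound. *)
have key (n : nat) : cabs (F (s +i* t)) ^+ 2 * (1 + n%:R * (a - t) ^+ 2) <= cabs c * M.
  pose E z := cexp (n%:R * - ((z - w) * (z - w))).
  pose H z := c * (F z * E z).
  pose DH z := c * (D z * E z + F z * (E z * (n%:R * - ((z - w) + (z - w))))).
  have qE z : qdiff E z (E z * (n%:R * - ((z - w) + (z - w)))) 0.
    have h1 := qdiffB (qdiff_id z) (qdiff_cst w z); rewrite subr0 subrr in h1.
    have h2 := qdiffZ n%:R (qdiffN (qdiffM h1 h1)).
    have := qdiff_comp h2 (qdiff_cexp _).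
    rewrite !(mul0r, mulr0, addr0, oppr0, mulr1, mul1r).
    by [].
  have qH z : strip z -> qdiff H z (DH z) 0.
    move=> /hF h; have := qdiffZ c (qdiffM h (qE z)).
    by rewrite mul0r mulr0 addr0 mulr0.
  have qDH z : strip z -> exists p q, qdiff DH z p q.
    move=> zs; have [p [q h]] := hD _ zs.
    have h1 := qdiffB (qdiff_id z) (qdiff_cst w z).
    have h2 := qdiffZ n%:R (qdiffN (qdiffD h1 h1)).
    have := qdiffZ c (qdiffD (qdiffM h (qE z)) (qdiffM (hF _ zs) (qdiffM (qE z) h2))).
    by move=> h3; eexists; eexists; exact: h3.
  have TH z : strip z -> taylor2 H z.
    move=> zs; have [r r0 hr] := strip_open zs; have [p [q h]] := qDH _ zs.
    by apply: (qdiff_taylor2 r0 _ h) => k /hr; exact: qH.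
  have aE x y : cabs (E (x +i* y)) = expR (n%:R * ((y - a) ^+ 2 - (x - s) ^+ 2)).
    rewrite cabs_cexp -realc_nat ReM /= mul0r subr0; congr (expR (_ * _)); ring.
  have := @max_principle _ H (s - a) (s + a) 0 a (cabs c * M) hx (ltW a0) _ _ _ s t.
  have -> : Re (H (s +i* t)) = cabs (F (s +i* t)) ^+ 2 * expR (n%:R * (a - t) ^+ 2).
    rewrite /H /c mulrA /E.
    have -> : n%:R * - ((s +i* t - w) * (s +i* t - w)) = (n%:R * (a - t) ^+ 2)%:C.
      by rewrite realcM realc_nat; congr (_ * _); apply: complex_ext => /=; ring.
    rewrite cexp_real cabs_sqr ReM /= mulr0 subr0; congr (_ * _).
    by case: (F _) => u v /=; ring.
  move=> H1; apply: le_trans (H1 _ _ _ _ _).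
  - by rewrite ler_wpM2l ?sqr_ge0// expR_ge1Dx.
  - by move=> x y _ hy; exists (DH (x +i* y)), 0; apply: qH; exact: in_strip.
  - by move=> x y _ /andP[y1 y2]; apply: TH; apply: in_strip; rewrite !ltW.
  - move=> x y hx' hy hb; have M0 : 0 <= M by exact: le_trans (cabs_ge0 _) (hM _ _ hx' hy).
    apply: le_trans (ler_norm _) _; apply: le_trans (normr_Re_le _) _.
    rewrite /H (Normc.normcM c) (Normc.normcM (F _)) ler_wpM2l ?cabs_ge0// aE.
    have [y0|yn0] := eqVneq y 0.
      by rewrite y0 -[x +i* 0]/(x%:C) hR Normc.normc0 mul0r.
    rewrite -[leRHS]mulr1 ler_pM ?cabs_ge0 ?expR_ge0 ?hM// expR_le1.
    apply: mulr_ge0_le0 => //; rewrite subr_le0.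
    move/andP: hy => [y1 y2].
    case: hb => [->|[->|[y3|->]]].
    + rewrite (_ : s - a - s = - a); last by ring.
      by rewrite sqrrN -[leLHS]sqrrN opprB lerXn2r ?nnegrE; lra.
    + rewrite (_ : s + a - s = a); last by ring.
      by rewrite -[leLHS]sqrrN opprB lerXn2r ?nnegrE; lra.
    + by rewrite y3 eqxx in yn0.
    + by rewrite subrr expr0n sqr_ge0.
  - by apply/andP; split; lra.
  - by apply/andP; split; lra.
apply: cabs0_eq; apply/eqP; rewrite -sqrf_eq0 eq_le sqr_ge0 andbT leNgt; apply/negP => F0.
have d0 : 0 < cabs (F (s +i* t)) ^+ 2 * (a - t) ^+ 2.
  by rewrite mulr_gt0// exprn_gt0// subr_gt0.
have := key (Num.truncn (cabs c * M / (cabs (F (s +i* t)) ^+ 2 * (a - t) ^+ 2))).+1.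
have := truncnS_gt (cabs c * M / (cabs (F (s +i* t)) ^+ 2 * (a - t) ^+ 2)).
move: (Num.truncn _).+1%:R => n; rewrite ltr_pdivrMr// mulrDr mulr1 => h1 h2.
have h3 : cabs (F (s +i* t)) ^+ 2 * (n * (a - t) ^+ 2) = n * (cabs (F (s +i* t)) ^+ 2 * (a - t) ^+ 2) by ring.
by lra.
Qed.

Lemma unique_continuation F D : (forall z, strip z -> qdiff F z (D z) 0) ->
  (forall z, strip z -> exists p q, qdiff D z p q) ->
  (forall x : R, F x%:C = 0) -> forall z, strip z -> F z = 0.
Proof.
move=> hF hD hR z zs; have [z0|z0|z0] := ltgtP (Im z) 0; last first.
- by case: z z0 zs => x y /= ->; rewrite -[x +i* 0]/(x%:C) hR.
- exact: continuation_up hF hD hR zs z0.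
have sN w : strip w -> strip (- w).
  by rewrite /strip ImN => /andP[h1 h2]; apply/andP; split; lra.
rewrite -[z]opprK.
apply: (@continuation_up (fun z => F (- z)) (fun z => - D (- z))).
- move=> w /sN ws; have := qdiff_comp (qdiffN (qdiff_id w)) (hF _ ws).
  by rewrite !mul0r oppr0 mulr0 !addr0 mulrN1.
- move=> w /sN /hD[p [q h]].
  have := qdiffN (qdiff_comp (qdiffN (qdiff_id w)) h).
  by move=> h'; eexists; eexists; exact: h'.
- by move=> x; rewrite -realcN.
- exact: sN.
- by rewrite ImN oppr_gt0.
Qed.

End Continuation.

(** * Integrals of complex-valued functions *)

Section ComplexIntegral.
Variable R : realType.
Notation mu := (@lebesgue_measure R).
Implicit Types (D : set R) (f g : R -> R) (q : R -> R[i]).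

Definition rint D f := mu.-integrable D (EFin \o f).
Definition cint D q := rint D (fun x => Re (q x)) /\ rint D (fun x => Im (q x)).
Definition cmeas D q := measurable_fun D (fun x => Re (q x)) /\
  measurable_fun D (fun x => Im (q x)).

Lemma rint_meas D f : rint D f -> measurable_fun D f.
Proof. by move=> /measurable_int /measurable_EFinP. Qed.

Lemma rint_dom D f g : measurable D -> measurable_fun D f ->
  (forall x, D x -> `|f x| <= g x) -> rint D g -> rint D f.
Proof.
move=> mD mf fg; apply: le_integrable => //; first exact/measurable_EFinP.
by move=> x Dx /=; rewrite lee_fin (le_trans (fg x Dx))// ler_norm.
Qed.

Lemma rintZ D f c : measurable D -> rint D f -> rint D (fun x => c * f x).
Proof. move=> mD hf; rewrite /rint (_ : EFin \o _ = fun x => (c%:E * (EFin \o f) x)%E)//.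
exact: integrableZl. Qed.

Lemma rintD D f g : measurable D -> rint D f -> rint D g -> rint D (fun x => f x + g x).
Proof. move=> mD hf hg; rewrite /rint (_ : EFin \o _ = ((EFin \o f) \+ (EFin \o g))%E)//.
exact: integrableD. Qed.

Lemma cint_dom D q g : measurable D -> cmeas D q -> (forall x, D x -> cabs (q x) <= g x) ->
  rint D g -> cint D q.
Proof.
move=> mD [m1 m2] h hg; split; apply: rint_dom hg => // x /h; apply: le_trans.
  exact: normr_Re_le.
exact: normr_Im_le.
Qed.

Lemma cmeasD D q1 q2 : cmeas D q1 -> cmeas D q2 -> cmeas D (fun x => q1 x + q2 x).
Proof.
move=> [a b] [c d]; split.
  by apply: eq_measurable_fun (measurable_funD a c) => x _ /=; rewrite ReD.
by apply: eq_measurable_fun (measurable_funD b d) => x _ /=; rewrite ImD.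
Qed.

Lemma cmeasM D q1 q2 : cmeas D q1 -> cmeas D q2 -> cmeas D (fun x => q1 x * q2 x).
Proof.
move=> [a b] [c d]; split.
  apply: eq_measurable_fun (measurable_funB (measurable_funM a c) (measurable_funM b d)) => x _ /=.
  by rewrite ReM.
apply: eq_measurable_fun (measurable_funD (measurable_funM a d) (measurable_funM b c)) => x _ /=.
by rewrite ImM.
Qed.

Lemma cmeas_real D f : measurable_fun D f -> cmeas D (fun x => (f x)%:C).
Proof. by move=> mf; split => //=; exact: measurable_cst. Qed.

Lemma cmeas_cst D c : cmeas D (fun=> c).
Proof. by split; exact: measurable_cst. Qed.

Lemma cmeas_sum D n (u : nat -> R -> R[i]) : (forall l, cmeas D (u l)) ->
  cmeas D (fun x => \sum_(0 <= l < n) u l x).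
Proof.
move=> h; elim: n => [|n IH].
  have -> : (fun x => \sum_(0 <= l < 0) u l x) = fun=> 0.
    by apply/funext => x; rewrite big_geq.
  exact: cmeas_cst.
have -> : (fun x => \sum_(0 <= l < n.+1) u l x) = (fun x => \sum_(0 <= l < n) u l x + u n x).
  by apply/funext => x; rewrite big_nat_recr.
exact: cmeasD.
Qed.

Lemma eq_cintegral D q1 q2 : (forall x, D x -> q1 x = q2 x) -> cintegral D q1 = cintegral D q2.
Proof.
by move=> h; congr (_ +i* _); apply: eq_Rintegral => x /set_mem /h ->.
Qed.

Lemma cint_ext D q1 q2 : measurable D -> (forall x, D x -> q1 x = q2 x) -> cint D q2 -> cint D q1.
Proof.
by move=> mD h [h1 h2]; split; [move: h1|move: h2]; apply: eq_integrable => // x /set_mem /h /= ->.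
Qed.

Lemma cintD D q1 q2 : measurable D -> cint D q1 -> cint D q2 -> cint D (fun x => q1 x + q2 x).
Proof.
move=> mD [a b] [c d]; split.
  rewrite (_ : (fun x => _) = (fun x => Re (q1 x) + Re (q2 x))); first exact: rintD.
  by apply/funext => x; rewrite ReD.
rewrite (_ : (fun x => _) = (fun x => Im (q1 x) + Im (q2 x))); first exact: rintD.
by apply/funext => x; rewrite ImD.
Qed.

Lemma cintZ D q c : measurable D -> cint D q -> cint D (fun x => c * q x).
Proof.
move=> mD [a b]; split.
  rewrite (_ : (fun x => _) = (fun x => Re c * Re (q x) + - Im c * Im (q x))).
    by apply: rintD => //; exact: rintZ.
  by apply/funext => x; rewrite ReM mulNr.
rewrite (_ : (fun x => _) = (fun x => Re c * Im (q x) + Im c * Re (q x))).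
  by apply: rintD => //; exact: rintZ.
by apply/funext => x; rewrite ImM.
Qed.

Lemma cintegralD D q1 q2 : measurable D -> cint D q1 -> cint D q2 ->
  cintegral D (fun x => q1 x + q2 x) = cintegral D q1 + cintegral D q2.
Proof.
move=> mD [a b] [c d]; apply: complex_ext; rewrite /cintegral ?ReD ?ImD /=.
  by rewrite -RintegralD//; apply: eq_Rintegral => x _; rewrite ReD.
by rewrite -RintegralD//; apply: eq_Rintegral => x _; rewrite ImD.
Qed.

Lemma cintegralZ D q c : measurable D -> cint D q ->
  cintegral D (fun x => c * q x) = c * cintegral D q.
Proof.
move=> mD [a b]; apply: complex_ext; rewrite /cintegral ?ReM ?ImM /=.
  rewrite -mulNr -!RintegralZl// -RintegralD//; try exact: rintZ.
  by apply: eq_Rintegral => x _; rewrite ReM mulNr.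
rewrite -!RintegralZl// -RintegralD//; try exact: rintZ.
by apply: eq_Rintegral => x _; rewrite ImM.
Qed.

Lemma cint0 D : cint D (fun=> 0).
Proof. by split; exact: integrable0. Qed.

Lemma cintegral0 D : cintegral D (fun=> 0) = 0.
Proof.
by rewrite /cintegral /= /Rintegral integral0.
Qed.

Lemma cint_sum (I : Type) (s : seq I) D (u : I -> R -> R[i]) : measurable D ->
  (forall l, cint D (u l)) -> cint D (fun x => \sum_(l <- s) u l x) /\
  cintegral D (fun x => \sum_(l <- s) u l x) = \sum_(l <- s) cintegral D (u l).
Proof.
move=> mD hu; elim: s => [|i s [IH1 IH2]].
  have -> : (fun x => \sum_(l <- [::]) u l x) = (fun=> 0) by apply/funext => x; rewrite big_nil.
  by rewrite big_nil cintegral0; split => //; exact: cint0.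
have -> : (fun x => \sum_(l <- i :: s) u l x) = (fun x => u i x + \sum_(l <- s) u l x).
  by apply/funext => x; rewrite big_cons.
by rewrite big_cons -IH2; split; [exact: cintD|exact: cintegralD].
Qed.

(** Every partial sum is dominated by [g], so dominated convergence applies to the real and
    imaginary parts. *)
Lemma cintegral_series D (u : nat -> R -> R[i]) s g : measurable D ->
  (forall l, cint D (u l)) -> cint D s -> rint D g ->
  (forall x, D x -> has_sum (fun l => u l x) (s x)) ->
  (forall x, D x -> abs_le (fun l => u l x) (g x)) ->
  cseries_cvg (fun l => cintegral D (u l)) (cintegral D s).
Proof.
move=> mD hu [s1 s2] hg us ug.
have part (p : R[i] -> R) : (forall (I : Type) (t : seq I) (v : I -> R[i]),
      p (\sum_(i <- t) v i) = \sum_(i <- t) p (v i)) ->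
    (forall z, `|p z| <= cabs z) -> (forall z w, p (z - w) = p z - p w) ->
    (forall l, rint D (fun x => p (u l x))) -> rint D (fun x => p (s x)) ->
    series (fun l => \int[mu]_(x in D) p (u l x)) @ \oo --> \int[mu]_(x in D) p (s x).
  move=> psum ple pB pu ps.
  pose S n x := \sum_(0 <= l < n) p (u l x).
  have hS n : rint D (S n) /\ \int[mu]_(x in D) S n x = \sum_(0 <= l < n) \int[mu]_(x in D) p (u l x).
    elim: n => [|n [IH1 IH2]].
      rewrite /S (_ : (fun x => _) = (fun=> 0)); last by apply/funext => x; rewrite big_geq.
      split; first exact: integrable0.
      rewrite [RHS]big_geq// /Rintegral (eq_integral (cst 0%E)) ?integral0//.
    rewrite (_ : S n.+1 = (fun x => S n x + p (u n x))).
      rewrite big_nat_recr//= -IH2; split; first exact: rintD.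
      rewrite RintegralD//; exact: pu.
    by apply/funext => x; rewrite /S big_nat_recr.
  have H : (\int[mu]_(x in D) (S n x)%:E)%E @[n --> \oo] --> (\int[mu]_(x in D) (p (s x))%:E)%E.
    apply: (@dominated_cvg _ _ _ mu D mD (fun n x => (S n x)%:E) (fun x => (p (s x))%:E) (fun x => (g x)%:E)).
    - by move=> n; apply/measurable_EFinP; apply: rint_meas; exact: (hS n).1.
    - move=> x Dx; apply: cvg_EFin; first by near=> n.
      apply/cvgrPdist_lt => e e0; have [N hN] := has_sum_nat (us x Dx) e0.
      exists N => // n /= /hN; apply: le_lt_trans.
      by rewrite /= /S -psum distrC -pB ple.
    - by [].
    - exact: hg.
    - move=> n x Dx; rewrite /= lee_fin /S -psum (le_trans (ple _))//.
      by rewrite (le_trans (cabs_sum _ _))// ug// iota_uniq.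
  have fin f : rint D f -> (\int[mu]_(x in D) (f x)%:E)%E = (\int[mu]_(x in D) f x)%:E.
    by move=> hf; rewrite /Rintegral fineK//; exact: integrable_fin_num.
  rewrite (fin _ ps) in H.
  rewrite (_ : series _ = (fun n => \int[mu]_(x in D) S n x)); last first.
    by apply/funext => n; rewrite (hS n).2.
  exact: fine_cvg H.
split.
  apply: part => //; [exact: Re_sum|exact: normr_Re_le|exact: ReB|].
  by move=> l; exact: (hu l).1.
apply: part => //; [exact: Im_sum|exact: normr_Im_le|exact: ImB|].
by move=> l; exact: (hu l).2.
Unshelve. all: by end_near. Qed.

End ComplexIntegral.

(** * Incomplete gamma function *)

Section LaplacePower.
Variables (R : realType) (k : R).
Notation mu := (@lebesgue_measure R).

Definition Lint (w : R) : R :=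
  \int[mu]_(t in `[0, +oo[) (expR (- (w * t)) * (1 + t) `^ (- k)).

Let mray a : measurable (`[a, +oo[ : set R). Proof. exact: measurable_itv. Qed.

Lemma rint_expR (w : R) : 0 < w -> rint `[0, +oo[ (fun t => expR (- (w * t))).
Proof.
move=> w0; have md : measurable_fun setT (fun t : R => expR (- (w * t))).
  by apply: measurableT_comp => //; apply: measurableT_comp.
have h1 : rint setT (exponential_pdf w).
  apply/integrableP; split.
    by apply/measurable_EFinP; exact: measurable_exponential_pdf.
  under eq_integral => t _ do rewrite /= ger0_norm ?exponential_pdf_ge0 ?(ltW w0)//.
  by rewrite integral_exponential_pdf// ltry.
have h2 : rint `[0, +oo[ (fun t => w^-1 * exponential_pdf w t).
  apply: rintZ => //; apply: integrableS h1 => //.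
apply: eq_integrable h2 => // t; rewrite inE /= in_itv /= andbT => t0.
by rewrite exponential_pdfE// mulKf ?lt0r_neq0// mulNr.
Qed.

(** From [ln x < x] at [x = d (1 + t)] comes [ln (1 + t) <= d (1 + t) - ln d]; the choice of [d]
    ensures [|k| d <= w]. *)
Lemma powR_exp_bound (w : R) : 0 < w -> exists2 C : R, 0 <= C &
  forall t, 0 <= t -> (1 + t) `^ (- k) <= C * expR (w * t).
Proof.
move=> w0; pose K := `|k| + 1; have K0 : 0 < K by rewrite ltr_wpDl.
pose d := w / K; have d0 : 0 < d by rewrite divr_gt0.
exists (expR (`|k| * d - `|k| * ln d)); first exact: expR_ge0.
move=> t t0; have t1 : 0 < 1 + t by rewrite ltr_wpDr.
rewrite /powR gt_eqF// -expRD ler_expR.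
have l0 : 0 <= ln (1 + t) by rewrite ln_ge0// lerDl.
apply: (@le_trans _ _ (`|k| * ln (1 + t))).
  by rewrite ler_wpM2r// -normrN ler_norm.
have h : ln (1 + t) <= d * (1 + t) - ln d.
  rewrite lerBrDr -lnM ?posrE// mulrC ltW//.
  by apply: ln_sublinear; rewrite mulr_gt0.
apply: (@le_trans _ _ (`|k| * (d * (1 + t) - ln d))); first by rewrite ler_wpM2l.
have : `|k| * d * t <= w * t.
  rewrite ler_wpM2r// /d mulrCA ler_piMr ?(ltW w0)// ler_pdivrMr// mul1r.
  by rewrite lerDl.
lra.
Qed.

Lemma measurable_lint (w : R) :
  measurable_fun setT (fun t : R => expR (- (w * t)) * (1 + t) `^ (- k)).
Proof.
apply: measurable_funM.
  by apply: measurableT_comp => //; apply: measurableT_comp.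
apply: (measurableT_comp (measurable_powR (- k))).
exact: measurable_funD.
Qed.

Lemma rint_lint (w : R) : 0 < w ->
  rint `[0, +oo[ (fun t => expR (- (w * t)) * (1 + t) `^ (- k)).
Proof.
move=> w0; have w2 : 0 < w / 2 by rewrite divr_gt0.
have [C C0 hC] := powR_exp_bound w2.
apply: (rint_dom (g := fun t => C * expR (- (w / 2 * t)))) => //.
- by apply: measurable_funTS; exact: measurable_lint.
- move=> t; rewrite /= in_itv /= andbT => t0.
  rewrite ger0_norm ?mulr_ge0 ?expR_ge0 ?powR_ge0//.
  apply: (@le_trans _ _ (expR (- (w * t)) * (C * expR (w / 2 * t)))).
    by rewrite ler_wpM2l ?expR_ge0// hC.
  rewrite mulrCA -expRD ler_wpM2l// ler_expR; lra.
- by apply: rintZ => //; exact: rint_expR.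
Qed.

Lemma Lint_ge0 w : 0 <= Lint w.
Proof.
by apply: Rintegral_ge0 => t _; rewrite mulr_ge0 ?expR_ge0 ?powR_ge0.
Qed.

Lemma Lint_le v w : 0 < v -> v <= w -> Lint w <= Lint v.
Proof.
move=> v0 vw; apply: le_Rintegral => //.
- by apply: rint_lint; exact: lt_le_trans vw.
- exact: rint_lint.
- move=> t; rewrite /= in_itv /= andbT => t0.
  by rewrite ler_wpM2r ?powR_ge0// ler_expR lerN2 ler_wpM2r.
Qed.

(* Power series expansion of [Lint] around [w], obtained by expanding the
   exponential under the integral sign. *)
Lemma ps_Lint (w r : R) : 0 < r -> r < w ->
  exists b, ps r b (Lint (w - r)) (fun y => (Lint (w + y))%:C).
Proof.
move=> r0' rw; have r0 := ltW r0'.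
pose D : set R := [set` `[0, +oo[ ].
pose f (t : R) := expR (- (w * t)) * (1 + t) `^ (- k).
pose u y (q : nat) (t : R) : R[i] := ((- (t * y)) ^+ q / q`!%:R * f t)%:C.
pose g (t : R) := expR (- ((w - r) * t)) * (1 + t) `^ (- k).
have wr : 0 < w - r by rewrite subr_gt0.
have gi : rint D g by exact: rint_lint.
have mf q y : measurable_fun setT (fun t : R => (- (t * y)) ^+ q / q`!%:R * f t).
  apply: measurable_funM; last exact: measurable_lint.
  apply: measurable_funM => //; apply: measurable_funX.
  by apply: measurableT_comp => //; exact: mulrr_measurable.
have D0 t : D t -> 0 <= t by rewrite /D /= in_itv /= andbT.
have bound y t : `|y| <= r -> D t -> abs_le (fun q => u y q t) (g t).
  move=> yr /D0 t0.
  apply: (abs_le_leq (g := fun q => (t * r) ^+ q / q`!%:R * f t)).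
    move=> q; rewrite cabs_real normrM (ger0_norm (mulr_ge0 (expR_ge0 _) (powR_ge0 _ _))).
    rewrite ler_wpM2r ?mulr_ge0 ?expR_ge0 ?powR_ge0// normrM normfV normr_nat ler_wpM2r//.
    rewrite normrX normrN normrM (ger0_norm t0) lerXn2r ?nnegrE ?mulr_ge0//.
    by rewrite ler_wpM2l.
  have -> : g t = expR (t * r) * f t.
    by rewrite /f mulrA -expRD; congr (expR _ * _); ring.
  apply: sum_leZr; first by rewrite mulr_ge0 ?expR_ge0 ?powR_ge0.
  by apply: sum_inv_fact_le; rewrite mulr_ge0.
have ui y q : `|y| <= r -> cint D (u y q).
  move=> yr; apply: (cint_dom (g := g) (mray 0)) => //.
    by apply: cmeas_real; apply: measurable_funTS; exact: mf.
  move=> t Dt; have := bound y t yr Dt [:: q] isT.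
  by rewrite big_seq1.
have sumu y t : `|y| <= r -> D t -> has_sum (fun q => u y q t)
    (expR (- ((w + y) * t)) * (1 + t) `^ (- k))%:C.
  move=> yr Dt.
  have := (ps_expR (- t) (normr_ge0 y)).2 y (lexx _).
  move=> /(has_sumZ (f t)%:C); rewrite -realcM.
  have -> : f t * expR (- t * y) = expR (- ((w + y) * t)) * (1 + t) `^ (- k).
    by rewrite /f mulrAC -expRD; congr (expR _ * _); ring.
  apply: has_sum_ext => q; rewrite /u -!realcM; congr (_%:C).
  rewrite -mulNr exprMn; ring.
pose b q : R := \int[mu]_(t in D) ((- t) ^+ q / q`!%:R * f t).
have bi q : rint D (fun t => (- t) ^+ q / q`!%:R * f t).
  have rr : `|r| <= r by rewrite ger0_norm.
  have := rintZ ((r ^+ q)^-1) (mray 0) (ui r q rr).1.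
  apply: eq_integrable => // t _; congr EFin.
  rewrite /u /= -mulNr exprMn.
  by field; rewrite expf_neq0 ?lt0r_neq0// pnatr_eq0 -lt0n fact_gt0.
have bE y q : (b q * y ^+ q)%:C = cintegral D (u y q).
  apply: complex_ext; rewrite /cintegral /=; last first.
    by rewrite /Rintegral (eq_integral (cst 0%E))// integral0.
  rewrite /b -RintegralZr; [|exact: mray|exact: bi].
  by apply: eq_Rintegral => t _; rewrite -mulNr exprMn; ring.
have sI y : cintegral D (fun t => (expR (- ((w + y) * t)) * (1 + t) `^ (- k))%:C) = (Lint (w + y))%:C.
  apply: complex_ext; rewrite /cintegral //=.
  by rewrite /Rintegral (eq_integral (cst 0%E))// integral0.
(* At [y = - r] all terms are nonnegative, so their moduli add up to at most the integral of [g],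
   which is [Lint (w - r)]. Every other [y] with [|y| <= r] is dominated termwise by this case. *)
have al y : `|y| <= r -> abs_le (fun q => (b q)%:C * (y ^+ q)%:C) (Lint (w - r)).
  move=> yr; have rr : `|- r| <= r by rewrite normrN ger0_norm.
  apply: (abs_le_leq (g := fun q => Re (cintegral D (u (- r) q)))).
    move=> q; rewrite -realcM cabs_real.
    have pos : 0 <= Re (cintegral D (u (- r) q)).
      rewrite /cintegral /=; apply: Rintegral_ge0 => t /D0 t0.
      apply: mulr_ge0; last by apply: mulr_ge0; [exact: expR_ge0|exact: powR_ge0].
      by apply: divr_ge0 => //; apply: exprn_ge0; rewrite mulrN opprK mulr_ge0.
    rewrite -(ger0_norm pos) -bE /= !normrM ler_wpM2l// !normrX normrN.
    by rewrite lerXn2r ?nnegrE// (ger0_norm r0).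
  move=> s us; rewrite -Re_sum.
  have [h1 <-] := cint_sum s (mray 0) (fun l => ui (- r) l rr).
  rewrite /cintegral /=; apply: le_Rintegral => //.
    exact: h1.1.
  move=> t Dt; rewrite Re_sum; apply: le_trans (bound (- r) t rr Dt s us).
  by apply: ler_sum => q _; apply: le_trans (normr_Re_le _); exact: ler_norm.
exists (fun q => (b q)%:C); split; first by apply: al; rewrite ger0_norm.
move=> y yr; apply: (has_sum_of_series (al y yr)).
have wy : 0 < w + y.
  by move: yr; rewrite ler_norml => /andP[]; lra.
have si : cint D (fun t => (expR (- ((w + y) * t)) * (1 + t) `^ (- k))%:C).
  split; first exact: (rint_lint wy).
  exact: integrable0.
have := cintegral_series (mray 0) (fun l => ui y l yr) si gi (fun t => sumu y t yr) (fun t => bound y t yr).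
rewrite sI; congr (cseries_cvg _ _); apply/funext => q.
by rewrite -bE realcM.
Qed.

(** Substitution [t = w (1 + s)], whose Jacobian turns [w^(-k)] into [w^(1-k)]. Integrability is
    stated along with it, since it allows the integral to be split at intermediate points. *)
Lemma incomplete_gammaE (w : R) : 0 < w ->
  rint `[w, +oo[ (fun t => expR (- t) * t `^ (1 - k - 1)) /\
  incomplete_gamma (1 - k) w = w `^ (1 - k) * expR (- w) * Lint w.
Proof.
move=> w0; pose F s := w * (1 + s); pose G t := expR (- t) * t `^ (1 - k - 1).
have dF (x : R) : is_derive x 1 F w.
  apply: (@quad_is_derive _ _ _ _ 1 0) => // h _.
  by rewrite /F (_ : _ - _ = 0) ?normr0 ?mul0r//; ring.
have F' : F^`()%classic = cst w.
  by apply/funext => x; rewrite derive1E; exact: derive_val.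
have F0 : F 0 = w by rewrite /F addr0 mulr1.
have Gd (t : R) : 0 < t -> {for t, continuous G}.
  move=> t0; apply: differentiable_continuous; apply/derivable1_diffP.
  apply: derivableM; last by have [] := is_derive1_powR (1 - k - 1) t0.
  have [] := is_derive1_comp (is_derive_expR (- t)) (is_deriveN (is_derive_id t 1)).
  by [].
have S : (\int[mu]_(t in `[w, +oo[) (G t)%:E = \int[mu]_(t in `[0%R, +oo[) ((w `^ (1 - k) * expR (- w) * (expR (- (w * t)) * (1 + t) `^ (- k)))%:E))%E.
  rewrite -[w in LHS]F0 (@increasing_ge0_integration_by_substitutiony _ F G 0).
  - apply: eq_integral => t; rewrite inE /= in_itv /= andbT => t0.
    rewrite F'; congr EFin; rewrite -[LHS]/(expR (- (w * (1 + t))) * (w * (1 + t)) `^ (1 - k - 1) * w).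
    have t1 : 0 < 1 + t by rewrite ltr_wpDr.
    rewrite powRM ?ltW// (_ : 1 - k - 1 = - k); last by ring.
    have -> : w `^ (1 - k) = w * w `^ (- k).
      rewrite -{2}[w]powRr1 ?ltW// -powRD//; last by rewrite (gt_eqF w0) implybT.
    have -> : - (w * (1 + t)) = - w + - (w * t) by ring.
    by rewrite expRD /=; ring.
  - by move=> x y _ _ xy; rewrite /F ltr_pM2l// ltrD2l.
  - by move=> x _; rewrite F'; exact: cst_continuous.
  - by rewrite F'; exact: is_cvg_cst.
  - by rewrite F'; exact: is_cvg_cst.
  - split; first by move=> x _; have [] := dF x.
    by apply: cvg_at_right_filter; apply: differentiable_continuous; apply/derivable1_diffP; have [] := dF 0.
  - apply: gt0_cvgMry => //; exact: cvg_addrl.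
  - rewrite F0; apply: continuous_in_subspaceT => t; rewrite inE /= in_itv /= andbT => wt.
    by apply: Gd; exact: lt_le_trans wt.
  - by move=> t _; rewrite /G mulr_ge0 ?expR_ge0 ?powR_ge0.
have li := rintZ (w `^ (1 - k) * expR (- w)) (mray 0) (rint_lint w0).
split.
  apply/integrableP; split.
    apply/measurable_EFinP; apply: subspace_continuous_measurable_fun => //.
    apply: continuous_in_subspaceT => t; rewrite inE /= in_itv /= andbT => wt.
    by apply: Gd; exact: lt_le_trans wt.
  under eq_integral => t _ do rewrite /= ger0_norm ?mulr_ge0 ?expR_ge0 ?powR_ge0//.
  by rewrite -/G S ltey_eq (integrable_fin_num _ li).
rewrite /incomplete_gamma /Rintegral -/G S.
rewrite -[RHS]RintegralZl//.
exact: rint_lint.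
Qed.

(** For [x > a] the function is a constant minus the integral of [G] over [[a, x]], and the
    fundamental theorem applies; [a = w / 2] serves as a point strictly between [0] and [w]. *)
Lemma is_derive_incomplete_gamma (w : R) : 0 < w ->
  is_derive w 1 (incomplete_gamma (1 - k)) (- (expR (- w) * w `^ (- k))).
Proof.
move=> w0; pose a := w / 2; have a0 : 0 < a by rewrite divr_gt0.
have aw : a < w by rewrite ltr_pdivrMr// ltr_pMr// ltr1n.
pose G t := expR (- t) * t `^ (1 - k - 1).
have G0 : G w = expR (- w) * w `^ (- k) by rewrite /G (_ : 1 - k - 1 = - k)//; ring.
have [ri _] := incomplete_gammaE a0.
pose F x := \int[mu]_(t in `[a, x]) G t.
have sub x : (`[a, x] `<=` `[a, +oo[)%classic.
  by move=> t; rewrite /= !in_itv /= andbT => /andP[].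
have [dF F'] : derivable F w 1 /\ F^`()%classic w = G w.
  apply: (@continuous_FTC1_closed _ _ _ _ (w + 1)) => //; first by rewrite ltrDl.
    apply: integrableS; [exact: (mray a)|exact: measurable_itv|exact: sub|exact: ri].
  apply: differentiable_continuous; apply/derivable1_diffP.
  apply: derivableM; last by have [] := is_derive1_powR (1 - k - 1) w0.
  by have [] := is_derive1_comp (is_derive_expR (- w)) (is_deriveN (is_derive_id w 1)).
rewrite -G0 -F' derive1E.
apply: (@near_eq_is_derive _ _ _ (fun x => incomplete_gamma (1 - k) a - F x)); last first.
  rewrite -[X in is_derive _ _ _ X]add0r.
  apply: is_deriveB; last exact: DeriveDef.
near=> x; have ax : a < x by near: x; exact: lt_nbhsr.
have := @Rintegral_itvB _ G (BLeft a) +oo%O x ri.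
rewrite bnd_simp ltW// => /(_ isT isT).
rewrite /incomplete_gamma -/G => ->.
rewrite Rintegral_itv_obnd_cbnd//.
apply: integrableS ri => //.
by move=> t; rewrite /= !in_itv /= !andbT => xt; apply: ltW; exact: lt_trans xt.
Unshelve. all: by end_near. Qed.

End LaplacePower.

(** * Fourier series *)

Section ExponentialSeries.
Variable R : realType.
Implicit Types (c : nat -> R[i]) (beta v d e : R) (tau : R[i]).

Lemma dps_cseries (c : nat -> R[i]) (aX aY : nat -> nat -> R[i])
    (BX BY : nat -> R) (X Y : nat -> R -> R[i]) r M (t : R -> R -> nat -> R[i]) : 0 < r ->
  (forall l, ps r (aX l) (BX l) (X l)) -> (forall l, ps r (aY l) (BY l) (Y l)) ->
  sum_le (fun l => cabs (c l) * (BX l * BY l)) M ->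
  (forall x y l, `|x| <= r -> `|y| <= r -> t x y l = c l * (X l x * Y l y)) ->
  exists a, [/\ dps r a M (fun x y => cseries (t x y)),
    forall p q, has_sum (fun l => c l * (aX l p * aY l q)) (a (p, q)) &
    forall x y, `|x| <= r -> `|y| <= r -> abs_le (t x y) M /\ has_sum (t x y) (cseries (t x y))].
Proof.
move=> r0 hX hY hM tE.
have ha x y : `|x| <= r -> `|y| <= r -> abs_le (t x y) M.
  move=> xr yr; apply: abs_le_leq hM => l; rewrite tE// !Normc.normcM.
  rewrite ler_wpM2l ?cabs_ge0// ler_pM ?cabs_ge0//.
    by apply: has_sum_le (ps_abs_le (hX l) xr) _; exact: (hX l).2.
  by apply: has_sum_le (ps_abs_le (hY l) yr) _; exact: (hY l).2.
have hs x y : `|x| <= r -> `|y| <= r -> has_sum (t x y) (cseries (t x y)).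
  by move=> xr yr; exact: abs_le_cseries (ha x y xr yr).
have [|a [h1 h2]] := dps_series (g := fun x y => cseries (t x y)) r0 hX hY hM.
  move=> x y xr yr; apply: has_sum_ext (hs x y xr yr) => l.
  exact: tE.
by exists a; split => // x y xr yr; split; [exact: ha|exact: hs].
Qed.

Lemma ps_comp_scale r a b B (Y : R -> R[i]) : 0 <= r -> 0 < a -> ps (a * r) b B Y ->
  ps r (fun q => b q * (a ^+ q)%:C) B (fun y => Y (a * y)).
Proof.
move=> r0 a0 [h1 h2]; split.
  move: h1; congr (abs_le _ _); apply/funext => q.
  by rewrite exprMn realcM mulrA.
move=> y yr; have /h2 : `|a * y| <= a * r by rewrite normrM gtr0_norm// ler_pM2l.
by congr (has_sum _ _); apply/funext => q; rewrite exprMn realcM mulrA.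
Qed.

(** Growth slower than every exponential: weaker than [O(e^(C sqrt l))], and stable under
    multiplication by powers of the frequency, so that all derived series belong to the same
    class. *)
Definition subexp c := forall e : R, 0 < e -> exists A : R,
  forall l : nat, cabs (c l) <= A * expR (e * l%:R).

Lemma subexpM c c' : subexp c -> subexp c' -> subexp (fun l => c l * c' l).
Proof.
move=> h h' e e0; have e2 : 0 < e / 2 by rewrite divr_gt0.
have [[A hA] [A' hA']] := (h _ e2, h' _ e2); exists (A * A') => l.
rewrite Normc.normcM [e]splitr mulrDl expRD mulrACA.
by rewrite ler_pM ?cabs_ge0.
Qed.

Lemma subexp_cst (z : R[i]) : subexp (fun=> z).
Proof.
move=> e e0; exists (cabs z) => l; rewrite ler_peMr ?cabs_ge0// -expR0 ler_expR.
by rewrite mulr_ge0// ltW.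
Qed.

Lemma subexp_linear beta : subexp (fun l => (l%:R + beta)%:C).
Proof.
move=> e e0; exists (e^-1 + `|beta|) => l; rewrite cabs_real.
have el : 0 <= e * l%:R by rewrite mulr_ge0// ltW.
rewrite mulrDl (le_trans (ler_normD _ _))// lerD//.
  rewrite normr_nat -ler_pdivrMl ?invr_gt0// invrK; apply: le_trans (expR_ge1Dx _).
  by rewrite lerDr.
by rewrite ler_peMr// -[leLHS]expR0 ler_expR.
Qed.

(** Writing [l + beta = beta (1 + l/beta)] reduces this to [powR_exp_bound], which allows exponents
    of either sign. *)
Lemma subexp_powR s a beta : 0 < a -> 0 < beta -> subexp (fun l => ((a * (l%:R + beta)) `^ s)%:C).
Proof.
move=> a0 b0 e e0.
have [C C0 hC] := powR_exp_bound (- s) (mulr_gt0 e0 b0).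
exists ((a * beta) `^ s * C) => l; rewrite cabs_real ger0_norm ?powR_ge0//.
have -> : a * (l%:R + beta) = a * beta * (1 + l%:R / beta).
  by field; rewrite gt_eqF.
have l0 : 0 <= l%:R / beta by rewrite divr_ge0// ltW.
have ab : 0 <= a * beta by rewrite mulr_ge0// ltW.
rewrite powRM//; last by rewrite addr_ge0.
rewrite -mulrA ler_wpM2l ?powR_ge0//.
have := hC _ l0; rewrite opprK => /le_trans; apply.
by rewrite (_ : e * beta * _ = e * l%:R)//; field; rewrite gt_eqF.
Qed.

(** Half of the decay rate [d] absorbs the growth of [c], leaving a geometric series of ratio
    [e^(-d/2)]. *)
Lemma subexp_sum c d K (B : nat -> R) : subexp c -> 0 < d ->
  (forall l, 0 <= B l) -> (forall l, B l <= K * expR (- (d * l%:R))) ->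
  exists M, sum_le (fun l => cabs (c l) * B l) M.
Proof.
move=> hc d0 B0 hB; have d2 : 0 < d / 2 by rewrite divr_gt0.
have [A hA] := hc _ d2.
have A0 : 0 <= A.
  by have := le_trans (cabs_ge0 _) (hA 0%N); rewrite mulr0 expR0 mulr1.
have K0 : 0 <= K.
  by have := le_trans (B0 _) (hB 0%N); rewrite mulr0 oppr0 expR0 mulr1.
pose x := expR (- (d / 2)).
exists ((A * K) * (1 - x)^-1).
have h : sum_le (fun q : nat => x ^+ q) (1 - x)^-1.
  by apply: sum_le_geometric; rewrite ?expR_ge0// -expR0 ltr_expR oppr_lt0.
have := sum_leZ (mulr_ge0 A0 K0) h.
move=> hs s us; apply: le_trans (hs s us); apply: ler_sum => l _.
apply: le_trans (ler_pM (cabs_ge0 _) (B0 l) (hA l) (hB l)) _.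
rewrite mulrACA ler_wpM2l ?mulr_ge0// -expRD /x -expRM_natl ler_expR.
by rewrite [X in X <= _](_ : _ = l%:R * - (d / 2))//; field.
Qed.

(** With [beta = kappa_j - n0] this is the holomorphic part of [f]; with [beta = 1 - kappa_j] it is
    the holomorphic function behind the conjugate derivative of the other part. *)
Definition eterm beta c tau (l : nat) :=
  c l * cexp ((2 * pi * (l%:R + beta))%:C * 'i%C * tau).
Definition eseries beta c tau := cseries (eterm beta c tau).

Lemma cexp_shift (a : R) tau x y :
  cexp (a%:C * 'i%C * ((Re tau + x) +i* (Im tau + y))) =
  cexp (a%:C * 'i%C * tau) * (cexp ((a * x)%:C * 'i%C) * (expR (- a * y))%:C).
Proof.
rewrite -cexp_real -!cexpD; congr cexp.
by apply: complex_ext; rewrite !(ReD, ImD, ReM, ImM) /=; ring.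
Qed.

Lemma cabs_cexp_i (a : R) tau : cabs (cexp (a%:C * 'i%C * tau)) = expR (- a * Im tau).
Proof. by rewrite cabs_cexp !(ReM, ImM) /=; congr expR; ring. Qed.

(** Each term is a phase in [x] times an exponential in [y]. The relation [a (0, 1) = i a (1, 0)] is
    the Cauchy-Riemann equation, and [a (1, 0)] is the termwise derivative. *)
Lemma eseries_dps beta c tau : subexp c -> 0 < Im tau -> exists r a M, [/\ 0 < r, r < Im tau,
  dps r a M (fun x y => eseries beta c ((Re tau + x) +i* (Im tau + y))),
  a (1, 0)%N = eseries beta (fun l => c l * ((2 * pi)%:C * 'i%C * (l%:R + beta)%:C)) tau /\
  a (0, 1)%N = 'i%C * a (1, 0)%N &
  has_sum (eterm beta c tau) (eseries beta c tau)].
Proof.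
(* With [r = v / 4] the two bounds [e^(|a l| r)] use up half of the decay [e^(-a l v)], so that
   [e^(-pi v l)] remains. *)
move=> hc; set v := Im tau => v0; pose r := v / 4.
have r0 : 0 < r by rewrite divr_gt0.
pose a (l : nat) := 2 * pi * (l%:R + beta).
have p2 : 0 <= 2 * pi :> R by rewrite mulr_ge0// pi_ge0.
have hM : exists M, sum_le (fun l => cabs (c l * cexp ((a l)%:C * 'i%C * tau)) *
    (expR (`|a l| * r) * expR (`|- a l| * r))) M.
  have [|||M hM] := @subexp_sum c (pi * v) (expR (2 * (pi * v * `|beta|) + pi * v * `|beta|)) (fun l =>
      expR (- a l * v) * (expR (`|a l| * r) * expR (`|- a l| * r))) hc.
  - by rewrite mulr_gt0// pi_gt0.
  - by move=> l; rewrite !mulr_ge0 ?expR_ge0.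
  - move=> l; rewrite -!expRD ler_expR normrN.
    have ha : `|a l| <= 2 * pi * (l%:R + `|beta|).
      by rewrite normrM (ger0_norm p2) ler_wpM2l// (le_trans (ler_normD _ _))// normr_nat.
    have h1 : `|a l| * r <= 2 * pi * (l%:R + `|beta|) * r by rewrite ler_wpM2r// ltW.
    have h2 : - beta * (pi * v) <= `|beta| * (pi * v).
      by rewrite ler_wpM2r ?mulr_ge0 ?pi_ge0 ?(ltW v0)// -normrN ler_norm.
    have -> : - a l * v = - beta * (pi * v) * 2 - (pi * v) * l%:R * 2 by rewrite /a; ring.
    have : 2 * pi * (l%:R + `|beta|) * r = (pi * v * l%:R + pi * v * `|beta|) / 2.
      by rewrite /r; field.
    move: h1 h2; rewrite (mulrC `|beta|).
    move: (pi * v * l%:R) (pi * v * `|beta|) (`|a l| * r) (_ * r) (- beta * (pi * v)) => *; lra.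
  exists M; move: hM; congr (sum_le _ _); apply/funext => l.
  by rewrite Normc.normcM cabs_cexp_i !mulrA.
have [M {}hM] := hM.
have [A [h1 h2 h3]] := dps_cseries (c := fun l => c l * cexp ((a l)%:C * 'i%C * tau)) r0
  (fun l => ps_cis (a l) (ltW r0)) (fun l => ps_expR (- a l) (ltW r0)) hM
  (t := fun x y => eterm beta c ((Re tau + x) +i* (v + y)))
  (fun x y l _ _ => etrans (congr1 (fun z => c l * z) (cexp_shift (a l) tau x y)) (mulrA _ _ _)).
exists r, A, M; split => //.
- by rewrite ltr_pdivrMr// ltr_pMr// ltr1n.
- have h10 := h2 1%N 0%N; split.
    rewrite /eseries; symmetry; apply: has_sum_cseries; apply: has_sum_ext h10 => l.
    rewrite /eterm /a expr0 expr1 !fact0 (_ : 1`! = 1%N)// !divr1 mulr1.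
    rewrite !realcM; ring.
  apply: has_sum_unique (h2 0%N 1%N) _.
  apply: has_sum_ext (has_sumZ 'i%C h10) => l.
  rewrite !expr0 !expr1 !fact0 (_ : 1`! = 1%N)// !divr1 mulr1 mul1r realcN.
  by rewrite mulrC -!mulrA ic_ic mulrN1.
- have := (h3 0 0 _ _).2; rewrite normr0 !addr0 /eseries => /(_ (ltW r0) (ltW r0)).
  by case: tau @v v0 {r r0 hM h1 h2 h3 A M a p2}.
Qed.

Lemma eseries_qdiff beta c tau : subexp c -> 0 < Im tau ->
  qdiff (eseries beta c) tau
    (eseries beta (fun l => c l * ((2 * pi)%:C * 'i%C * (l%:R + beta)%:C)) tau) 0.
Proof.
move=> hc v0; have [r [a [M [r0 _ h [h10 h01] _]]]] := eseries_dps beta hc v0.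
have := qdiff_dps (f := fun u v => eseries beta c (u +i* v)) r0 h.
rewrite h01 mulrA ic_ic mulN1r opprK subrr mul0r h10.
set E := eseries _ _ tau; rewrite (_ : (E + E) / 2 = E); last by field.
by apply: qdiff_ext => -[].
Qed.

(** * Terms with the incomplete gamma function *)

Section Nonholomorphic.
Variable k : R.

(** For [n = -(l+1)] one has [n + kappa_j = -(l + beta)] with [beta = 1 - kappa_j]. The exponential
    grows like [e^(2 pi (l + beta) v)]; the series converges because the gamma factor decays, up to
    powers, like the inverse square of this. *)
Definition nterm beta c tau (l : nat) :=
  c l * (incomplete_gamma (1 - k) (4 * pi * (l%:R + beta) * Im tau))%:C
  * cexp ((- (2 * pi * (l%:R + beta)))%:C * 'i%C * tau).
Definition nseries beta c tau := cseries (nterm beta c tau).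

(** The vertical factor of one term, with [a = 2 pi (l + beta)]. By [YE] it is a product of factors
    that each have a known power series. *)
Let Y (a v : R) (y : R) : R := incomplete_gamma (1 - k) (2 * a * (v + y)) * expR (a * (v + y)).

Let YE a v y : 0 < a -> 0 < v + y ->
  Y a v y = (2 * a) `^ (1 - k) *
    ((v + y) `^ (1 - k) * (expR (- (a * v)) * (expR (- a * y) * Lint k (2 * a * v + 2 * a * y)))).
Proof.
move=> a0 vy; have a2 : 0 < 2 * a by rewrite mulr_gt0.
rewrite /Y (incomplete_gammaE k (mulr_gt0 a2 vy)).2 -mulrDr powRM ?ltW//.
have -> : expR (- (2 * a * (v + y))) = expR (- (a * v)) * expR (- a * y) * (expR (a * (v + y)))^-1.
  by rewrite -expRN -!expRD; congr expR; ring.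
by field; rewrite gt_eqF ?expR_gt0.
Qed.

(** The first summand comes from the exponential, the second from the gamma factor, where
    [e^(-2av) e^(av)] collapses to [e^(-av)]; the latter is the source of the antiholomorphic
    contribution. *)
Let Yd a v : 0 < a -> 0 < v -> is_derive (0 : R) 1 (Y a v)
  (a * Y a v 0 - (2 * a) `^ (1 - k) * v `^ (- k) * expR (- (a * v))).
Proof.
move=> a0 v0; have a2 : 0 < 2 * a by rewrite mulr_gt0.
have w0 : 0 < 2 * a * (v + 0) by rewrite addr0 mulr_gt0.
have lin (b : R) : is_derive (0 : R) 1 (fun y => b * (v + y)) b.
  apply: (@quad_is_derive _ _ _ _ 1 0) => // h _.
  by rewrite (_ : _ - _ = 0) ?normr0 ?mul0r//; ring.
have d1 : is_derive (0:R) 1 (fun y => incomplete_gamma (1 - k) (2 * a * (v + y))) _ :=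
  @is_derive1_comp _ (incomplete_gamma (1 - k)) (fun y => 2 * a * (v + y)) _ _ _
    (is_derive_incomplete_gamma k w0) (lin (2 * a)).
have d2 : is_derive (0:R) 1 (fun y => expR (a * (v + y))) _ :=
  @is_derive1_comp _ expR (fun y => a * (v + y)) _ _ _ (is_derive_expR (a * (v + 0))) (lin a).
apply: is_derive_eq (is_deriveM d1 d2) _.
rewrite /GRing.scale /= /Y !addr0.
have -> : (2 * a) `^ (1 - k) = 2 * a * (2 * a) `^ (- k).
  rewrite -{2}[2 * a]powRr1 ?ltW// -powRD//.
  by rewrite (gt_eqF a2) implybT.
rewrite powRM ?ltW//.
have -> : expR (- (2 * a * v)) = expR (- (a * v)) * (expR (a * v))^-1.
  by rewrite -expRN -expRD; congr expR; ring.
by field; rewrite gt_eqF ?expR_gt0.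
Qed.

(** Differentiating the exponentials multiplies the coefficients by [2 pi (l + beta)], up to a
    constant, while the gamma factor contributes [v^(-k)] times exponentials in [- conj tau]. The
    two first order coefficients thus fail the Cauchy-Riemann equation exactly by the second
    series. *)
Lemma nseries_dps beta c tau : 0 < beta -> subexp c -> 0 < Im tau -> exists r a M,
  [/\ 0 < r, r < Im tau,
  dps r a M (fun x y => nseries beta c ((Re tau + x) +i* (Im tau + y))),
  a (1, 0)%N = - 'i%C * nseries beta (fun l => c l * (2 * pi * (l%:R + beta))%:C) tau /\
  a (0, 1)%N = nseries beta (fun l => c l * (2 * pi * (l%:R + beta))%:C) tau
    - (Im tau `^ (- k))%:C * eseries beta
        (fun l => c l * ((4 * pi * (l%:R + beta)) `^ (1 - k))%:C) (- tau^*%C) &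
  has_sum (nterm beta c tau) (nseries beta c tau)].
Proof.
move=> b0 hc; set v := Im tau => v0.
have [rp [bp [Bp [rp0 rpv hp]]]] := ps_powR (1 - k) v0.
(* [rp] is a radius for the power [(v + y)^(1-k)]; the bound [v / 4] again leaves half of the
   exponential decay. *)
pose r := Num.min rp (v / 4).
have r0 : 0 < r by rewrite lt_min rp0 divr_gt0.
have rv : r < v by rewrite gt_min rpv.
have r4 : r <= v / 4 by rewrite ge_min lexx orbT.
have rrp : r <= rp by rewrite ge_min lexx.
have {}hp := ps_sub (ltW r0) rrp hp.
have Bp0 := ps_ge0 hp.
pose a (l : nat) := 2 * pi * (l%:R + beta).
have pi0 := pi_gt0 R.
have a0 l : 0 < a l by rewrite mulr_gt0 ?mulr_gt0// ltr_wpDl.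
(* [Lint] is decreasing, so its value at the lowest frequency [l = 0] and the lowest height [v - r]
   bounds it for all [l] at once. *)
pose L0 := Lint k (2 * (2 * pi * beta) * (v - r)).
have L0_ge0 : 0 <= L0 by exact: Lint_ge0.
have hY l : exists b, ps r b (((2 * a l) `^ (1 - k)) *
    (Bp * (expR (- (a l * v)) * (expR (a l * r) * L0)))) (fun y => (Y (a l) v y)%:C).
  have a2 : 0 < 2 * a l by rewrite mulr_gt0.
  have [|b1 h1] := @ps_Lint _ k (2 * a l * v) (2 * a l * r) (mulr_gt0 a2 r0).
    by rewrite ltr_pM2l.
  have h2 : ps (2 * a l * r) b1 L0 (fun y => (Lint k (2 * a l * v + y))%:C).
    apply: ps_le h1; apply: Lint_le.
      by rewrite !mulr_gt0// subr_gt0.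
    rewrite -mulrBr ler_pM2r ?subr_gt0// ler_pM2l// /a ler_pM2l ?mulr_gt0//.
    by rewrite lerDr.
  have h3 := ps_comp_scale (ltW r0) a2 h2.
  have [b4 h4] := ps_mul (ltW r0) (ps_expR (- a l) (ltW r0)) h3.
  have h5 := ps_scale (expR (- (a l * v)))%:C h4.
  have [b6 h6] := ps_mul (ltW r0) hp h5.
  have h7 := ps_scale ((2 * a l) `^ (1 - k))%:C h6.
  exists (fun q => ((2 * a l) `^ (1 - k))%:C * b6 q).
  move: h7; rewrite !cabs_real (ger0_norm (powR_ge0 _ _)) (ger0_norm (expR_ge0 _)).
  rewrite normrN (gtr0_norm (a0 l)); apply: ps_ext => y yr.
  rewrite -!realcM -YE//.
  by move: yr; rewrite ler_norml => /andP[]; lra.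
have [aY {}hY] := choice hY.
(* The phase in [Re tau] goes into the coefficient without changing its modulus. *)
pose c' l := c l * cexp ((- a l * Re tau)%:C * 'i%C).
have cc l : cabs (c' l) = cabs (c l).
  by rewrite Normc.normcM cabs_cexp !(ReM, ImM) /= !(mulr0, mul0r, mulr1, subr0) expR0 mulr1.
have hM : exists M, sum_le (fun l => cabs (c' l) *
    (expR (`|- a l| * r) * (((2 * a l) `^ (1 - k)) *
    (Bp * (expR (- (a l * v)) * (expR (a l * r) * L0)))))) M.
  have sc : subexp (fun l => c l * ((2 * (2 * pi) * (l%:R + beta)) `^ (1 - k))%:C).
    by apply: subexpM hc _; apply: subexp_powR => //; rewrite !mulr_gt0.
  have [|||M hM] := @subexp_sum _ (pi * v) (Bp * L0) (fun l =>
    expR (a l * r) * (Bp * (expR (- (a l * v)) * (expR (a l * r) * L0)))) sc.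
  - by rewrite mulr_gt0.
  - by move=> l; rewrite !mulr_ge0 ?expR_ge0.
  - move=> l.
    have -> : expR (a l * r) * (Bp * (expR (- (a l * v)) * (expR (a l * r) * L0)))
        = Bp * L0 * (expR (a l * r) * expR (- (a l * v)) * expR (a l * r)) by ring.
    rewrite ler_wpM2l ?mulr_ge0// -!expRD ler_expR.
    have h1 : a l * r <= a l * (v / 4) by rewrite ler_wpM2l// ltW.
    have h2 : a l * v = 2 * (pi * v * l%:R) + 2 * (pi * v * beta) by rewrite /a; ring.
    have h3 : 0 <= pi * v * beta by rewrite !mulr_ge0// ltW.
    have h4 : a l * (v / 4) = a l * v / 4 by rewrite mulrA.
    move: h1; rewrite h4 h2.
    move: (pi * v * l%:R) (pi * v * beta) (a l * r) h3 => *; lra.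
  exists M; move: hM; congr (sum_le _ _); apply/funext => l.
  rewrite cc Normc.normcM cabs_real (ger0_norm (powR_ge0 _ _)) normrN (gtr0_norm (a0 l)).
  by rewrite -(mulrA 2 (2 * pi)) -/(a l) -!mulrA; congr (_ * _); rewrite mulrCA.
have [M {}hM] := hM.
have tE x y l : `|x| <= r -> `|y| <= r -> nterm beta c ((Re tau + x) +i* (v + y)) l =
    c' l * (cexp ((- a l * x)%:C * 'i%C) * (Y (a l) v y)%:C).
  move=> _ _; rewrite /nterm /c' /Y /=.
  have -> : 4 * pi * (l%:R + beta) = 2 * a l by rewrite /a; ring.
  have -> : cexp ((- (2 * pi * (l%:R + beta)))%:C * 'i%C * ((Re tau + x) +i* (v + y))) =
      cexp ((- a l * Re tau)%:C * 'i%C) * (cexp ((- a l * x)%:C * 'i%C) * cexp (a l * (v + y))%:C).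
    rewrite -!cexpD -/(a l); congr cexp.
    by apply: complex_ext; rewrite !(ReD, ImD, ReM, ImM) /=; ring.
  by rewrite (realcM (incomplete_gamma _ _)) cexp_real; ring.
have [A [h1 h2 h3]] := dps_cseries (c := c') r0
  (fun l => ps_cis (- a l) (ltW r0)) hY hM
  (t := fun x y => nterm beta c ((Re tau + x) +i* (v + y))) tE.
have hs0 : has_sum (nterm beta c tau) (nseries beta c tau).
  have := (h3 0 0 _ _).2; rewrite normr0 !addr0 /nseries => /(_ (ltW r0) (ltW r0)).
  by rewrite /v; case: (tau).
have tauE : tau = (Re tau + 0) +i* (v + 0) by rewrite !addr0 /v; case: (tau).
have t0 l : nterm beta c tau l = c' l * (Y (a l) v 0)%:C.
  rewrite {1}tauE tE ?normr0 ?ltW// mulr0 (_ : 0%:C = 0)// mul0r cexp0.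
  by rewrite mul1r.
have aY0 l : aY l 0%N = (Y (a l) v 0)%:C by rewrite -(ps_0 (ltW r0) (hY l)).
have aY1 l : aY l 1%N = (a l * Y (a l) v 0 - (2 * a l) `^ (1 - k) * v `^ (- k) * expR (- (a l * v)))%:C.
  exact: ps_real_coef1 r0 (hY l) (Yd (a0 l) v0).
have nE l : nterm beta (fun l => c l * (a l)%:C) tau l = (a l)%:C * (c' l * (Y (a l) v 0)%:C).
  by rewrite -t0 /nterm; ring.
have h10 : has_sum (fun l => - 'i%C * nterm beta (fun l => c l * (a l)%:C) tau l) (A (1, 0)%N).
  apply: has_sum_ext (h2 1%N 0%N) => l.
  by rewrite expr1 (_ : 1`! = 1%N)// divr1 aY0 nE realcN; ring.
have i2 : - 'i%C * 'i%C = 1 :> R[i] by rewrite mulNr ic_ic opprK.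
have hn : has_sum (nterm beta (fun l => c l * (a l)%:C) tau) ('i%C * A (1, 0)%N).
  apply: has_sum_ext (has_sumZ 'i%C h10) => l.
  by rewrite mulrA mulrN ic_ic opprK mul1r.
have nsE : nseries beta (fun l => c l * (a l)%:C) tau = 'i%C * A (1, 0)%N by exact: has_sum_cseries.
exists r, A, M; split => //; rewrite -/a nsE; split.
  by rewrite mulrA i2 mul1r.
have h01 : has_sum (fun l => nterm beta (fun l => c l * (a l)%:C) tau l -
    (v `^ (- k))%:C * eterm beta (fun l => c l * ((4 * pi * (l%:R + beta)) `^ (1 - k))%:C) (- tau^*%C) l)
    (A (0, 1)%N).
  apply: has_sum_ext (h2 0%N 1%N) => l.
  rewrite expr0 fact0 divr1 mul1r aY1 nE realcB realcM /eterm -/(a l).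
  have -> : 4 * pi * (l%:R + beta) = 2 * a l by rewrite /a; ring.
  have -> : cexp ((a l)%:C * 'i%C * - tau^*%C) =
      cexp ((- a l * Re tau)%:C * 'i%C) * (expR (- (a l * v)))%:C.
    rewrite -cexp_real -cexpD; congr cexp.
    by rewrite /v; apply: complex_ext; case: (tau) => ? ?; rewrite !(ReD, ImD, ReM, ImM) /=; ring.
  by rewrite (realcM _ (expR _)) realcM /c'; ring.
have he : has_sum (eterm beta (fun l => c l * ((4 * pi * (l%:R + beta)) `^ (1 - k))%:C) (- tau^*%C))
    (eseries beta (fun l => c l * ((4 * pi * (l%:R + beta)) `^ (1 - k))%:C) (- tau^*%C)).
  have [||? [? [? [_ _ _ _]]]] := @eseries_dps beta (fun l => c l * ((4 * pi * (l%:R + beta)) `^ (1 - k))%:C) (- tau^*%C).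
  - by apply: subexpM => //; apply: subexp_powR => //; rewrite mulr_gt0.
  - by move: v0; rewrite /v; case: (tau) => ? ? /=; rewrite opprK.
  - by [].
apply: has_sum_unique h01 _.
by apply: has_sumD hn _; apply: has_sumN; exact: has_sumZ.
Qed.

Lemma nseries_qdiff beta c tau : 0 < beta -> subexp c -> 0 < Im tau ->
  let Q := nseries beta (fun l => c l * (2 * pi * (l%:R + beta))%:C) tau in
  let G := (Im tau `^ (- k))%:C * eseries beta
        (fun l => c l * ((4 * pi * (l%:R + beta)) `^ (1 - k))%:C) (- tau^*%C) in
  qdiff (nseries beta c) tau (- 'i%C * Q + 'i%C / 2 * G) (- ('i%C / 2) * G).
Proof.
move=> b0 hc v0 Q G; have [r [a [M [r0 _ h [h10 h01] _]]]] := nseries_dps b0 hc v0.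
have := qdiff_dps (f := fun u v => nseries beta c (u +i* v)) r0 h.
rewrite h01 h10 -/Q -/G => hq.
rewrite (_ : - 'i%C * Q + _ = (- 'i%C * Q - 'i%C * (Q - G)) / 2); last first.
  by field.
rewrite (_ : - _ * G = (- 'i%C * Q + 'i%C * (Q - G)) / 2); last by field.
by apply: qdiff_ext hq => -[].
Qed.
End Nonholomorphic.
End ExponentialSeries.

(** * L-series as integrals *)

Section TestFunctions.
Variable R : realType.
Notation mu := (@lebesgue_measure R).
Implicit Types (phi : R -> R[i]) (a b B : R).

(** The product majorant [g t * h x] supplies joint integrability on the plane. *)
Lemma Rfubini (F : R * R -> R) (g h : R -> R) : measurable_fun setT F ->
  rint setT g -> rint setT h -> (forall t x, `|F (t, x)| <= g t * h x) ->
  \int[mu]_t \int[mu]_x F (t, x) = \int[mu]_x \int[mu]_t F (t, x).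
Proof.
move=> mF ig ih bF.
have mf : measurable_fun setT (EFin \o F) by exact/measurable_EFinP.
have fin1 t : rint setT (fun x => F (t, x)).
  apply: (rint_dom (g := fun x => g t * h x)) => //; last exact: rintZ.
  exact: (measurableT_comp mF (pair1_measurable t)).
have fin2 x : rint setT (fun t => F (t, x)).
  apply: (rint_dom (g := fun t => h x * g t)) => //; last exact: rintZ.
    exact: (measurableT_comp mF (pair2_measurable x)).
  by move=> t _; rewrite mulrC.
pose H := \int[mu]_x h x.
have fI : (mu \x mu)%E.-integrable setT (EFin \o F).
  apply/integrable12ltyP => //.
  apply: (@le_lt_trans _ _ (\int[mu]_t (H * g t)%:E)%E); last first.
    by apply: integrable_lty => //; exact: rintZ.
  apply: ge0_le_integral => //.
  - by move=> t _; exact: integral_ge0.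
  - have ma : measurable_fun setT (abse \o (EFin \o F)) by exact: measurableT_comp.
    exact: (@measurable_fun_fubini_tonelli_F _ _ _ _ _ mu _ ma (fun z => abse_ge0 _)).
  - by apply/measurable_EFinP; exact: rint_meas (rintZ H measurableT ig).
  - move=> t _; rewrite mulrC EFinM.
    have -> : (H%:E = \int[mu]_x (h x)%:E)%E.
      by rewrite /H /Rintegral fineK// (integrable_fin_num _ ih).
    rewrite -integralZl//; apply: ge0_le_integral => //.
    + apply: measurableT_comp => //; apply/measurable_EFinP; exact: rint_meas (fin1 t).
    + by apply/measurable_EFinP; exact: rint_meas (rintZ (g t) measurableT ih).
    + by move=> x _; rewrite /= -EFinM lee_fin.
have := Fubini fI.
rewrite /Rintegral => E; congr fine.
transitivity (\int[mu]_t \int[mu]_x (EFin \o F) (t, x))%E.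
  by apply: eq_integral => t _; rewrite fineK// (integrable_fin_num _ (fin1 t)).
rewrite E; apply: eq_integral => x _.
by rewrite fineK// (integrable_fin_num _ (fin2 x)).
Qed.

Lemma rint_setT (D : set R) (f : R -> R) : measurable D -> rint D f <-> rint setT (f \_ D).
Proof. by move=> mD; rewrite /rint -restrict_EFin; exact: integrable_mkcond. Qed.

Lemma indic_itvE a b x : \1_`[a, b] x = (a <= x <= b)%R%:R :> R.
Proof. by rewrite indicE; congr (_%:R); congr nat_of_bool; apply/idP/idP; rewrite inE /= in_itv. Qed.

(** One inequality encodes both the support in [[a, b]] and the bound [B]; positivity of [a] keeps
    the support away from [0], where the weights [x^s] may be unbounded. *)
Definition test_bound a b B phi := [/\ 0 < a, cmeas setT phi &
  forall x, cabs (phi x) <= B * \1_`[a, b] x].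
Definition nice phi := exists a b B, test_bound a b B phi.

Lemma test_bound_out a b B phi x : test_bound a b B phi -> ~ (a <= x <= b) -> phi x = 0.
Proof.
move=> [_ _ h] ax; apply: cabs_le0_eq => e e0; apply: le_lt_trans e0.
by rewrite (le_trans (h x))// indic_itvE; move/negP/negbTE: ax => ->; rewrite mulr0.
Qed.

Lemma test_bound_in a b B phi x : test_bound a b B phi -> cabs (phi x) <= `|B|.
Proof.
move=> [_ _ h]; apply: le_trans (h x) _; rewrite indicE.
by case: (x \in _); rewrite ?mulr0// mulr1 ler_norm.
Qed.

Lemma rint_indic a b B (D : set R) : measurable D -> rint D (fun x => B * \1_`[a, b] x).
Proof.
move=> mD; apply: rintZ => //.
have := @integrable_indic_itv R a b true false.
by apply: integrableS.
Qed.

(** A power is monotone, increasing or decreasing according to the sign of [s]; the sum of the two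
    endpoint values covers both cases. *)
Lemma powR_bound (s a b : R) : 0 < a -> forall x, a <= x <= b -> x `^ s <= a `^ s + b `^ s.
Proof.
move=> a0 x /andP[ax xb]; have x0 : 0 < x by exact: lt_le_trans ax.
have [s0|s0] := leP 0 s.
  apply: (@le_trans _ _ (b `^ s)); last by rewrite lerDr powR_ge0.
  by rewrite ge0_ler_powR ?nnegrE ?(ltW x0)// (le_trans (ltW x0)).
apply: (@le_trans _ _ (a `^ s)); last by rewrite lerDl powR_ge0.
have [t t0 ->] : exists2 t, 0 <= t & s = - t by exists (- s); rewrite ?opprK// oppr_ge0 ltW.
rewrite !powRN lef_pV2 ?posrE ?powR_gt0//.
by rewrite ge0_ler_powR ?nnegrE ?(ltW x0) ?(ltW a0).
Qed.

Lemma test_boundM a b B phi (g : R -> R) C : test_bound a b B phi ->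
  measurable_fun setT g -> (forall x, a <= x <= b -> `|g x| <= C) ->
  test_bound a b (B * C) (fun x => phi x * (g x)%:C).
Proof.
move=> [a0 mp h] mg hg; split => //; first by apply: cmeasM => //; exact: cmeas_real.
move=> x; rewrite Normc.normcM cabs_real; have := h x; rewrite indic_itvE.
have [hx|_] := boolP (a <= x <= b).
  by rewrite !mulr1 => hp; rewrite ler_pM ?cabs_ge0// hg.
by rewrite !mulr0 => hp; rewrite mulr_le0_ge0.
Qed.

Lemma nice_twist s phi : nice phi -> nice (twist s phi).
Proof.
move=> [a [b [B h]]]; have [a0 _ _] := h.
exists a, b, (B * (a `^ (s - 1) + b `^ (s - 1))).
apply: (test_boundM (g := fun x => x `^ (s - 1)) h); first exact: measurable_powR.
by move=> x hx; rewrite ger0_norm ?powR_ge0// powR_bound.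
Qed.

Lemma test_bound_slash k chi a b B phi : a <= b -> test_bound a b B phi ->
  exists B', test_bound b^-1 a^-1 B' (slash_test k chi phi).
Proof.
move=> ab h; have [a0 mp hp] := h.
have b0 : 0 < b by exact: lt_le_trans ab.
(* For [x > 0] the inverse is the power [x^(-1)], measurable by [measurable_powR]; for [x <= 0] the
   indicator gives the value [0] that [phi] at [x^-1] has there too. *)
pose psi x := phi (x `^ (-1)) * (\1_(`]0, +oo[ : set R) x)%:C * (chi SL2ZS).
have psiE x : phi x^-1 * chi SL2ZS = psi x.
  rewrite /psi indicE; have [x0|x0] := ltP 0 x.
    by rewrite mem_set ?mulr1 ?powR_inv1 ?ltW//= in_itv /= x0.
  rewrite memNset ?mulr0 ?mul0r ?(test_bound_out h) ?mul0r//.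
    by move=> /andP[h1 _]; move: x0; rewrite -invr_le0 leNgt (lt_le_trans a0 h1).
  by rewrite /= in_itv /= andbT ltNge x0.
have mi : measurable_fun setT (fun x : R => x `^ (-1)) by exact: measurable_powR.
have hb : test_bound b^-1 a^-1 (B * cabs (chi SL2ZS)) psi.
  split; first by rewrite invr_gt0.
  - apply: cmeasM; last exact: cmeas_cst.
    apply: cmeasM; last by apply: cmeas_real; exact: measurable_indic.
    by split; [exact: (measurableT_comp mp.1 mi)|exact: (measurableT_comp mp.2 mi)].
  - move=> x; rewrite -psiE Normc.normcM mulrAC ler_wpM2r ?cabs_ge0//.
    apply: le_trans (hp _) _; rewrite !indic_itvE.
    suff -> : (a <= x^-1 <= b) = (b^-1 <= x <= a^-1) by [].
    have [x0|x0] := ltP 0 x.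
      by rewrite andbC invf_ple ?posrE// [in RHS]invf_pge ?posrE.
    have x1 : x^-1 <= 0 by rewrite invr_le0.
    rewrite !leNgt (le_lt_trans x1 a0) (le_lt_trans x0) ?invr_gt0//.
exists (B * cabs (chi SL2ZS) * ((b^-1) `^ (k - 2) + (a^-1) `^ (k - 2))).
have -> : slash_test k chi phi = fun x => psi x * (x `^ (k - 2))%:C.
  by apply/funext => x; rewrite /slash_test -psiE; ring.
apply: (test_boundM (g := fun x => x `^ (k - 2)) hb); first exact: measurable_powR.
by move=> x hx; rewrite ger0_norm ?powR_ge0// powR_bound// invr_gt0.
Qed.

Lemma nice_slash k chi phi : nice phi -> nice (slash_test k chi phi).
Proof.
move=> [a [b [B h]]]; have [ab|ba] := leP a b.
  by have [B' hB'] := test_bound_slash k chi ab h; exists b^-1, a^-1, B'.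
exists 1, 1, 0; split => //.
    have -> : slash_test k chi phi = fun=> 0; last exact: cmeas_cst.
    apply/funext => x; rewrite /slash_test (test_bound_out h) ?mulr0// => /andP[h1 h2].
    by have := lt_le_trans ba (le_trans h1 h2); rewrite ltxx.
  move=> x; rewrite /slash_test (test_bound_out h) ?mulr0 ?normcr0 ?mul0r//.
    by rewrite Normc.normc0.
  by move=> /andP[h1 h2]; have := lt_le_trans ba (le_trans h1 h2); rewrite ltxx.
Qed.

(** On the compact support each smooth piece is bounded, and the sum of these bounds serves for all
    pieces. Measurability is checked on a countable cover by the pieces and the half-line [x <= 0],
    where [phi] vanishes. *)
Lemma nice_of_pieces phi : compactly_supported_pos phi -> piecewise_smooth phi -> nice phi.
Proof.
move=> [a [b [a0 supp]]] [N [I [g [h [hs _ cov hI]]]]].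
have cont (u : R -> R) : smooth u -> continuous u.
  move=> su x; apply: differentiable_continuous; apply/derivable1_diffP.
  exact: su 0%N x.
have meas (p : R[i] -> R) (G : 'I_N -> R -> R) : p 0 = 0 -> (forall i, continuous (G i)) ->
    (forall i x, 0 < x -> x \in I i -> p (phi x) = G i x) ->
    measurable_fun setT (fun x => p (phi x)).
  move=> p0 Gc hp.
  pose E (n : nat) : set R := if (n < N)%N then (if insub n is Some i then [set` I i] `&` `]0, +oo[ else set0)%classic else `]-oo, 0]%classic.
  have mE n : measurable (E n).
    rewrite /E; case: ifP => nN //; case: insub => // i; exact: measurableI.
  have -> : setT = \bigcup_n E n.
    apply/seteqP; split => // x _; have [x0|x0] := ltP 0 x; last first.
      by exists N => //; rewrite /E ltnn /= in_itv.
    have [i xi] := cov x x0; exists i => //; rewrite /E ltn_ord valK /=; split => //.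
    by rewrite /= in_itv /= x0.
  apply/measurable_fun_bigcup => // n; rewrite /E; case: ifP => nN; last first.
    have : measurable_fun (`]-oo, 0] : set R) (cst (0 : R)) by exact: measurable_cst.
    apply: eq_measurable_fun => x.
    rewrite inE /= in_itv /= => x0; rewrite supp ?p0// => /andP[ax _].
    by have := lt_le_trans a0 (le_trans ax x0); rewrite ltxx.
  case: insubP => [i _ _|_]; last exact: measurable_fun_set0.
  apply: (eq_measurable_fun (G i)).
    move=> x /set_mem [xi x0]; rewrite (hp i)//.
    by move: x0; rewrite /= in_itv /= andbT.
  by apply: measurable_funTS; exact: continuous_measurable_fun.
have bd (u : R -> R) : continuous u -> exists C, forall x, a <= x <= b -> `|u x| <= C.
  move=> uc; have [ab|ba] := leP a b; last first.
    by exists 0 => x /andP[h1 h2]; have := lt_le_trans ba (le_trans h1 h2); rewrite ltxx.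
  have [c _ hc] := @EVT_max R (fun x => `|u x|) a b ab (continuous_subspaceT (fun x => continuous_comp (uc x) (@norm_continuous _ _ _))).
  by exists (`|u c|) => x hx; apply: hc; rewrite in_itv.
have [Cg hCg] := choice (fun i => bd (g i) (cont _ (hs i).1)).
have [Ch hCh] := choice (fun i => bd (h i) (cont _ (hs i).2)).
exists a, b, (\sum_i (`|Cg i| + `|Ch i|)); split => //.
  split; [apply: (meas (@Re R) g)|apply: (meas (@Im R) h)] => //.
  - by move=> i; apply: cont; exact: (hs i).1.
  - by move=> i x x0 xi; rewrite (hI i).
  - by move=> i; apply: cont; exact: (hs i).2.
  - by move=> i x x0 xi; rewrite (hI i).
move=> x; rewrite indic_itvE; have [hx|hx] := boolP (a <= x <= b); last first.
  by rewrite mulr0 supp; [rewrite Normc.normc0|exact/negP].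
have [ax _] := andP hx; have x0 := lt_le_trans a0 ax.
have [i xi] := cov x x0; rewrite mulr1 (bigD1 i)//= ler_wpDr ?sumr_ge0//.
apply: le_trans (cabs_le_ReIm _) _; rewrite (hI i)//= lerD//.
  by apply: le_trans (hCg i x hx) _; exact: ler_norm.
by apply: le_trans (hCh i x hx) _; exact: ler_norm.
Qed.

(** The sum is measurable as a pointwise limit of its partial sums, and [g] dominates everything
    else. *)
Lemma cintegral_dominated D (u : nat -> R -> R[i]) s g : measurable D ->
  (forall l, cmeas D (u l)) -> rint D g ->
  (forall x, D x -> has_sum (fun l => u l x) (s x)) ->
  (forall x, D x -> abs_le (fun l => u l x) (g x)) ->
  [/\ forall l, cint D (u l), cint D s &
   cseries_cvg (fun l => cintegral D (u l)) (cintegral D s)].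
Proof.
move=> mD mu_ ig hs hg.
have iu l : cint D (u l).
  apply: cint_dom ig => // x Dx.
  by have := hg x Dx [:: l] isT; rewrite big_seq1.
have ms : cmeas D s.
  split.
    apply: (@measurable_fun_cvg _ _ _ _ (fun n x => Re (\sum_(0 <= l < n) u l x))).
      by move=> n; exact: (cmeas_sum n mu_).1.
    move=> x Dx; have [h _] := has_sum_cseries_cvg (hs x Dx).
    by rewrite (_ : (fun n => Re _) = series (fun n => Re (u n x)))//; apply/funext => n; rewrite Re_sum.
  apply: (@measurable_fun_cvg _ _ _ _ (fun n x => Im (\sum_(0 <= l < n) u l x))).
    by move=> n; exact: (cmeas_sum n mu_).2.
  move=> x Dx; have [_ h] := has_sum_cseries_cvg (hs x Dx).
  by rewrite (_ : (fun n => Im _) = series (fun n => Im (u n x)))//; apply/funext => n; rewrite Im_sum.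
have is_ : cint D s.
  by apply: cint_dom ig => // x Dx; apply: has_sum_le (hg x Dx) (hs x Dx).
by split => //; exact: cintegral_series mD iu is_ ig hs hg.
Qed.


Let mpos : measurable (`]0, +oo[ : set R). Proof. exact: measurable_itv. Qed.

(** Fubini: integrating over [t] first turns [e^(-w(2t+1)x) (1+t)^(-k)] into [e^(-wx) Lint(2wx)]. As
    [q] lives on [x >= a > 0], the kernel is dominated by [e^(-2wat) (1+t)^(-k)], which is
    integrable whatever the sign of [k]. *)
Let Rlaplace_mean (k w a b B : R) (q : R -> R) : 0 < w -> 0 < a -> measurable_fun setT q ->
  (forall x, `|q x| <= B * \1_`[a, b] x) ->
  \int[mu]_(t in `[0, +oo[) ((\int[mu]_(x in `]0, +oo[) (expR (- (w * (2 * t + 1) * x)) * q x)) * (1 + t) `^ (- k))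
  = \int[mu]_(x in `]0, +oo[) (expR (- (w * x)) * Lint k (2 * w * x) * q x).
Proof.
move=> w0 a0 mq hq.
have I0 (f : R -> R) : (forall x, f x = 0) -> \int[mu]_x f x = 0.
  by move=> f0; rewrite /Rintegral (eq_integral (cst 0%E)) ?integral0// => x _; rewrite f0.
have q0 x : x < a -> q x = 0.
  move=> xa; apply/eqP; rewrite -normr_le0; apply: le_trans (hq x) _.
  by rewrite indic_itvE (leNgt a x) xa mulr0.
(* Half-lines are replaced by full lines, with a cut-off [ind] in [t] and the support of [q] in [x],
   so that Fubini can be applied on the plane. *)
have [ind [mo o1 o0]] : exists ind : R -> R, [/\ measurable_fun setT ind,
    forall t, 0 <= t -> ind t = 1 & forall t, t < 0 -> ind t = 0].
  exists (\1_(`[0, +oo[ : set R)); split; first exact: measurable_indic.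
    by move=> t t0; rewrite indicE mem_set//= in_itv /= t0.
  by move=> t t0; rewrite indicE memNset//= in_itv /= andbT leNgt t0.
have to0 (f : R -> R) : \int[mu]_(t in `[0, +oo[) f t = \int[mu]_t (ind t * f t).
  rewrite Rintegral_mkcond; apply: eq_Rintegral => t _.
  rewrite patchE (_ : (t \in _) = (0 <= t)) ?mem_setE ?in_itv /= ?andbT//.
  by case: leP => t0; rewrite ?(o1 t t0) ?(o0 t t0) ?mul1r ?mul0r.
have toq (f : R -> R) : \int[mu]_(x in `]0, +oo[) (f x * q x) = \int[mu]_x (f x * q x).
  rewrite Rintegral_mkcond; apply: eq_Rintegral => x _.
  rewrite patchE (_ : (x \in _) = (0 < x)) ?mem_setE ?in_itv /= ?andbT//.
  by case: ltP => // x0; rewrite q0 ?mulr0// (le_lt_trans x0).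
have fi t : 0 <= t -> rint setT (fun x => expR (- (w * (2 * t + 1) * x)) * q x).
  move=> t0; apply: (rint_dom (g := fun x => B * \1_`[a, b] x)) => //.
  - apply: measurable_funM => //; apply: measurableT_comp => //; exact: measurableT_comp.
  - move=> x _; rewrite normrM (ger0_norm (expR_ge0 _)).
    have [xa|ax] := ltP x a; first by rewrite q0// normr0 mulr0; exact: le_trans (hq x).
    apply: le_trans (hq x); rewrite ler_piMl// -expR0 ler_expR oppr_le0.
    have x0 : 0 <= x by exact: le_trans (ltW a0) ax.
    by rewrite !mulr_ge0 ?addr_ge0 ?mulr_ge0// ltW.
  - exact: rint_indic.
pose F (p : R * R) := ind p.1 * (expR (- (w * (2 * p.1 + 1) * p.2)) * q p.2) * (1 + p.1) `^ (- k).
have mf1 : measurable_fun setT (fun p : R * R => p.1) by exact: measurable_fst.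
have mf2 : measurable_fun setT (fun p : R * R => p.2) by exact: measurable_snd.
have mF : measurable_fun setT F.
  apply: measurable_funM; last first.
    by apply: (measurableT_comp (measurable_powR (- k))); exact: measurable_funD.
  apply: measurable_funM; first exact: (measurableT_comp mo mf1).
  apply: measurable_funM; last exact: (measurableT_comp mq mf2).
  apply: measurableT_comp => //; apply: measurableT_comp => //.
  apply: measurable_funM => //; apply: measurable_funM => //.
  by apply: measurable_funD => //; exact: measurable_funM.
have rl d : 0 < d -> rint setT (fun t => ind t * (expR (- (d * t)) * (1 + t) `^ (- k))).
  move=> d0; have /rint_setT := rint_lint k d0 => /(_ (measurable_itv _)).
  congr (rint _ _); apply/funext => t; rewrite patchE.
  rewrite (_ : (t \in _) = (0 <= t)) ?mem_setE ?in_itv /= ?andbT//.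
  by case: leP => t0; rewrite ?(o1 t t0) ?(o0 t t0) ?mul1r ?mul0r.
have c0 : 0 < 2 * w * a by rewrite !mulr_gt0.
have ig : rint setT (fun t => ind t * (expR (- (2 * w * a * t)) * (1 + t) `^ (- k))).
  exact: rl.
have ih : rint setT (fun x => B * \1_`[a, b] x) by exact: rint_indic.
have bF t x : `|F (t, x)| <= ind t * (expR (- (2 * w * a * t)) * (1 + t) `^ (- k)) * (B * \1_`[a, b] x).
  rewrite /F /=; have [t0|t0] := leP 0 t; last by rewrite o0// !mul0r normr0.
  rewrite o1// !mul1r !normrM (ger0_norm (expR_ge0 _)) (ger0_norm (powR_ge0 _ _)).
  rewrite mulrAC; have [xa|ax] := ltP x a.
    rewrite q0// normr0 mulr0; apply: mulr_ge0; last exact: le_trans (hq x).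
    by rewrite mulr_ge0 ?expR_ge0 ?powR_ge0.
  apply: ler_pM (hq x) => //; rewrite ?mulr_ge0 ?expR_ge0 ?powR_ge0//.
  rewrite ler_wpM2r ?powR_ge0// ler_expR lerN2.
  have x0 : 0 <= x by exact: le_trans (ltW a0) ax.
  have -> : 2 * w * a * t = 2 * w * t * a by ring.
  have -> : w * (2 * t + 1) * x = 2 * w * t * x + w * x by ring.
  by rewrite ler_wpDr ?ler_wpM2l ?mulr_ge0// ltW.
have := Rfubini mF ig ih bF.
rewrite to0 toq => E; transitivity (\int[mu]_t \int[mu]_x F (t, x)).
  apply: eq_Rintegral => t _; rewrite toq /F /=.
  have [t0|t0] := leP 0 t; last first.
    rewrite (o0 t t0); transitivity (0 : R); first exact: mul0r.
    by symmetry; apply: I0 => x; rewrite mul0r mul0r.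
  rewrite (o1 t t0); transitivity (\int[mu]_x (expR (- (w * (2 * t + 1) * x)) * q x) * (1 + t) `^ (- k)); first exact: mul1r.
  rewrite -RintegralZr; [|exact: measurableT|].
    by apply: eq_Rintegral => x _; congr (_ * _); rewrite mul1r.
  exact: fi.
rewrite E; apply: eq_Rintegral => x _; rewrite /F /=.
have [xa|ax] := ltP x a.
  rewrite (q0 x xa); transitivity (0 : R); last by symmetry; exact: mulr0.
  by apply: (I0 (fun t => ind t * (expR (- (w * (2 * t + 1) * x)) * 0) * (1 + t) `^ (- k))) => t; rewrite mulr0 mulr0 mul0r.
have x0 : 0 < x by exact: lt_le_trans ax.
rewrite /Lint to0.
have c1 : 0 < 2 * w * x by rewrite !mulr_gt0.
rewrite -RintegralZl; [|exact: measurableT|exact: rl].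
rewrite -RintegralZr; [|exact: measurableT|exact: (rintZ _ _ (rl _ c1))].
apply: eq_Rintegral => t _.
by rewrite (_ : - (w * (2 * t + 1) * x) = - (w * x) + - (2 * w * x * t)) ?expRD; ring.
Qed.

Lemma laplace_mean (k w : R) phi : 0 < w -> nice phi ->
  cintegral `[0, +oo[ (fun t => laplace phi (w * (2 * t + 1)) / ((1 + t) `^ k)%:C) =
  cintegral `]0, +oo[ (fun x => (expR (- (w * x)) * Lint k (2 * w * x))%:C * phi x).
Proof.
move=> w0 [a [b [B [a0 [m1 m2] h]]]].
have e1 (z : R[i]) (y : R) : Re (z / (y `^ k)%:C) = Re z * y `^ (- k).
  by rewrite -realcV ReM /= mulr0 subr0 powRN.
have e2 (z : R[i]) (y : R) : Im (z / (y `^ k)%:C) = Im z * y `^ (- k).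
  by rewrite -realcV ImM /= mulr0 add0r powRN.
have e3 (y : R) (z : R[i]) : Re (y%:C * z) = y * Re z by rewrite ReM /= mul0r subr0.
have e4 (y : R) (z : R[i]) : Im (y%:C * z) = y * Im z by rewrite ImM /= mul0r addr0.
congr (_ +i* _).
  transitivity (\int[mu]_(x in `]0, +oo[) (expR (- (w * x)) * Lint k (2 * w * x) * Re (phi x))); last by apply: eq_Rintegral => x _; rewrite e3.
  rewrite -(Rlaplace_mean k w0 a0 m1 (fun x => le_trans (normr_Re_le _) (h x))).
  apply: eq_Rintegral => t _; rewrite e1 /laplace /cintegral /=; congr (_ * _).
  by apply: eq_Rintegral => x _; rewrite e3.
transitivity (\int[mu]_(x in `]0, +oo[) (expR (- (w * x)) * Lint k (2 * w * x) * Im (phi x))); last by apply: eq_Rintegral => x _; rewrite e4.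
rewrite -(Rlaplace_mean k w0 a0 m2 (fun x => le_trans (normr_Im_le _) (h x))).
apply: eq_Rintegral => t _; rewrite e2 /laplace /cintegral /=; congr (_ * _).
by apply: eq_Rintegral => x _; rewrite e4.
Qed.

(** The common interchange of sum and integral for both kinds of Fourier terms: on the support of
    [phi] the weights are bounded by [W l], and the sum of [|c l| W l] is finite. *)
Lemma cintegral_weighted a b B phi (c : nat -> R[i]) (w : nat -> R -> R) (W : nat -> R) M s :
  test_bound a b B phi -> (forall l, measurable_fun (`]0, +oo[ : set R) (w l)) ->
  (forall l x, a <= x <= b -> `|w l x| <= W l) -> sum_le (fun l => cabs (c l) * W l) M ->
  (forall x, 0 < x -> has_sum (fun l => c l * (w l x)%:C) (s x)) ->
  [/\ forall l, cint `]0, +oo[ (fun x => (w l x)%:C * phi x),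
      cint `]0, +oo[ (fun x => s x * phi x) &
  cseries (fun l => c l * cintegral `]0, +oo[ (fun x => (w l x)%:C * phi x)) =
    cintegral `]0, +oo[ (fun x => s x * phi x)].
Proof.
move=> h mw hw hM hs; have [a0 mp hp] := h.
have mp' : cmeas `]0, +oo[ phi by split; apply: measurable_funTS; [exact: mp.1|exact: mp.2].
have [||||i1 i2 i3] := @cintegral_dominated `]0, +oo[ (fun l x => c l * ((w l x)%:C * phi x)) (fun x => s x * phi x)
  (fun x => M * `|B| * \1_`[a, b] x) mpos.
- move=> l; apply: cmeasM; first exact: cmeas_cst.
  by apply: cmeasM => //; exact: cmeas_real.
- exact: rint_indic.
- move=> x; rewrite /= in_itv /= andbT => x0.
  have := has_sumZ (phi x) (hs x x0); rewrite mulrC; apply: has_sum_ext => l; ring.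
- move=> x _; rewrite indic_itvE; have [ab|/negP ab] := boolP (a <= x <= b); last first.
    move=> t _; rewrite mulr0 big1// => l _.
    by rewrite (test_bound_out h ab) !mulr0 Normc.normc0.
  rewrite mulr1; apply: abs_le_leq (sum_leZr (normr_ge0 B) hM) => l.
  rewrite !Normc.normcM cabs_real -mulrA ler_wpM2l ?cabs_ge0//.
  by rewrite ler_pM ?cabs_ge0// ?hw// (test_bound_in x h).
have iw l : cint `]0, +oo[ (fun x => (w l x)%:C * phi x); last first.
  split => //; apply: cseries_cvgE; move: i3; congr (cseries_cvg _ _); apply/funext => l.
  by rewrite cintegralZ.
apply: (cint_dom (g := fun x => `|W l| * `|B| * \1_`[a, b] x)) => //.
- by apply: cmeasM => //; exact: cmeas_real.
- move=> x _; rewrite indic_itvE; have [ab|/negP ab] := boolP (a <= x <= b); last first.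
    by rewrite (test_bound_out h ab) !mulr0 Normc.normc0.
  rewrite mulr1 Normc.normcM cabs_real ler_pM ?cabs_ge0 ?(test_bound_in x h)//.
  by apply: le_trans (hw l x ab) (ler_norm _).
- exact: rint_indic.
Qed.

End TestFunctions.

Section LseriesIntegral.
Variables (R : realType) (k : R).
Notation mu := (@lebesgue_measure R).
Implicit Types (c d : nat -> R[i]) (phi : R -> R[i]).

Let mpos : measurable (`]0, +oo[ : set R). Proof. exact: measurable_itv. Qed.

Lemma eterm_iy beta c y l : eterm beta c (0 +i* y) l =
  c l * (expR (- (2 * pi * (l%:R + beta) * y)))%:C :> R[i].
Proof.
rewrite /eterm -cexp_real; congr (_ * cexp _).
by apply: complex_ext; rewrite !(ReM, ImM) /=; ring.
Qed.

Lemma nterm_iy beta c y l : nterm k beta c (0 +i* y) l =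
  c l * (incomplete_gamma (1 - k) (4 * pi * (l%:R + beta) * y)
    * expR (2 * pi * (l%:R + beta) * y))%:C.
Proof.
rewrite /nterm /= realcM mulrA -cexp_real; congr (_ * cexp _).
by apply: complex_ext; rewrite !(ReM, ImM) /=; ring.
Qed.

Lemma eseries_integral beta c phi : subexp c -> nice phi ->
  cint `]0, +oo[ (fun x => eseries beta c (0 +i* x) * phi x) /\
  cseries (fun l => c l * laplace phi (2 * pi * (l%:R + beta))) =
    cintegral `]0, +oo[ (fun x => eseries beta c (0 +i* x) * phi x).
Proof.
move=> hc [a [b [B h]]]; have [a0 _ _] := h; have pi0 := pi_gt0 R.
pose W (l : nat) : R := expR (2 * pi * `|beta| * b) * expR (- (2 * pi * a * l%:R)).
have [|l|l|M hM] := @subexp_sum _ c (2 * pi * a) (expR (2 * pi * `|beta| * b)) W hc.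
- by rewrite !mulr_gt0.
- by rewrite mulr_ge0 ?expR_ge0.
- by [].
have [|||_] := @cintegral_weighted _ a b B phi c (fun l x => expR (- (2 * pi * (l%:R + beta) * x))) W M (fun x => eseries beta c (0 +i* x)) h _ _ hM; last by move=> i1 i2; split.
- move=> l; apply: measurable_funTS; apply: measurableT_comp => //.
  by apply: measurableT_comp => //; exact: measurable_funM.
- move=> l x /andP[ax xb]; rewrite (ger0_norm (expR_ge0 _)) /W -expRD ler_expR.
  have x0 : 0 <= x by exact: le_trans (ltW a0) ax.
  have h1 : 2 * pi * a * l%:R <= 2 * pi * l%:R * x.
    by rewrite mulrAC ler_wpM2l// !mulr_ge0// ltW.
  have h2 : - beta * (2 * pi * x) <= `|beta| * (2 * pi * b).
    apply: (@le_trans _ _ (`|beta| * (2 * pi * x))).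
      by rewrite ler_wpM2r ?mulr_ge0 ?(ltW pi0)// -normrN ler_norm.
    by rewrite ler_wpM2l// ler_wpM2l// mulr_ge0// ltW.
  have -> : - (2 * pi * (l%:R + beta) * x) = - beta * (2 * pi * x) - 2 * pi * l%:R * x by ring.
  have -> : 2 * pi * `|beta| * b = `|beta| * (2 * pi * b) by ring.
  by rewrite lerB.
- move=> x x0; have [? [? [? [_ _ _ _]]]] := @eseries_dps _ beta c (0 +i* x) hc x0.
  by apply: has_sum_ext => l; rewrite eterm_iy.
Qed.

(** The twist by [2 - k] contributes the factor [x^(1-k)]. With [rho = 2 pi (l + beta)], this
    factor, [(2 rho)^(1-k)] and the outcome of [laplace_mean] rebuild
    [Gamma(1-k, 2 rho x) e^(rho x)], the term of [f(ix)]. *)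
Lemma nseries_integral beta c phi : 0 < beta -> subexp c -> nice phi ->
  cint `]0, +oo[ (fun x => nseries k beta c (0 +i* x) * phi x) /\
  cseries (fun l => c l * ((4 * pi * (l%:R + beta)) `^ (1 - k))%:C *
     cintegral `[0, +oo[ (fun t => laplace (twist (2 - k) phi)
       (2 * pi * (l%:R + beta) * (2 * t + 1)) / ((1 + t) `^ k)%:C)) =
    cintegral `]0, +oo[ (fun x => nseries k beta c (0 +i* x) * phi x).
Proof.
move=> b0 hc hphi; have [a [b [B h]]] := hphi; have [a0 mp hp] := h; have pi0 := pi_gt0 R.
pose rho (l : nat) : R := 2 * pi * (l%:R + beta).
have r0 l : 0 < rho l by rewrite !mulr_gt0// ltr_wpDl.
have r2 l : 4 * pi * (l%:R + beta) = 2 * rho l by rewrite /rho; ring.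
pose w l x := incomplete_gamma (1 - k) (2 * rho l * x) * expR (rho l * x).
have wE l x : 0 < x -> w l x = (2 * rho l) `^ (1 - k) *
    (x `^ (1 - k) * (expR (- (rho l * x)) * Lint k (2 * rho l * x))).
  move=> x0; rewrite /w (incomplete_gammaE k (mulr_gt0 (mulr_gt0 _ (r0 l)) x0)).2//.
  have r20 : 0 < 2 * rho l by rewrite mulr_gt0.
  rewrite [(2 * rho l * x) `^ _]powRM ?ltW//.
  have -> : expR (- (2 * rho l * x)) = expR (- (rho l * x)) * (expR (rho l * x))^-1.
    by rewrite -expRN -expRD; congr expR; ring.
  by field; rewrite gt_eqF ?expR_gt0.
pose L0 := Lint k (2 * (2 * pi * beta) * a).
have L0_ge0 : 0 <= L0 by exact: Lint_ge0.
pose K := (a `^ (1 - k) + b `^ (1 - k)) * L0.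
pose V (l : nat) : R := K * expR (- (2 * pi * a * l%:R)).
have K0 : 0 <= K by rewrite mulr_ge0// addr_ge0 ?powR_ge0.
have sc : subexp (fun l => c l * ((4 * pi * (l%:R + beta)) `^ (1 - k))%:C).
  by apply: subexpM hc _; apply: subexp_powR => //; rewrite mulr_gt0.
have [|l|l|M hM] := @subexp_sum _ _ (2 * pi * a) K V sc.
- by rewrite !mulr_gt0.
- by rewrite mulr_ge0 ?expR_ge0.
- by [].
have wW l x : a <= x <= b -> `|w l x| <= (4 * pi * (l%:R + beta)) `^ (1 - k) * V l.
  move=> /andP[ax xb]; have x0 : 0 < x by exact: lt_le_trans ax.
  rewrite wE// !normrM !(ger0_norm (powR_ge0 _ _)) (ger0_norm (expR_ge0 _)) (ger0_norm (Lint_ge0 _ _)).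
  rewrite r2 ler_wpM2l ?powR_ge0//.
  have -> : V l = (a `^ (1 - k) + b `^ (1 - k)) * (expR (- (2 * pi * a * l%:R)) * L0) by rewrite /V /K; ring.
  rewrite ler_pM ?powR_ge0 ?mulr_ge0 ?expR_ge0 ?Lint_ge0//.
    by apply: powR_bound => //; rewrite ax.
  rewrite ler_pM ?expR_ge0 ?Lint_ge0//.
    rewrite ler_expR lerN2 /rho.
    have h1 : 2 * pi * a * l%:R <= 2 * pi * x * l%:R.
      by rewrite ler_wpM2r// ler_wpM2l// mulr_ge0// ltW.
    apply: le_trans h1 _; rewrite [leRHS](_ : _ = 2 * pi * x * l%:R + 2 * pi * x * beta); last by ring.
    by rewrite lerDl !mulr_ge0// ltW.
  apply: Lint_le; first by rewrite !mulr_gt0.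
  rewrite ler_pM ?mulr_ge0 ?(ltW a0) ?(ltW b0) ?(ltW pi0)//.
  by rewrite /rho ler_wpM2l// ler_wpM2l ?mulr_ge0 ?(ltW pi0)// lerDr.
have hs x : 0 < x -> has_sum (fun l => c l * (w l x)%:C) (nseries k beta c (0 +i* x)).
  move=> x0; have [? [? [? [_ _ _ _]]]] := @nseries_dps _ k beta c (0 +i* x) b0 hc x0.
  by apply: has_sum_ext => l; rewrite nterm_iy r2.
have cc (x : R) : 0 < x -> {for x, continuous (incomplete_gamma (1 - k))}.
  move=> x0; apply: differentiable_continuous; apply/derivable1_diffP.
  by have [] := is_derive_incomplete_gamma k x0.
have [||||iw i1 i2] := @cintegral_weighted _ a b B phi c w
    (fun l => (4 * pi * (l%:R + beta)) `^ (1 - k) * V l) M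
    (fun x => nseries k beta c (0 +i* x)) h.
- move=> l; apply: open_continuous_measurable_fun; first exact: interval_open.
  move=> x /set_mem; rewrite /= in_itv /= andbT => x0.
  apply: (@continuousM _ _ (fun x => incomplete_gamma (1 - k) (2 * rho l * x))
    (fun x => expR (rho l * x))).
    apply: (@continuous_comp _ _ _ (fun x => 2 * rho l * x) (incomplete_gamma (1 - k))).
      exact: mulrl_continuous.
    by apply: cc; apply: mulr_gt0 x0; apply: mulr_gt0 (r0 l).
  apply: (@continuous_comp _ _ _ (fun x => rho l * x) expR).
    exact: mulrl_continuous.
  exact: continuous_expR.
- exact: wW.
- move: hM; congr (sum_le _ _); apply/funext => l.
  by rewrite Normc.normcM cabs_real (ger0_norm (powR_ge0 _ _)) -mulrA.
- exact: hs.
split; first exact: i1.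
rewrite -i2; congr cseries; apply/funext => l.
rewrite -mulrA; congr (_ * _).
rewrite (laplace_mean k (r0 l) (nice_twist (2 - k) hphi)).
have E x : x \in `]0, +oo[ -> ((4 * pi * (l%:R + beta)) `^ (1 - k))%:C *
    ((expR (- (rho l * x)) * Lint k (2 * rho l * x))%:C * twist (2 - k) phi x) =
    (w l x)%:C * phi x.
  rewrite in_itv /= andbT => x0; rewrite wE// r2 /twist.
  by rewrite (_ : 2 - k - 1 = 1 - k) ?realcM; ring.
rewrite -cintegralZ; first exact: eq_cintegral.
  exact: mpos.
have p0 : ((4 * pi * (l%:R + beta)) `^ (1 - k))%:C != 0 :> R[i].
  by rewrite realc_eq0 gt_eqF// powR_gt0// r2 mulr_gt0.
apply: (cint_ext mpos _ (cintZ (((4 * pi * (l%:R + beta)) `^ (1 - k))%:C^-1) mpos (iw l))).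
by move=> x /E <-; rewrite mulKf.
Qed.

Variables (m : nat) (kappa : 'I_m -> R) (n0 : int) (cp cm : 'I_m -> int -> R[i]).
Hypothesis kappa1 : forall j, kappa j < 1.
Hypothesis subp : forall j, subexp (fun l => cp j (pos_index n0 l)).
Hypothesis subm : forall j, subexp (fun l => cm j (neg_index l)).

(** The shifts of the two enumerations: [n + kappa_j] is [l + hpos j] along [pos_index] and
    [-(l + hneg j)] along [neg_index]. *)
Definition hpos j := kappa j - n0%:~R.
Definition hneg j := 1 - kappa j.
Definition cpos j l := cp j (pos_index n0 l).
Definition cneg j l := cm j (neg_index l).

Lemma hneg_gt0 j : 0 < hneg j. Proof. by rewrite subr_gt0. Qed.

Lemma freq_pos j l : freq kappa j (pos_index n0 l) = l%:R + hpos j.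
Proof. by rewrite /freq /pos_index /hpos intrB; ring. Qed.

Lemma freq_neg j l : freq kappa j (neg_index l) = - (l%:R + hneg j).
Proof. by rewrite /freq /neg_index /hneg rmorphN /= -[l.+1]addn1 PoszD intrD; ring. Qed.

Definition hfun j (x : R) := eseries (hpos j) (cpos j) (0 +i* x) +
  nseries k (hneg j) (cneg j) (0 +i* x).

(** At [ix] this is the derivative of the [j]-th component in [u], divided by [2 pi i]. *)
Definition dhfun j (x : R) :=
  eseries (hpos j) (fun l => cpos j l * (l%:R + hpos j)%:C) (0 +i* x) +
  nseries k (hneg j) (fun l => cneg j l * (- (l%:R + hneg j))%:C) (0 +i* x).

Let neg_term s phi j l :
  ((- 4 * pi * freq kappa j (neg_index l)) `^ (1 - k))%:C
      * laplace_int k kappa j (neg_index l) s phi =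
  ((4 * pi * (l%:R + hneg j)) `^ (1 - k))%:C *
     cintegral `[0, +oo[ (fun t => laplace (twist s phi)
       (2 * pi * (l%:R + hneg j) * (2 * t + 1)) / ((1 + t) `^ k)%:C) :> R[i].
Proof.
rewrite /laplace_int freq_neg.
have -> : - 4 * pi * - (l%:R + hneg j) = 4 * pi * (l%:R + hneg j) by ring.
by have -> : - 2 * pi * - (l%:R + hneg j) = 2 * pi * (l%:R + hneg j) by ring.
Qed.

Let congr_cseries2 (u v u' v' : nat -> R[i]) : u =1 u' -> v =1 v' ->
  cseries u + cseries v = cseries u' + cseries v'.
Proof. by move=> /funext -> /funext ->. Qed.

Lemma LseriesE phi j : nice phi ->
  cint `]0, +oo[ (fun x => hfun j x * phi x) /\
  Lseries k kappa n0 cp cm phi j 0 = cintegral `]0, +oo[ (fun x => hfun j x * phi x).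
Proof.
move=> hphi.
have [i1 e1] := eseries_integral (hpos j) (subp j) hphi.
have [i2 e2] := nseries_integral (hneg_gt0 j) (subm j) hphi.
have E x : x \in `]0, +oo[ -> hfun j x * phi x = eseries (hpos j) (cpos j) (0 +i* x) * phi x +
   nseries k (hneg j) (cneg j) (0 +i* x) * phi x by move=> _; exact: mulrDl.
split; first by apply: (cint_ext mpos E); exact: cintD.
rewrite (eq_cintegral E) (cintegralD mpos i1 i2) -e1 -e2 mxE.
apply: congr_cseries2 => l; cbv zeta; first by rewrite freq_pos.
by rewrite -mulrA neg_term mulrA.
Qed.

Let combE (u v w : 'cV[R[i]]_m) (a b : R[i]) j :
  (a *: u - b *: v - b *: w) j 0 = a * u j 0 - b * v j 0 - b * w j 0.
Proof. by rewrite !mxE. Qed.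

(** Serves to see [phi_(3-k)] as the twist of [phi_2] by [2 - k]. Multiplying powers requires a
    positive base; elsewhere [phi] vanishes. *)
Lemma twist_twist phi s t : nice phi -> twist (s + t - 1) phi = twist s (twist t phi).
Proof.
move=> [a [b [B h]]]; have [a0 _ _] := h; apply/funext => x; rewrite /twist.
have [x0|x0] := ltP 0 x; last first.
  by rewrite (test_bound_out h) ?mul0r// => /andP[ax _]; have := lt_le_trans a0 (le_trans ax x0); rewrite ltxx.
rewrite -mulrA -realcM -powRD; last by rewrite (gt_eqF x0) implybT.
by congr (_ * (_ `^ _)%:C); ring.
Qed.

(** The power [x] carried by [twist 2] is, up to [i], the factor [tau] of [delta_k] at [tau = ix];
    together with the factor [2 pi i] left out of [dhfun] it accounts for the constant [- 2 pi]. *)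
Lemma Lseries_deltaE phi j : nice phi ->
  cint `]0, +oo[ (fun x => dhfun j x * twist 2 phi x) /\
  Lseries_delta k kappa n0 cp cm phi j 0 =
    (k / 2)%:C * cintegral `]0, +oo[ (fun x => hfun j x * phi x) -
    (2 * pi)%:C * cintegral `]0, +oo[ (fun x => dhfun j x * twist 2 phi x).
Proof.
move=> hphi; have hphi2 := nice_twist 2 hphi.
have subp' : subexp (fun l => cpos j l * (l%:R + hpos j)%:C).
  by apply: subexpM (subp j) _; exact: subexp_linear.
have subm' : subexp (fun l => cneg j l * (- (l%:R + hneg j))%:C).
  apply: subexpM (subm j) _.
  by move=> e /(subexp_linear (hneg j)) [A hA]; exists A => l; rewrite realcN cabsN.
have [i1 e1] := eseries_integral (hpos j) subp' hphi2.
have [i2 e2] := nseries_integral (hneg_gt0 j) subm' hphi2.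
have E x : x \in `]0, +oo[ -> dhfun j x * twist 2 phi x =
   eseries (hpos j) (fun l => cpos j l * (l%:R + hpos j)%:C) (0 +i* x) * twist 2 phi x +
   nseries k (hneg j) (fun l => cneg j l * (- (l%:R + hneg j))%:C) (0 +i* x) * twist 2 phi x.
  by move=> _; exact: mulrDl.
split; first by apply: (cint_ext mpos E); exact: cintD.
have [_ eL] := LseriesE j hphi.
rewrite (eq_cintegral E) (cintegralD mpos i1 i2) -e1 -e2.
rewrite -eL /Lseries_delta combE -addrA; congr (_ + _).
rewrite -opprD -mulrDr; congr (- (_ * _)).
apply: etrans (f_equal2 +%R (mxE _ _ _ _) (mxE _ _ _ _)) _.
apply: congr_cseries2 => l; cbv zeta; first by rewrite freq_pos.
have k3 : 2 - k + 2 - 1 = 3 - k by ring.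
by rewrite -mulrA neg_term mulrA freq_neg -(twist_twist _ _ hphi) k3.
Qed.

End LseriesIntegral.

(** * Landau kernels and moments *)

Section Moments.
Variable R : realType.
Notation mu := (@lebesgue_measure R).
Implicit Types (F K : R -> R) (D J : set R).

Let mpos : measurable (`]0, +oo[ : set R). Proof. exact: measurable_itv. Qed.

(** The integral is split along [J]: there [F] is within [e] of [c] and the kernel is nonnegative;
    elsewhere the kernel is at most [q] and [F] has total mass at most [L]. *)
Lemma kernel_bound F K J (a b B c e q L : R) : measurable J -> J `<=` `]0, +oo[ ->
  rint `]0, +oo[ (fun x => F x * K x) -> rint J K -> 0 <= q ->
  (forall x, `|F x| <= B * \1_`[a, b] x) ->
  (forall x, J x -> 0 <= K x /\ `|F x - c| <= e) ->
  (forall x, a <= x <= b -> ~ J x -> `|K x| <= q) ->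
  L = \int[mu]_(x in `]0, +oo[) (B * \1_`[a, b] x) ->
  `|\int[mu]_(x in `]0, +oo[) (F x * K x) - c * \int[mu]_(x in J) K x| <=
    e * \int[mu]_(x in J) K x + q * L.
Proof.
move=> mJ sJ iFK iK q0 hF hJ hK ->.
pose KJ := K \_ J.
have iKJ : rint `]0, +oo[ KJ.
  have /(rint_setT _ mJ) : rint J K by [].
  by apply: integrableS.
have KJE : \int[mu]_(x in J) K x = \int[mu]_(x in `]0, +oo[) KJ x.
  rewrite [LHS]Rintegral_mkcond [RHS]Rintegral_mkcond; apply: eq_Rintegral => x _.
  rewrite /KJ !patchE; case: ifP => xJ; last by case: ifP.
  by rewrite mem_set//; apply/sJ/set_mem.
have iB : rint `]0, +oo[ (fun x => B * \1_`[a, b] x) by exact: rint_indic.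
rewrite KJE -!RintegralZl//.
have i1 := rintZ c mpos iKJ; have i2 := rintZ e mpos iKJ; have i3 := rintZ q mpos iB.
have i4 : rint `]0, +oo[ (fun x => F x * K x - c * KJ x).
  have := rintD mpos iFK (rintZ (-1) mpos i1).
  by congr (rint _ _); apply/funext => x; rewrite mulN1r.
rewrite -RintegralB// -RintegralD//.
apply: (le_trans (@le_normr_Rintegral _ _ _ mu _ _ mpos i4)); apply: le_Rintegral => //.
- exact: integrable_norm.
- exact: rintD.
move=> x _; rewrite /KJ patchE; case: ifP => xJ.
  have [K0 Fc] := hJ x (set_mem xJ).
  rewrite -mulrBl normrM (ger0_norm K0) ler_wpDr ?ler_wpM2r//.
  by rewrite mulr_ge0//; exact: le_trans (hF x).
rewrite !mulr0 subr0 add0r normrM mulrC; have := hF x; rewrite !indic_itvE.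
have [ab|_] := boolP (a <= x <= b).
  rewrite !mulr1 => h; rewrite ler_pM// hK// => /mem_set; by rewrite xJ.
by rewrite !mulr0 normr_le0 => /eqP ->; rewrite normr0 mulr0.
Qed.

Lemma rint_supported F K (a b B C : R) : measurable_fun setT F ->
  (forall x, `|F x| <= B * \1_`[a, b] x) -> measurable_fun (`]0, +oo[ : set R) K ->
  (forall x, a <= x <= b -> `|K x| <= C) -> rint `]0, +oo[ (fun x => F x * K x).
Proof.
move=> mF hF mK hK; apply: (rint_dom (g := fun x => B * C * \1_`[a, b] x)) => //.
- by apply: measurable_funM => //; exact: measurable_funTS.
- move=> x _; have := hF x; rewrite !indic_itvE normrM; have [ab|_] := boolP (a <= x <= b).
    by rewrite !mulr1 => h; rewrite ler_pM// hK.
  by rewrite !mulr0 normr_le0 => /eqP ->; rewrite normr0 mul0r.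
- exact: rint_indic.
Qed.

Lemma Rintegral_indic_itv J (c d : R) : measurable J -> c < d ->
  [set` `[c, d]] `<=` J -> \int[mu]_(x in J) \1_[set` `[c, d]] x = d - c.
Proof.
move=> mJ cd sJ; rewrite /Rintegral integral_indic//.
rewrite (setIidl sJ).
have := @lebesgue_measure_itv R `[c, d].
rewrite /= lte_fin cd => E.
transitivity (fine (d%:E - c%:E)%E); last by [].
by congr fine.
Qed.

Let inv_bound (a b x : R) : 0 < a -> b^-1 <= x <= a^-1 -> [/\ 0 < b -> 0 < x, 0 < b -> a <= x^-1 & 0 < b -> x^-1 <= b].
Proof.
move=> a0 /andP[h1 h2].
have x0 : 0 < b -> 0 < x by move=> b0; apply: lt_le_trans h1; rewrite invr_gt0.
split => // b0; have {}x0 := x0 b0; first by rewrite invf_pge ?posrE.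
by rewrite invf_ple ?posrE.
Qed.

Lemma moments_poly F1 F2 (a b B : R) : 0 < a -> 0 < b ->
  measurable_fun setT F1 -> measurable_fun setT F2 ->
  (forall x, `|F1 x| <= B * \1_`[a, b] x) ->
  (forall x, `|F2 x| <= B * \1_`[b^-1, a^-1] x) ->
  (forall n : nat, \int[mu]_(x in `]0, +oo[) (F1 x * x ^+ n) =
     \int[mu]_(x in `]0, +oo[) (F2 x * x^-1 ^+ n)) ->
  forall p : {poly R}, [/\ rint `]0, +oo[ (fun x => F1 x * p.[x]),
    rint `]0, +oo[ (fun x => F2 x * p.[x^-1]) &
    \int[mu]_(x in `]0, +oo[) (F1 x * p.[x]) =
     \int[mu]_(x in `]0, +oo[) (F2 x * p.[x^-1])].
Proof.
move=> a0 b0 m1 m2 h1 h2 hn p.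
have pc (q : {poly R}) : continuous (fun x => q.[x]) by exact: continuous_horner.
have pb (q : {poly R}) : exists C, forall x, a <= x <= b -> `|q.[x]| <= C.
  have [ab|ba] := leP a b; last first.
    by exists 0 => x /andP[g1 g2]; have := lt_le_trans ba (le_trans g1 g2); rewrite ltxx.
  have [c _ hc] := @EVT_max R (fun x => `|q.[x]|) a b ab (continuous_subspaceT (fun x => continuous_comp (pc q x) (@norm_continuous _ _ _))).
  by exists (`|q.[c]|) => x hx; apply: hc; rewrite in_itv.
have r1 (q : {poly R}) : rint `]0, +oo[ (fun x => F1 x * q.[x]).
  have [C hC] := pb q; apply: (rint_supported m1 h1 _ hC).
  by apply: measurable_funTS; exact: continuous_measurable_fun.
have r2 (q : {poly R}) : rint `]0, +oo[ (fun x => F2 x * q.[x^-1]).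
  have [C hC] := pb q; apply: (rint_supported m2 h2 (C := C)).
    apply: open_continuous_measurable_fun; first exact: interval_open.
    move=> x /set_mem; rewrite /= in_itv /= andbT => x0.
    apply: (@continuous_comp _ _ _ (fun x : R => x^-1) (fun x => q.[x])); last exact: pc.
    by apply: inv_continuous; rewrite gt_eqF.
  move=> x /(inv_bound a0) [g1 g2 g3]; apply: hC.
  by rewrite g2// g3.
split => //.
(* Strengthened by a factor [X^n] to fit Horner induction: [(p X + c) X^n = p X^(n+1) + c X^n]. *)
suff : forall n : nat, \int[mu]_(x in `]0, +oo[) (F1 x * (p * 'X^n).[x]) =
     \int[mu]_(x in `]0, +oo[) (F2 x * (p * 'X^n).[x^-1]).
  by move=> /(_ 0%N); rewrite expr0 mulr1.
elim/poly_ind: p => [n|p c IH n].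
  under eq_Rintegral => x _ do rewrite mul0r horner0 mulr0.
  by under [RHS]eq_Rintegral => x _ do rewrite mul0r horner0 mulr0.
have E x : ((p * 'X + c%:P) * 'X^n).[x] = (p * 'X^(n.+1)).[x] + c * x ^+ n.
  by rewrite !hornerE exprS; ring.
have q1 : rint `]0, +oo[ (fun x => c * (F1 x * x ^+ n)).
  apply: rintZ => //; have := r1 'X^n; congr (rint _ _).
  by apply/funext => x; rewrite hornerXn.
have q2 : rint `]0, +oo[ (fun x => c * (F2 x * x^-1 ^+ n)).
  apply: rintZ => //; have := r2 'X^n; congr (rint _ _).
  by apply/funext => x; rewrite hornerXn.
have q3 : rint `]0, +oo[ (fun x => F1 x * x ^+ n).
  by have := r1 'X^n; congr (rint _ _); apply/funext => x; rewrite hornerXn.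
have q4 : rint `]0, +oo[ (fun x => F2 x * x^-1 ^+ n).
  by have := r2 'X^n; congr (rint _ _); apply/funext => x; rewrite hornerXn.
transitivity (\int[mu]_(x in `]0, +oo[) (F1 x * (p * 'X^(n.+1)).[x] + c * (F1 x * x ^+ n))).
  by apply: eq_Rintegral => x _; rewrite E; ring.
rewrite RintegralD; [|exact: mpos|exact: r1|exact: q1].
rewrite RintegralZl; [|exact: mpos|exact: q3]; rewrite IH hn.
rewrite -RintegralZl; [|exact: mpos|exact: q4].
rewrite -RintegralD; [|exact: mpos|exact: r2|exact: q2].
by apply: eq_Rintegral => x _; rewrite E; ring.
Qed.

(** Landau's method. For the kernels [P^n] centred at [x0], both sides of the polynomial moment
    identity concentrate: the left one on [F1 x0], the right one, after [y = 1/x], on [G x0].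
    Division by the common mass [D n] leaves [|F1 x0 - G x0| <= 2e + C (q0/q1)^n]. *)
Lemma moment_point F1 F2 (a b B x0 : R) : 0 < a -> 0 < b ->
  measurable_fun setT F1 -> measurable_fun setT F2 ->
  (forall x, `|F1 x| <= B * \1_`[a, b] x) ->
  (forall x, `|F2 x| <= B * \1_`[b^-1, a^-1] x) ->
  (forall n : nat, \int[mu]_(x in `]0, +oo[) (F1 x * x ^+ n) =
     \int[mu]_(x in `]0, +oo[) (F2 x * x^-1 ^+ n)) ->
  0 < x0 -> {for x0, continuous F1} -> {for x0, continuous (fun x : R => F2 x^-1)} ->
  F1 x0 = F2 x0^-1 * x0^-1 ^+ 2.
Proof.
move=> a0 b0 m1 m2 h1 h2 hn x00 c1 c2.
apply/eqP; rewrite -subr_eq0 -normr_le0; apply/ler_addgt0Pl => e3 e30.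
(* Two thirds go to the two localisations at [x0], one third to the geometric tail. *)
rewrite addr0; pose e := e3 / 3; have e0 : 0 < e by rewrite divr_gt0.
(* The factor [x^-2] is the Jacobian of [y = 1/x]. *)
pose G x := F2 x^-1 * x^-1 ^+ 2.
have c3 : {for x0, continuous G}.
  apply: (@continuousM _ _ (fun x : R => F2 x^-1) (fun x : R => x^-1 ^+ 2)) => //.
  apply: (@continuous_comp _ _ _ (fun x : R => x^-1) (fun x => x ^+ 2)).
    by apply: inv_continuous; rewrite gt_eqF.
  exact: exprn_continuous.
have [d [d0 dx0 hd1 hd2]] : exists d, [/\ 0 < d, d < x0,
    forall x, `|x - x0| <= d -> `|F1 x - F1 x0| <= e &
    forall x, `|x - x0| <= d -> `|G x - G x0| <= e].
  have ball (f : R -> R) : {for x0, continuous f} -> exists2 d, 0 < d &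
      forall x, `|x - x0| < d -> `|f x - f x0| <= e.
    move=> /cvgrPdist_le/(_ e e0)/nbhs_ballP[d d0 hd]; exists d => // x xd.
    by rewrite distrC; apply: hd; rewrite /ball /= distrC.
  have [[da da0 ha] [db db0 hb]] := (ball _ c1, ball _ c3).
  exists (Num.min (Num.min da db) x0 / 2).
  have m0 : 0 < Num.min (Num.min da db) x0 by rewrite !lt_min da0 db0.
  have m2' : Num.min (Num.min da db) x0 / 2 < Num.min (Num.min da db) x0.
    by rewrite ltr_pdivrMr// ltr_pMr// ltr1n.
  split; first by rewrite divr_gt0.
  - by apply: lt_le_trans m2' _; rewrite ge_min lexx orbT.
  - move=> x h; apply: ha; apply: le_lt_trans h _; apply: lt_le_trans m2' _.
    by rewrite !ge_min lexx.
  - move=> x h; apply: hb; apply: le_lt_trans h _; apply: lt_le_trans m2' _.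
    by rewrite !ge_min lexx orbT.
(* All of [[a, b]] lies within distance [r] of [x0], so that [0 <= P <= 1] there. *)
pose r := b + x0; have r0 : 0 < r by rewrite addr_gt0.
pose P x := 1 - ((x - x0) / r) ^+ 2.
pose p : {poly R} := 1 - (r^-1 *: ('X - x0%:P)) ^+ 2.
have pE x : p.[x] = P x by rewrite /p !hornerE /P; congr (1 - _ ^+ 2); rewrite mulrC.
(* [q0] bounds [P] from above at distance at least [d] from [x0], and [q1] bounds it from below
   within [d / 2]. The strict inequality [q0 < q1] makes the outer part negligible against the
   mass. *)
pose q0 := 1 - (d / r) ^+ 2; pose q1 := 1 - (d / 2 / r) ^+ 2.
have dr : d < r by rewrite (lt_trans dx0)// /r ltrDr.
have Pge x t : 0 <= t -> `|x - x0| <= t -> 1 - (t / r) ^+ 2 <= P x.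
  move=> t0 xt; rewrite /P lerD2l lerN2 -(real_normK (num_real (_ / r))) lerXn2r ?nnegrE ?divr_ge0 ?(ltW r0)//.
  by rewrite normrM normfV (gtr0_norm r0) ler_wpM2r// invr_ge0 ltW.
have Ple x t : 0 <= t -> t <= `|x - x0| -> P x <= 1 - (t / r) ^+ 2.
  move=> t0 xt; rewrite /P lerD2l lerN2 -[leRHS](real_normK (num_real _)) lerXn2r ?nnegrE ?divr_ge0 ?(ltW r0)//.
  by rewrite normrM normfV (gtr0_norm r0) ler_wpM2r// invr_ge0 ltW.
have P0 x : `|x - x0| <= r -> 0 <= P x.
  by move=> /(Pge _ _ (ltW r0)); rewrite divff ?gt_eqF// expr1n subrr.
pose J1 : set R := [set` `[x0 - d, x0 + d] ].
pose J2 : set R := [set` `[(x0 + d)^-1, (x0 - d)^-1] ].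
have J1E x : J1 x <-> `|x - x0| <= d.
  by rewrite /J1 /= in_itv /= ler_distl.
have xd0 : 0 < x0 - d by rewrite subr_gt0.
have xd1 : 0 < x0 + d by rewrite addr_gt0.
have J1pos : J1 `<=` `]0, +oo[.
  by move=> x; rewrite /J1 /= !in_itv /= andbT => /andP[h _]; exact: lt_le_trans h.
have J2E x : J2 x <-> 0 < x /\ J1 x^-1.
  rewrite /J2 /J1 /= !in_itv /=; split.
    move=> /andP[g1 g2]; have x_0 : 0 < x by apply: lt_le_trans g1; rewrite invr_gt0.
    by split => //; rewrite invf_pge ?posrE// g2 invf_ple ?posrE.
  move=> [x_0 /andP[g1 g2]]; rewrite invf_ple ?posrE// g2 /=.
  by rewrite invf_pge ?posrE.
have J2pos : J2 `<=` `]0, +oo[ by move=> x /J2E [x_0 _]; rewrite /= in_itv /= x_0.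
have q00 : 0 <= q0.
  rewrite /q0 subr_ge0 expr_le1// ?divr_ge0 ?(ltW d0) ?(ltW r0)//.
  by rewrite ler_pdivrMr// mul1r ltW.
have q01 : q0 < q1.
  rewrite /q0 /q1 ltrD2l ltrN2 ltrXn2r ?nnegrE ?divr_ge0 ?(ltW d0) ?(ltW r0)//.
  by rewrite ltr_pM2r ?invr_gt0// ltr_pdivrMr// ltr_pMr// ltr1n.
have q10 : 0 < q1 by exact: le_lt_trans q01.
have xr x : a <= x <= b -> `|x - x0| <= r.
  move=> /andP[ax xb]; rewrite /r ler_distl; apply/andP; split; last by lra.
  by have := lt_le_trans a0 ax; lra.
have out x : a <= x <= b -> ~ J1 x -> 0 <= P x <= q0.
  move=> /xr h /J1E/negP; rewrite -ltNge => xd.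
  by rewrite P0// Ple// ltW.
pose L1 := \int[mu]_(x in `]0, +oo[) (B * \1_`[a, b] x).
pose B2 := B * a^-1 ^+ 2.
pose L2 := \int[mu]_(x in `]0, +oo[) (B2 * \1_`[b^-1, a^-1] x).
have mJ1 : measurable J1 by exact: measurable_itv.
have mJ2 : measurable J2 by exact: measurable_itv.
have Pc n : continuous (fun x => P x ^+ n).
  move=> x; have -> : (fun x => P x ^+ n) = (fun x => (p ^+ n).[x]).
    by apply/funext => y; rewrite horner_exp pE.
  exact: continuous_horner.
have Pinvc n (x : R) : 0 < x -> {for x, continuous (fun y : R => P y^-1 ^+ n)}.
  move=> x_0; apply: (@continuous_comp _ _ _ (fun x : R => x^-1) (fun x => P x ^+ n)); last exact: Pc.
  by apply: inv_continuous; rewrite gt_eqF.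
pose D n := \int[mu]_(x in J1) (P x ^+ n).
have iP n : rint J1 (fun x => P x ^+ n).
  apply: continuous_compact_integrable; first exact: segment_compact.
  exact: continuous_subspaceT.
(* The same mass seen from the [F2] side: the decreasing substitution [x = 1/y] maps [J2] onto
   [J1]. *)
have subst n : D n = \int[mu]_(y in J2) (P y^-1 ^+ n * y^-1 ^+ 2).
  pose F (y : R) := y^-1.
  have dF (y : R) : 0 < y -> is_derive y 1 F (- y^-1 ^+ 2).
    move=> y0; apply: is_derive_eq (is_deriveV _ (is_derive_id y 1)) _.
      by rewrite gt_eqF.
    by rewrite /GRing.scale /= mulr1 exprVn.
  have F' y : 0 < y -> F^`()%classic y = - y^-1 ^+ 2.
    by move=> y0; rewrite derive1E; have [_ ->] := dF y y0.
  have u0 : 0 < (x0 + d)^-1 by rewrite invr_gt0.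
  have v0 : 0 < (x0 - d)^-1 by rewrite invr_gt0.
  have cF' y : 0 < y -> {for y, continuous F^`()%classic}.
    move=> y0; rewrite /prop_for /continuous_at F'//.
    apply: (@cvg_trans _ ((fun z : R => - z^-1 ^+ 2) z @[z --> y])).
      apply: near_eq_cvg; near=> z; rewrite F'//.
      by near: z; exact: lt_nbhsr.
    have : {for y, continuous (fun z : R => z^-1 ^+ 2)}.
      apply: (@continuous_comp _ _ _ (fun x : R => x^-1) (fun x => x ^+ 2)).
        by apply: inv_continuous; rewrite gt_eqF.
      exact: exprn_continuous.
    exact: cvgN.
  have cF (y : R) : 0 < y -> {for y, continuous F}.
    by move=> y0; apply: inv_continuous; rewrite gt_eqF.
  have uv : (x0 + d)^-1 <= (x0 - d)^-1.
    by rewrite lef_pV2 ?posrE//; lra.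
  have := @integration_by_substitution_decreasing R F (fun x => P x ^+ n) _ _ uv.
  have Fu : F (x0 + d)^-1 = x0 + d by exact: invrK.
  have Fv : F (x0 - d)^-1 = x0 - d by exact: invrK.
  rewrite Fu Fv /D /J1 /Rintegral => -> //; last first.
  - exact: continuous_subspaceT.
  - split.
    + by move=> y; rewrite in_itv /= => /andP[uy _]; have [] := dF y (lt_trans u0 uy).
    + by apply: cvg_at_right_filter; exact: cF.
    + by apply: cvg_at_left_filter; exact: cF.
  - by apply/cvg_ex; eexists; apply: cvg_at_left_filter; exact: cF'.
  - by apply/cvg_ex; eexists; apply: cvg_at_right_filter; exact: cF'.
  - move=> y; rewrite in_itv /= => /andP[uy _]; exact: cF' (lt_trans u0 uy).
  - move=> y z; rewrite !in_itv /= => /andP[uy _] /andP[uz _] yz.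
    by rewrite /F ltf_pV2 ?posrE// (lt_le_trans u0).
  rewrite /Rintegral; congr fine; apply: eq_integral => y /set_mem /J2E [y0 _].
  have E : (((fun x => P x ^+ n) \o F) * - F^`()%classic) y = P y^-1 ^+ n * - F^`()%classic y by [].
  by rewrite E F'// opprK.
have ineq1 n : `|\int[mu]_(x in `]0, +oo[) (F1 x * P x ^+ n) - F1 x0 * D n| <= e * D n + q0 ^+ n * L1.
  have [i1 _ _] := moments_poly a0 b0 m1 m2 h1 h2 hn (p ^+ n).
  apply: (kernel_bound mJ1 J1pos _ (iP n) _ h1) => //.
  - by move: i1; congr (rint _ _); apply/funext => x; rewrite horner_exp pE.
  - by rewrite exprn_ge0.
  - move=> x /J1E xd; split; last exact: hd1.
    by rewrite exprn_ge0// P0// (le_trans xd)// ltW.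
  - move=> x xab nJ; have /andP[g1 g2] := out x xab nJ.
    by rewrite ger0_norm ?exprn_ge0// lerXn2r ?nnegrE.
have ineq2 n : `|\int[mu]_(x in `]0, +oo[) (F2 x * P x^-1 ^+ n) - G x0 * D n| <= e * D n + (q0 ^+ n * b ^+ 2) * L2.
  have [_ i1 _] := moments_poly a0 b0 m1 m2 h1 h2 hn (p ^+ n).
  (* Regrouped so that the first factor [F2 x * x^2] is [G] at [1/x] and the second is the kernel in
     [subst]; off [J2], the extra factor [x^-2] is at most [b^2]. *)
  rewrite subst (_ : \int[mu]_(x in `]0, +oo[) (F2 x * P x^-1 ^+ n) =
    \int[mu]_(x in `]0, +oo[) (F2 x * x ^+ 2 * (P x^-1 ^+ n * x^-1 ^+ 2))); last first.
    apply: eq_Rintegral => x /set_mem; rewrite /= in_itv /= andbT => x_0.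
    by field; rewrite gt_eqF.
  apply: (@kernel_bound _ _ J2 b^-1 a^-1 B2) => //.
  - apply: eq_integrable i1 => // x /set_mem; rewrite /= in_itv /= andbT => x_0.
    by congr EFin; rewrite horner_exp pE; field; rewrite gt_eqF.
  - apply: continuous_compact_integrable; first exact: segment_compact.
    apply: continuous_in_subspaceT => x /set_mem /J2E [x_0 _].
    apply: (@continuousM _ _ (fun y : R => P y^-1 ^+ n) (fun x : R => x^-1 ^+ 2)); first exact: Pinvc.
    apply: (@continuous_comp _ _ _ (fun x : R => x^-1) (fun x => x ^+ 2)).
      by apply: inv_continuous; rewrite gt_eqF.
    exact: exprn_continuous.
  - by rewrite mulr_ge0 ?exprn_ge0// ltW.
  - move=> x; have := h2 x; rewrite !indic_itvE normrM; have [xab|_] := boolP (b^-1 <= x <= a^-1).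
      rewrite !mulr1 => h; rewrite ler_pM// ger0_norm ?sqr_ge0//.
      have [g1 _ _] := inv_bound a0 xab; have /andP[_ xa] := xab.
      by rewrite lerXn2r ?nnegrE ?invr_ge0 ?(ltW a0)// ltW// g1.
    by rewrite !mulr0 normr_le0 => /eqP ->; rewrite normr0 mul0r.
  - move=> x /J2E [x_0 /J1E xd]; split.
      by rewrite mulr_ge0 ?exprn_ge0 ?invr_ge0 ?(ltW x_0)// P0// (le_trans xd)// ltW.
    have -> : F2 x * x ^+ 2 = G x^-1 by rewrite /G invrK.
    exact: hd2.
  - move=> x xab nJ; have [g1 g2 g3] := inv_bound a0 xab.
    have nJ' : ~ J1 x^-1 by move=> hJ; apply: nJ; apply/J2E; split => //; exact: g1.
    have [|g4 g5] := andP (out x^-1 _ nJ'); first by rewrite g2// g3.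
    rewrite normrM !ger0_norm ?exprn_ge0 ?invr_ge0 ?(ltW (g1 b0))//.
    by rewrite ler_pM ?exprn_ge0 ?invr_ge0 ?(ltW (g1 b0))// lerXn2r ?nnegrE ?invr_ge0 ?(ltW b0) ?(ltW (g1 b0))// g3.
(* The middle half of [J1], where [P >= q1], already carries mass at least [d q1^n]. *)
have Dlow : exists2 l : R, 0 < l & forall n, l * q1 ^+ n <= D n.
  pose J3 : set R := [set` `[x0 - d / 2, x0 + d / 2] ].
  have mJ3 : measurable J3 by exact: measurable_itv.
  have d2 : d / 2 < d by rewrite ltr_pdivrMr// ltr_pMr// ltr1n.
  have J31 : J3 `<=` J1.
    move=> x; rewrite /J3 /J1 /= !in_itv /= => /andP[g1 g2]; apply/andP; split.
      by apply: le_trans g1; rewrite lerD2l lerN2 ltW.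
    by apply: (le_trans g2); rewrite lerD2l ltW.
  exists (\int[mu]_(x in J1) (\1_J3 x)).
    have lt3 : x0 - d / 2 < x0 + d / 2.
      by apply: (@lt_trans _ _ x0); rewrite ?gtrBl ?ltrDl divr_gt0.
    by rewrite (Rintegral_indic_itv mJ1 lt3 J31) subr_gt0.
  move=> n; rewrite mulrC -RintegralZl//; last first.
    have := @integrable_indic_itv R (x0 - d / 2) (x0 + d / 2) true false.
    by apply: integrableS.
  apply: le_Rintegral => //.
    apply: rintZ => //; have := @integrable_indic_itv R (x0 - d / 2) (x0 + d / 2) true false.
    by apply: integrableS.
    exact: iP.
  move=> x /J1E xd; rewrite indic_itvE; have [h|_] := boolP (x0 - d / 2 <= x <= x0 + d / 2).
    rewrite mulr1 lerXn2r ?nnegrE ?(ltW q10)//; first by rewrite P0// (le_trans xd)// ltW.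
    by apply: Pge; [rewrite divr_ge0// ltW|rewrite ler_distl].
  by rewrite mulr0 exprn_ge0// P0// (le_trans xd)// ltW.
have [l l0 hl] := Dlow.
have D0 n : 0 < D n by apply: lt_le_trans (hl n); rewrite mulr_gt0 ?exprn_gt0.
have key n : `|F1 x0 - G x0| * D n <= 2 * e * D n + q0 ^+ n * (L1 + b ^+ 2 * L2).
  have [_ _ E] := moments_poly a0 b0 m1 m2 h1 h2 hn (p ^+ n).
  have E' : \int[mu]_(x in `]0, +oo[) (F1 x * P x ^+ n) = \int[mu]_(x in `]0, +oo[) (F2 x * P x^-1 ^+ n).
    transitivity (\int[mu]_(x in `]0, +oo[) (F1 x * (p ^+ n).[x])).
      by apply: eq_Rintegral => x _; rewrite horner_exp pE.
    by rewrite E; apply: eq_Rintegral => x _; rewrite horner_exp pE.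
  have := ineq1 n; have := ineq2 n; rewrite -E'.
  move: (\int[mu]_(x in `]0, +oo[) _) => I hI2 hI1.
  rewrite -(gtr0_norm (D0 n)) -normrM (gtr0_norm (D0 n)) mulrBl.
  have -> : F1 x0 * D n - G x0 * D n = (I - G x0 * D n) - (I - F1 x0 * D n) by ring.
  apply: le_trans (ler_normB _ _) _; apply: le_trans (lerD hI2 hI1) _.
  by rewrite le_eqVlt; apply/orP; left; apply/eqP; ring.
pose C := `|L1 + b ^+ 2 * L2| / l.
have C0 : 0 <= C by rewrite divr_ge0// ltW.
have key2 n : `|F1 x0 - G x0| <= 2 * e + C * (q0 / q1) ^+ n.
  rewrite -(ler_pM2r (D0 n)); apply: le_trans (key n) _; rewrite [leRHS]mulrDl lerD2l.
  apply: (@le_trans _ _ (q0 ^+ n * (C * l))).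
    by rewrite ler_wpM2l ?exprn_ge0// /C divfK ?gt_eqF// ler_norm.
  have -> : C * (q0 / q1) ^+ n * D n = q0 ^+ n * (C * (D n / q1 ^+ n)).
    by rewrite expr_div_n; ring.
  rewrite ler_wpM2l ?exprn_ge0// ler_wpM2l//.
  by rewrite ler_pdivlMr ?exprn_gt0.
have q1n : `|q0 / q1| < 1.
  by rewrite ger0_norm ?divr_ge0 ?(ltW q10)// ltr_pdivrMr// mul1r.
have /cvgrPdist_le/(_ e e0)[N _ hN] : C * (q0 / q1) ^+ n @[n --> \oo] --> 0.
  exact: (cvg_geometric C q1n).
have := hN N (leqnn N); rewrite /= sub0r normrN ger0_norm; last first.
  exact: (mulr_ge0 C0 (exprn_ge0 _ (divr_ge0 q00 (ltW q10)))).
move=> hC; apply: le_trans (key2 N) _.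
have -> : e3 = 2 * e + e by rewrite /e; field.
by rewrite lerD2l.
Unshelve. all: by end_near. Qed.

End Moments.

(** * The modular group *)

Section ModularGroup.
Implicit Types g h : SL2Z.

Lemma mul22E (A B : 'M[int]_2) i j : (A *m B) i j = A i 0 * B 0 j + A i 1 * B 1 j.
Proof.
rewrite mxE !big_ord_recl big_ord0 addr0; congr (_ + A i _ * B _ j); exact: val_inj.
Qed.

Lemma ord2P (i : 'I_2) : i = 0 \/ i = 1.
Proof. by case: i => -[|[|]]// h; [left|right]; exact: val_inj. Qed.

Lemma SL2Z_eq g h : val g 0 0 = val h 0 0 -> val g 0 1 = val h 0 1 ->
  val g 1 0 = val h 1 0 -> val g 1 1 = val h 1 1 -> g = h.
Proof.
move=> e1 e2 e3 e4; apply: val_inj; apply/matrixP => i j.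
by case: (ord2P i) => ->; case: (ord2P j) => ->.
Qed.

Lemma SL2Z_det g : val g 0 0 * val g 1 1 - val g 0 1 * val g 1 0 = 1.
Proof.
have E : val g = mx22 (val g 0 0) (val g 0 1) (val g 1 0) (val g 1 1).
  by apply/matrixP => i j; case: (ord2P i) => ->; case: (ord2P j) => ->; rewrite mxE.
by have /eqP := valP g; rewrite [in \det _]E det_mx22E.
Qed.

Lemma SL2ZME g h i j : val (SL2ZM g h) i j = val g i 0 * val h 0 j + val g i 1 * val h 1 j.
Proof. exact: mul22E. Qed.

(** Euclid's algorithm on the first column, by induction on the absolute value of the lower left
    entry. The last closure hypothesis yields inverses, hence negative powers of [T]; the matrix
    [-1] is [S^2]. *)
Lemma SL2Z_ind (P : SL2Z -> Prop) : P SL2ZS -> P SL2ZT ->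
  (forall g h, P g -> P h -> P (SL2ZM g h)) ->
  (forall g h, P g -> SL2ZM g h = SL2Z1 -> P h) -> forall g, P g.
Proof.
move=> PS PT PM PV.
have mk (a b c d : int) : a * d - b * c = 1 -> exists g, val g = mx22 a b c d.
  move=> e; have D : \det (mx22 a b c d) == 1 by rewrite det_mx22E e.
  by exists (exist (fun g : 'M[int]_2 => \det g == 1) _ D).
have PTn (n : nat) : exists2 g, P g & val g = mx22 1 n 0 1.
  elim: n => [|n [g Pg Eg]].
    have [h Eh] : exists h, val h = mx22 1 (-1) 0 1 by apply: mk.
    have Ph : P h.
      apply: PV PT _; apply: SL2Z_eq; rewrite !SL2ZME Eh !mxE /=; lia.
    exists (SL2ZM SL2ZT h); first exact: PM.
    apply/matrixP => i j; rewrite SL2ZME Eh.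
    by case: (ord2P i) => ->; case: (ord2P j) => ->; rewrite !mxE /=.
  exists (SL2ZM g SL2ZT); first exact: PM.
  apply/matrixP => i j; rewrite SL2ZME Eg.
  by case: (ord2P i) => ->; case: (ord2P j) => ->; rewrite !mxE /=; lia.
have PTz (n : int) : exists2 g, P g & val g = mx22 1 n 0 1.
  case: (intP n) => [|p|p]; first exact: (PTn 0%N).
    exact: (PTn p.+1).
  have [g Pg Eg] := PTn p.+1.
  have [h Eh] : exists h, val h = mx22 1 (- p.+1%:Z) 0 1 by apply: mk.
  exists h => //; apply: PV Pg _; apply: SL2Z_eq; rewrite !SL2ZME Eg Eh !mxE /=; lia.
have Pneg g : P g -> exists2 h, P h & forall i j, val h i j = - val g i j.
  move=> Pg; exists (SL2ZM (SL2ZM SL2ZS SL2ZS) g); first exact: (PM _ _ (PM _ _ PS PS) Pg).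
  move=> i j; rewrite !SL2ZME.
  by case: (ord2P i) => ->; rewrite !mxE /=; lia.
suff main (n : nat) : forall g, (absz (val g 1%R 0%R) <= n)%N -> P g.
  by move=> g; exact: main (leqnn _).
elim: n => [|n IH] g hg.
  have c0 : val g 1 0 = 0 by lia.
  have := SL2Z_det g; rewrite c0 mulr0 subr0 => ad.
  (* With lower left entry [0] the diagonal is [(1, 1)] or [(-1, -1)]; writing [a], [b] for the
     first row, [g] is [T^(ab)] or [-T^(ab)]. *)
  have [h Ph Eh] := PTz (val g 0 0 * val g 0 1).
  have [[a1 d1]|[a1 d1]] : (val g 0 0 = 1 /\ val g 1 1 = 1) \/ (val g 0 0 = -1 /\ val g 1 1 = -1).
    have : (absz (val g 0%R 0%R) * absz (val g 1%R 1%R) == 1)%N by rewrite -abszM ad.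
    rewrite muln_eq1 => /andP[/eqP a1 /eqP d1]; move: ad a1 d1.
    move: (val g 0 0) (val g 1 1) => a d ad a1 d1.
    have [ea|ea] : a = 1 \/ a = -1 by lia.
      by left; move: ad; rewrite ea mul1r.
    by right; move: ad; rewrite ea mulN1r => /eqP; rewrite eqr_oppLR => /eqP.
    suff -> : g = h by [].
    by apply: SL2Z_eq; rewrite Eh !mxE /= ?c0 ?a1 ?d1 ?mul1r.
  have [h' Ph' Eh'] := Pneg h Ph.
  suff -> : g = h' by [].
  by apply: SL2Z_eq; rewrite Eh' Eh !mxE /= ?c0 ?a1 ?d1 ?mulN1r ?opprK ?oppr0.
have [c0|c0] := eqVneq (val g 1 0) 0.
  by apply: IH; rewrite c0.
(* With [a], [c] the first column, [S T^(-q) g] has the remainder of [a] modulo [c] as its lower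
   left entry. *)
pose q := divz (val g 0 0) (val g 1 0).
have [t Pt Et] := PTz (- q).
have [t' Pt' Et'] := PTz q.
pose h := SL2ZM SL2ZS (SL2ZM t g).
have Ph : P h.
  apply: IH; rewrite /h !SL2ZME !mxE Et !mxE /=.
  have -> : 1 * (1 * val g 0 0 + - q * val g 1 0) + 0 * (0 * val g 0 0 + 1 * val g 1 0) =
     modz (val g 0 0) (val g 1 0) by rewrite /modz -/q; ring.
  by have := ltz_mod (val g 0 0) c0; have := modz_ge0 (val g 0 0) c0; lia.
have [s Ps Es] := Pneg _ PS.
have -> : g = SL2ZM t' (SL2ZM s h).
  apply: SL2Z_eq; rewrite /h !SL2ZME Et Et' !Es !mxE /=; ring.
exact: (PM _ _ Pt' (PM _ _ Ps Ph)).
Qed.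

End ModularGroup.

Section Slash.
Variable R : realType.
Implicit Types (z tau zeta : R[i]) (a x : R).

Lemma cpowE z a : cpow z a = (cabs z `^ a)%:C * cexp ((a * carg z)%:C * 'i%C).
Proof.
rewrite /cpow /cexp; congr (_ * _).
have -> : Re ((a * carg z)%:C * 'i%C) = 0 by rewrite ReM /= mulr0 mul0r subr0.
have -> : Im ((a * carg z)%:C * 'i%C) = a * carg z by rewrite ImM /= mulr1 mul0r addr0.
by rewrite expR0 mul1r.
Qed.

Lemma cpowN z a : cpow z (- a) = (cpow z a)^-1.
Proof.
rewrite !cpowE invfM powRN realcV; congr (_ * _).
by rewrite -cexpN; congr cexp; rewrite -mulNr -realcN -mulNr.
Qed.

Lemma cabs_eq0 z : (cabs z == 0) = (z == 0).
Proof. by apply/eqP/eqP => [/cabs0_eq|->] //; exact: Normc.normc0. Qed.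

Lemma cpow_neq0 z a : z != 0 -> cpow z a != 0.
Proof.
move=> z0; rewrite cpowE mulf_neq0 ?cexp_neq0// realc_eq0 gt_eqF// powR_gt0//.
by rewrite lt_neqAle cabs_ge0 eq_sym cabs_eq0 z0.
Qed.

Lemma cpow1 a : cpow 1 a = 1 :> R[i].
Proof.
have c1 : cabs (1 : R[i]) = 1 by exact: Normc.normc1.
rewrite cpowE /carg c1 powR1 divr1 /= lexx acos1 mulr0.
by rewrite mul0r cexp0 mulr1.
Qed.

(** Principal powers are not multiplicative in general. Here the argument of [i e^zeta] is
    [Im zeta + pi/2], inside [(0, pi)], so no jump of the branch is met. *)
Lemma cpow_i_cexp zeta a : strip zeta ->
  cpow ('i%C * cexp zeta) a = cpow 'i%C a * cexp (a%:C * zeta).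
Proof.
have gen z : strip z -> cpow ('i%C * cexp z) a = cexp (a%:C * (z + (pi / 2)%:C * 'i%C)).
  move=> /andP[h1 h2]; rewrite cpowE Normc.normcM cabs_i mul1r cabs_cexp.
  have -> : carg ('i%C * cexp z) = Im z + pi / 2.
    rewrite /carg Normc.normcM cabs_i mul1r cabs_cexp ReM ImM Re_cexp Im_cexp /= !mul0r !mul1r sub0r add0r.
    have c0 : 0 < cos (Im z) by apply: cos_gt0_pihalf; rewrite h1.
    rewrite mulr_ge0 ?expR_ge0 ?(ltW c0)//.
    have -> : - (expR (Re z) * sin (Im z)) / expR (Re z) = - sin (Im z).
      by field; rewrite gt_eqF ?expR_gt0.
    rewrite -cosDpihalf cosK// in_itv /=; apply/andP; split; lra.
  rewrite -expRM mulrC -cexp_real -cexpD; congr cexp.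
  by apply: complex_ext; rewrite !(ReD, ImD, ReM, ImM) /=; ring.
move=> hz; have h0 : strip (0 : R[i]).
  by rewrite /strip /= oppr_lt0 divr_gt0 ?pi_gt0.
have := gen 0 h0; rewrite cexp0 mulr1 => ->; rewrite gen// -cexpD; congr cexp.
ring.
Qed.

Lemma upper_polar tau : 0 < Im tau -> exists2 zeta, strip zeta & tau = 'i%C * cexp zeta.
Proof.
move=> v0; have t0 : 0 < cabs tau.
  by apply: lt_le_trans (normr_Im_le tau); rewrite normr_gt0 gt_eqF.
pose x := Re tau / cabs tau.
have x2 : (Im tau / cabs tau) ^+ 2 = 1 - x ^+ 2.
  rewrite /x !expr_div_n; apply/eqP; rewrite eq_sym subr_eq -mulrDl addrC -cabs_sqr.
  by rewrite divff// expf_neq0// gt_eqF.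
have x1 : -1 < x < 1.
  rewrite -ltr_norml -(@ltr_pXn2r _ 2)// ?nnegrE// expr1n real_normK ?num_real//.
  by rewrite -subr_gt0 -x2 exprn_gt0// divr_gt0.
have x1' : -1 <= x <= 1 by case/andP: x1 => /ltW -> /ltW ->.
(* As [i e^(it) = - sin t + i cos t], the angle must have sine [- Re tau / |tau|]; cosine positive
   selects the arcsine. *)
exists (ln (cabs tau) +i* - asin x).
  have /andP[g1 g2] := x1.
  have s1 : asin x < pi / 2 by apply: asin_ltpi2; rewrite (ltW g1) g2.
  have s2 : - (pi / 2) < asin x by apply: asin_gtNpi2; rewrite g1 (ltW g2).
  by rewrite /strip /= ltrN2 s1 ltrNl.
have sx : sin (asin x) = x by apply: asinK; rewrite in_itv.
apply: complex_ext; [rewrite [RHS]ReM|rewrite [RHS]ImM]; rewrite Re_cexp Im_cexp /= lnK ?posrE//.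
  by rewrite sinN sx mul0r mul1r sub0r mulrN opprK /x mulrC divfK ?gt_eqF.
rewrite cosN mul0r mul1r add0r cos_asin// -x2 sqrtr_sqr.
by rewrite ger0_norm ?divr_ge0 ?(ltW v0) ?(ltW t0)// mulrC divfK ?gt_eqF.
Qed.

Lemma autjM g h tau : autj h tau != 0 ->
  autj (SL2ZM g h) tau = autj g (moebius h tau) * autj h tau.
Proof.
move=> h0; rewrite [autj g _]/autj [RHS]mulrDl -[X in _ = X + _]mulrA /moebius divfK//.
rewrite /autj !SL2ZME !intrD !intrM; ring.
Qed.

Lemma autj_neq0 g tau : 0 < Im tau -> autj g tau != 0.
Proof.
move=> v0; apply/eqP => e.
have intc (n : int) : n%:~R = (n%:~R)%:C :> R[i] by rewrite rmorph_int.
have c0 : (val g 1 0)%:~R = 0 :> R.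
  have := congr1 (@Im R) e; rewrite /autj !intc ImD ImM /= mul0r !addr0 => /eqP.
  by rewrite mulf_eq0 (gt_eqF v0) orbF => /eqP.
have d0 : (val g 1 1)%:~R = 0 :> R.
  by have := congr1 (@Re R) e; rewrite /autj !intc ReD ReM /= c0 !mul0r subr0 add0r.
have := SL2Z_det g; move/eqP: c0; move/eqP: d0; rewrite !intr_eq0 => /eqP -> /eqP ->.
by rewrite !mulr0 subr0.
Qed.

Lemma moebius_Im g tau : 0 < Im tau -> 0 < Im (moebius g tau).
Proof.
move=> v0; have j0 := autj_neq0 g v0.
have intc (n : int) : n%:~R = (n%:~R)%:C :> R[i] by rewrite rmorph_int.
have n0 : 0 < Re (autj g tau) ^+ 2 + Im (autj g tau) ^+ 2.
  by rewrite -cabs_sqr exprn_gt0// lt_neqAle cabs_ge0 eq_sym cabs_eq0 j0.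
have inv z : Im z^-1 = - Im z / (Re z ^+ 2 + Im z ^+ 2) /\ Re z^-1 = Re z / (Re z ^+ 2 + Im z ^+ 2).
  by case: z => ? ? /=; rewrite mulNr.
rewrite /moebius ImM (inv _).1 (inv _).2 mulrA mulrA -mulrDl divr_gt0//.
have det : (val g 0 0)%:~R * (val g 1 1)%:~R - (val g 0 1)%:~R * (val g 1 0)%:~R = 1 :> R.
  by rewrite -!intrM -intrB SL2Z_det.
rewrite /autj !intc; move: ((val g 0 0)%:~R : R) ((val g 0 1)%:~R : R) ((val g 1 0)%:~R : R)
  ((val g 1 1)%:~R : R) det => a b c d det.
rewrite !(ReD, ImD, ReM, ImM) /= !(mul0r, mulr0, addr0, subr0, add0r).
suff -> : (a * Re tau + b) * - (c * Im tau) + a * Im tau * (c * Re tau + d) = (a * d - b * c) * Im tau.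
  by rewrite det mul1r.
ring.
Qed.

Lemma moebiusM g h tau : 0 < Im tau ->
  moebius (SL2ZM g h) tau = moebius g (moebius h tau).
Proof.
move=> v0; have j0 := autj_neq0 h v0; have j1 := autj_neq0 g (moebius_Im h v0).
have e : (val (SL2ZM g h) 0 0)%:~R * tau + (val (SL2ZM g h) 0 1)%:~R =
    ((val g 0 0)%:~R * moebius h tau + (val g 0 1)%:~R) * autj h tau :> R[i].
  rewrite [RHS]mulrDl -[X in _ = X + _]mulrA /moebius divfK//.
  by rewrite /autj !SL2ZME !intrD !intrM; ring.
by rewrite [LHS]/moebius e autjM// -mulf_div divff// mulr1.
Qed.

Section Invariance.
Variables (m : nat) (k : R) (chi : SL2Z -> R[i]) (rho : SL2Z -> 'M[R[i]]_m).
Hypothesis hchi : unitary_multiplier k chi.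
Hypothesis hrho : unitary_representation rho.

Lemma chi_neq0 g : chi g != 0.
Proof. by rewrite -normr_eq0 hchi.1 oner_eq0. Qed.

(** The consistency condition at [g = h = 1] reads [chi(1) = chi(1)^2], as the automorphy factor is
    [1]. *)
Lemma chi1 : chi SL2Z1 = 1.
Proof.
have e : SL2ZM SL2Z1 SL2Z1 = SL2Z1.
  by apply: SL2Z_eq; rewrite !SL2ZME !mxE.
have i0 : 0 < Im ('i%C : R[i]) by exact: ltr01.
have j1 tau : autj SL2Z1 tau = 1 :> R[i].
  by rewrite /autj !mxE /= mul0r add0r.
have := hchi.2 SL2Z1 SL2Z1 'i%C i0; rewrite e !j1 !cpow1 !mulr1 => h.
by apply: (mulfI (chi_neq0 SL2Z1)); rewrite mulr1 -h.
Qed.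

Lemma rho_unit g : rho g \in unitmx.
Proof. by apply: unitarymx_unit; have [_ _ ->] := hrho. Qed.

Let invmx_mul (A B : 'M[R[i]]_m) : A \in unitmx -> B \in unitmx ->
  invmx (A *m B) = invmx B *m invmx A.
Proof.
move=> uA uB; have uAB : A *m B \in unitmx by rewrite unitmx_mul uA.
apply: (can_inj (mulKmx uAB)); rewrite mulmxV//.
by rewrite mulmxA -(mulmxA A) mulmxV// mulmx1 mulmxV.
Qed.

Let fac g tau := cpow (autj g tau) (- k) * (chi g)^-1.

Let facM g h tau : 0 < Im tau -> fac (SL2ZM g h) tau = fac g (moebius h tau) * fac h tau.
Proof.
move=> v0; have := hchi.2 g h tau v0; rewrite /fac !cpowN -!invfM => e.
by congr (_^-1); rewrite mulrC e; ring.
Qed.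

(** The consistency condition on [chi], in the form [facM], and the multiplicativity of [rho] make
    the slash operation a right action. *)
Let slashM f g h tau : 0 < Im tau ->
  slash k chi rho f (SL2ZM g h) tau = fac h tau *: (invmx (rho h) *m slash k chi rho f g (moebius h tau)).
Proof.
move=> v0; rewrite /slash -/(fac _ _) -/(fac _ _) facM// moebiusM//.
have [_ -> _] := hrho; rewrite invmx_mul ?rho_unit//.
by rewrite -scalemxAr scalerA mulrC mulmxA.
Qed.

Lemma slash_invariant (f : R[i] -> 'cV[R[i]]_m) :
  (forall tau, 0 < Im tau -> slash k chi rho f SL2ZS tau = f tau) ->
  (forall tau, 0 < Im tau -> slash k chi rho f SL2ZT tau = f tau) ->
  forall g tau, 0 < Im tau -> slash k chi rho f g tau = f tau.
Proof.
have s1 tau : slash k chi rho f SL2Z1 tau = f tau.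
  rewrite /slash chi1; have [-> _ _] := hrho.
  have -> : autj SL2Z1 tau = 1 by rewrite /autj !mxE /= mul0r add0r.
  rewrite cpow1 invr1 mulr1 scale1r invmx1 mul1mx; congr f.
  by rewrite /moebius /autj !mxE /= mul0r mul1r addr0 add0r divr1.
move=> fS fT.
apply: (@SL2Z_ind (fun g => forall tau, 0 < Im tau -> slash k chi rho f g tau = f tau));
  [exact: fS|exact: fT|move=> g h fg fh tau v0|move=> g h fg gh tau v0].
  by rewrite slashM// fg ?moebius_Im//; exact: fh.
(* If [gh = 1] and [f|g = f], then [f|h = (f|g)|h = f|1 = f]. *)
by rewrite -[RHS]s1 -gh slashM// fg// moebius_Im.
Qed.

End Invariance.
End Slash.

(** * Functional equations on the imaginary axis *)

Section Orthogonality.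
Variable R : realType.
Notation mu := (@lebesgue_measure R).
Implicit Types (F G H K phi : R -> R[i]).

Let mpos : measurable (`]0, +oo[ : set R). Proof. exact: measurable_itv. Qed.

Definition ccont F (x : R) := {for x, continuous (fun y => Re (F y))} /\
  {for x, continuous (fun y => Im (F y))}.

Lemma ccontD F G x : ccont F x -> ccont G x -> ccont (fun y => F y + G y) x.
Proof.
move=> [a b] [c d]; split.
  rewrite (_ : (fun y => _) = (fun y => Re (F y) + Re (G y))); first exact: continuousD.
  by apply/funext => y; rewrite ReD.
rewrite (_ : (fun y => _) = (fun y => Im (F y) + Im (G y))); first exact: continuousD.
by apply/funext => y; rewrite ImD.
Qed.

Lemma ccontM F G x : ccont F x -> ccont G x -> ccont (fun y => F y * G y) x.
Proof.
move=> [a b] [c d]; split.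
  rewrite (_ : (fun y => _) = (fun y => Re (F y) * Re (G y) - Im (F y) * Im (G y))).
    by apply: continuousB; exact: continuousM.
  by apply/funext => y; rewrite ReM.
rewrite (_ : (fun y => _) = (fun y => Re (F y) * Im (G y) + Im (F y) * Re (G y))).
  by apply: continuousD; exact: continuousM.
by apply/funext => y; rewrite ImM.
Qed.

Lemma ccont_cst (c : R[i]) x : ccont (fun=> c) x.
Proof. by split; exact: cst_continuous. Qed.

Lemma ccont_real (f : R -> R) x : {for x, continuous f} -> ccont (fun y => (f y)%:C) x.
Proof. by move=> h; split => //=; exact: cst_continuous. Qed.

Lemma ccontN F x : ccont F x -> ccont (fun y => - F y) x.
Proof.
move=> h; rewrite (_ : (fun y => _) = (fun y => (-1) * F y)).
  by apply: ccontM h; exact: ccont_cst.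
by apply/funext => y; rewrite mulN1r.
Qed.

Lemma ccont_sum (I : Type) (s : seq I) (F : I -> R -> R[i]) x :
  (forall i, ccont (F i) x) -> ccont (fun y => \sum_(i <- s) F i y) x.
Proof.
move=> h; elim: s => [|i s IH].
  rewrite (_ : (fun y => _) = (fun=> 0)); first exact: ccont_cst.
  by apply/funext => y; rewrite big_nil.
rewrite (_ : (fun y => _) = (fun y => F i y + \sum_(i <- s) F i y)); first exact: ccontD.
by apply/funext => y; rewrite big_cons.
Qed.

Lemma ccont_inv F (x : R) : 0 < x -> ccont F x^-1 -> ccont (fun y => F y^-1) x.
Proof.
move=> x0 [a b]; have ci : {for x, continuous (fun y : R => y^-1)}.
  by apply: inv_continuous; rewrite gt_eqF.
by split; [exact: (@continuous_comp _ _ _ (fun y : R => y^-1) (fun y => Re (F y)))|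
  exact: (@continuous_comp _ _ _ (fun y : R => y^-1) (fun y => Im (F y)))].
Qed.

Lemma ccont_powR (s x : R) : 0 < x -> ccont (fun y => (y `^ s)%:C) x.
Proof.
move=> x0; apply: ccont_real; apply: differentiable_continuous; apply/derivable1_diffP.
by have [] := is_derive1_powR s x0.
Qed.

Lemma ccont_near F G (x l u : R) : l < x < u ->
  (forall y, l < y < u -> F y = G y) -> ccont G x -> ccont F x.
Proof.
move=> /andP[lx xu] FG [a b].
have near_ (p : R[i] -> R) : {for x, continuous (fun y => p (G y))} ->
    {for x, continuous (fun y => p (F y))}.
  rewrite /prop_for /continuous_at => c; rewrite FG ?lx//.
  apply: cvg_trans c; apply: near_eq_cvg; near=> y; rewrite FG//; apply/andP; split.
    by near: y; exact: lt_nbhsr.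
  by near: y; exact: lt_nbhsl.
by split; exact: near_.
Unshelve. all: by end_near. Qed.

Lemma ccont_dist F x (e : R) : ccont F x -> 0 < e -> exists2 d : R, 0 < d &
  forall y, `|y - x| < d -> cabs (F y - F x) < e.
Proof.
move=> [a b] e0; have e2 : 0 < e / 2 by rewrite divr_gt0.
have ball (f : R -> R) : {for x, continuous f} -> exists2 d, 0 < d &
      forall y, `|y - x| < d -> `|f y - f x| < e / 2.
  move=> /cvgrPdist_lt/(_ _ e2)/nbhs_ballP[d d0 hd]; exists d => // y yd.
  by rewrite distrC; apply: hd; rewrite /ball /= distrC.
have [[d1 d10 h1] [d2 d20 h2]] := (ball _ a, ball _ b).
exists (Num.min d1 d2); first by rewrite lt_min d10.
move=> y; rewrite lt_min => /andP[y1 y2].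
apply: le_lt_trans (cabs_le_ReIm _) _; rewrite ReB ImB [e]splitr.
by apply: ltrD; [exact: h1|exact: h2].
Qed.

Lemma test_boundMc a b B phi H : test_bound a b B phi -> (forall x, 0 < x -> ccont H x) ->
  exists2 B', 0 <= B' & test_bound a b B' (fun x => H x * phi x).
Proof.
move=> h hH; have [a0 mp hp] := h.
have bd (f : R -> R) : (forall x, 0 < x -> {for x, continuous f}) ->
    exists C, forall x, a <= x <= b -> `|f x| <= C.
  move=> fc; have [ab|ba] := leP a b; last first.
    by exists 0 => x /andP[g1 g2]; have := lt_le_trans ba (le_trans g1 g2); rewrite ltxx.
  have [|c _ hc] := @EVT_max R (fun x => `|f x|) a b ab.
    apply: continuous_in_subspaceT => x /set_mem; rewrite /= in_itv /= => /andP[ax _].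
    apply: (@continuous_comp _ _ _ f (fun y => `|y|)); last exact: norm_continuous.
    by apply: fc; exact: lt_le_trans ax.
  by exists (`|f c|) => x hx; apply: hc; rewrite in_itv.
have [C1 hC1] := bd _ (fun x x0 => (hH x x0).1).
have [C2 hC2] := bd _ (fun x x0 => (hH x x0).2).
exists ((`|C1| + `|C2|) * `|B|); first by rewrite mulr_ge0 ?addr_ge0.
have H0 x : 0 < x \/ phi x = 0.
  have [|x0] := ltP 0 x; [by left|right].
  by rewrite (test_bound_out h)// => /andP[ax _]; have := lt_le_trans a0 (le_trans ax x0); rewrite ltxx.
split => //.
  (* [H] is controlled only on [x > 0]; on the rest of the line [phi] vanishes, so [H] may be
     replaced by [0]. *)
  pose Hp (x : R) := if 0 < x then H x else 0.
  have -> : (fun x => H x * phi x) = (fun x => Hp x * phi x).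
    apply/funext => x; rewrite /Hp; case: (H0 x) => [->//|->].
    by rewrite !mulr0.
  apply: cmeasM => //.
  have gen (p : R[i] -> R) : p 0 = 0 -> (forall x, 0 < x -> {for x, continuous (fun y => p (H y))}) ->
      measurable_fun setT (fun x => p (Hp x)).
    move=> p0 pc; rewrite (_ : (fun x => _) = ((fun y => p (H y)) \_ `]0, +oo[)).
      apply/(measurable_restrictT _ _).1; first exact: mpos.
      apply: open_continuous_measurable_fun; first exact: interval_open.
      by move=> x /set_mem; rewrite /= in_itv /= andbT => /pc.
    apply/funext => x; rewrite patchE /Hp; have [x0|x0] := boolP (0 < x).
      by rewrite mem_set//= in_itv /= x0.
    by rewrite memNset//= in_itv /= andbT; exact/negP.
  by split; apply: gen => // x /hH [].
move=> x; rewrite indic_itvE Normc.normcM; have [xab|/negP xab] := boolP (a <= x <= b); last first.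
  by rewrite (test_bound_out h xab) Normc.normc0 !mulr0.
rewrite mulr1 ler_pM ?cabs_ge0 ?(test_bound_in x h)//.
apply: le_trans (cabs_le_ReIm _) _; apply: lerD.
  by apply: le_trans (hC1 x xab) (ler_norm _).
by apply: le_trans (hC2 x xab) (ler_norm _).
Qed.

Lemma test_bound_le a b B B' phi : B <= B' -> test_bound a b B phi -> test_bound a b B' phi.
Proof.
move=> BB [a0 mp hp]; split => // x; apply: le_trans (hp x) _.
by rewrite indic_itvE ler_wpM2r.
Qed.

Lemma moment_point_complex F1 F2 (a b B x0 : R) : 0 < b -> test_bound a b B F1 ->
  test_bound b^-1 a^-1 B F2 ->
  (forall n : nat, cintegral `]0, +oo[ (fun x => F1 x * (x ^+ n)%:C) =
     cintegral `]0, +oo[ (fun x => F2 x * (x^-1 ^+ n)%:C)) ->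
  0 < x0 -> ccont F1 x0 -> ccont (fun x => F2 x^-1) x0 ->
  F1 x0 = F2 x0^-1 * (x0^-1 ^+ 2)%:C.
Proof.
move=> b0 [a0 [m1 m1'] h1] [_ [m2 m2'] h2] hn x00 [c1 c1'] [c2 c2'].
have eRe z (r : R) : Re (z * r%:C) = Re z * r by rewrite ReM /= mulr0 subr0.
have eIm z (r : R) : Im (z * r%:C) = Im z * r by rewrite ImM /= mulr0 add0r.
apply: complex_ext; rewrite ?eRe ?eIm.
  apply: (@moment_point R (fun x => Re (F1 x)) (fun x => Re (F2 x)) a b B) => //.
  - by move=> x; apply: le_trans (normr_Re_le _) (h1 x).
  - by move=> x; apply: le_trans (normr_Re_le _) (h2 x).
  - move=> n; have := congr1 (@Re R) (hn n); rewrite /cintegral /= => e.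
    transitivity (\int[mu]_(x in `]0, +oo[) Re (F1 x * (x ^+ n)%:C)).
      by apply: eq_Rintegral => x _; rewrite eRe.
    by rewrite e; apply: eq_Rintegral => x _; rewrite eRe.
apply: (@moment_point R (fun x => Im (F1 x)) (fun x => Im (F2 x)) a b B) => //.
- by move=> x; apply: le_trans (normr_Im_le _) (h1 x).
- by move=> x; apply: le_trans (normr_Im_le _) (h2 x).
- move=> n; have := congr1 (@Im R) (hn n); rewrite /cintegral /= => e.
  transitivity (\int[mu]_(x in `]0, +oo[) Im (F1 x * (x ^+ n)%:C)).
    by apply: eq_Rintegral => x _; rewrite eIm.
  by rewrite e; apply: eq_Rintegral => x _; rewrite eIm.
Qed.

Lemma smooth_continuous (g : R -> R) : smooth g -> continuous g.
Proof.
move=> sg x; apply: differentiable_continuous; apply/derivable1_diffP.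
exact: sg 0%N x.
Qed.

(** * From integral identities to pointwise ones *)

Section Functional.
Variables (k : R) (chi : SL2Z -> R[i]) (Sc : set (R -> R[i])) (H K : R -> R[i]).
Hypothesis hSc : test_functions Sc.
Hypothesis cH : forall x, 0 < x -> ccont H x.
Hypothesis cK : forall x, 0 < x -> ccont K x.
Hypothesis hI : forall phi, Sc phi -> cintegral `]0, +oo[ (fun x => H x * phi x) =
  cintegral `]0, +oo[ (fun x => K x * slash_test k chi phi x).

Let D x := H x - K x^-1 * (chi SL2ZS * (x `^ (- k))%:C).

(** Stability under twists provides the test functions [phi(x) x^n], so [H phi] and [K (phi|S)]
    satisfy the moment hypothesis of [moment_point_complex]. At a continuity point of [phi] the
    resulting equation can be divided by [phi x0]. *)
Let D_at phi x0 : Sc phi -> 0 < x0 -> phi x0 != 0 -> ccont phi x0 -> D x0 = 0.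
Proof.
move=> sphi x00 phi0 cphi; have [hcs htw _] := hSc.
have [a [b [B h]]] : nice phi by have [h1 h2] := hcs _ sphi; exact: nice_of_pieces.
have /andP[ax xb] : a <= x0 <= b.
  by apply: contraNT phi0 => /negP h'; rewrite (test_bound_out h).
have [a0 _ _] := h; have b0 : 0 < b by exact: lt_le_trans xb.
have [B1 hB1] := test_bound_slash k chi (le_trans ax xb) h.
have [C1 C10 hF1] := test_boundMc h cH; have [C2 C20 hF2] := test_boundMc hB1 cK.
have xi0 : 0 < x0^-1 by rewrite invr_gt0.
have := @moment_point_complex _ _ a b (Num.max C1 C2) x0 b0
  (test_bound_le _ hF1) (test_bound_le _ hF2).
rewrite !le_max !lexx orbT => /(_ isT isT) => E.
have {}E := E _ x00 _ _.
have twE (n : nat) x : 0 < x -> twist n.+1%:R phi x = phi x * (x ^+ n)%:C.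
  by move=> x_0; rewrite /twist -natr1 addrK powR_mulrn ?ltW.
rewrite /D; apply/eqP; rewrite subr_eq0; apply/eqP; apply: (mulIf phi0); rewrite E.
- rewrite /slash_test invrK; transitivity (K x0^-1 * (chi SL2ZS * phi x0) * ((x0^-1 `^ (k - 2)) * x0^-1 ^+ 2)%:C).
    by rewrite realcM; ring.
  have -> : x0^-1 `^ (k - 2) * x0^-1 ^+ 2 = x0 `^ (- k).
    rewrite -[x0^-1 ^+ 2]powR_mulrn ?ltW// -powRD; last by rewrite (gt_eqF xi0) implybT.
    by rewrite subrK -powR_inv1 ?ltW// -powRrM mulN1r.
  ring.
- move=> n; have := hI (htw _ n.+1%:R sphi).
  rewrite (@eq_cintegral _ _ _ (fun x => H x * phi x * (x ^+ n)%:C)); last first.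
    by move=> x; rewrite /= in_itv /= andbT => x_0; rewrite twE// mulrA.
  move=> ->; apply: eq_cintegral => x; rewrite /= in_itv /= andbT => x_0.
  by rewrite /slash_test twE ?invr_gt0//; ring.
- by apply: ccontM cphi; exact: cH.
- rewrite (_ : (fun x => _) = (fun x => K x^-1 * ((x^-1 `^ (k - 2))%:C * chi SL2ZS * phi x))).
    apply: ccontM; first by apply: ccont_inv => //; exact: cK.
    apply: ccontM cphi; apply: ccontM; last exact: ccont_cst.
    by apply: (@ccont_inv (fun y => (y `^ (k - 2))%:C)) => //; exact: ccont_powR.
  by apply/funext => x; rewrite /slash_test invrK.
Qed.

(** A test function nonzero at [y] may jump there. On the smooth piece containing [y], however, it
    is continuous and nonzero at interior points arbitrarily close to [y]; the defect [D] vanishes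
    at these points and is continuous at [y]. *)
Lemma functional_of_integrals y : 0 < y ->
  H y = chi SL2ZS * (y `^ (- k))%:C * K y^-1.
Proof.
move=> y0; suff : D y = 0.
  by rewrite /D => /eqP; rewrite subr_eq0 => /eqP ->; rewrite mulrC.
have cD : ccont D y.
  apply: ccontD; first exact: cH.
  apply: ccontN; apply: ccontM.
    by apply: ccont_inv => //; apply: cK; rewrite invr_gt0.
  by apply: ccontM; [exact: ccont_cst|exact: ccont_powR].
apply: cabs_le0_eq => e e0.
have [hcs _ /(_ y y0) [phi sphi phi0]] := hSc.
have [_ [N [I [g [h [hs hnd hcov hgh]]]]]] := hcs _ sphi.
have [i yi] := hcov y y0.
pose F x := g i x +i* h i x.
have cF x : ccont F x.
  by split; apply: smooth_continuous; [exact: (hs i).1|exact: (hs i).2].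
have Fy : F y != 0 by rewrite /F -hgh.
have [z zi zy] : exists2 z, z \in I i & z != y.
  have [x1 [x2 [x12 i1 i2]]] := hnd i.
  have [e1|] := eqVneq x1 y; last by exists x1.
  by exists x2 => //; rewrite -e1 gt_eqF.
have [d1 d10 hd1] := ccont_dist cD e0.
have F0 : 0 < cabs (F y) by rewrite lt_neqAle cabs_ge0 eq_sym cabs_eq0 Fy.
have [d2 d20 hd2] := ccont_dist (cF y) F0.
have key x l u : 0 < x -> l < x < u -> (forall t, l < t < u -> 0 < t /\ t \in I i) ->
    `|x - y| < d1 -> `|x - y| < d2 -> cabs (D y) < e.
  move=> x0 lxu hlu x1 x2.
  have xI := (hlu x lxu).2.
  have Dx : D x = 0.
    apply: (D_at sphi x0).
      rewrite (hgh i)// -/(F x); apply/eqP => Fx.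
      by have := hd2 x x2; rewrite Fx sub0r cabsN ltxx.
    apply: (ccont_near lxu _ (cF x)) => t /hlu [t0 ti].
    by rewrite (hgh i).
  by have := hd1 x x1; rewrite Dx sub0r cabsN.
have conv (s t : R) : s \in I i -> t \in I i -> forall w, s <= w <= t -> w \in I i.
  by move=> si ti w hw; exact: (@interval_is_interval R (I i) s t si ti w hw).
have [yz|zy'] := ltP y z.
  pose x := y + Num.min (Num.min d1 d2) (z - y) / 2.
  have m0 : 0 < Num.min (Num.min d1 d2) (z - y) by rewrite !lt_min d10 d20 subr_gt0.
  have m2 : Num.min (Num.min d1 d2) (z - y) / 2 < Num.min (Num.min d1 d2) (z - y).
    by rewrite ltr_pdivrMr// ltr_pMr// ltr1n.
  have xy : `|x - y| < Num.min (Num.min d1 d2) (z - y).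
    by rewrite /x addrAC subrr add0r gtr0_norm// divr_gt0.
  move: (xy); rewrite !lt_min => /andP[/andP[xd1 xd2] xz].
  have yx : y < x by rewrite /x ltrDl divr_gt0.
  apply: (key x y z) => //; first exact: lt_trans yx.
    by rewrite yx /=; move: xz; rewrite gtr0_norm ?subr_gt0// ltrD2r.
  move=> t /andP[yt tz]; split; first exact: lt_trans yt.
  by apply: (conv y z) => //; rewrite !ltW.
have {}zy : z < y by rewrite lt_neqAle zy.
(* When the piece extends to the left of [y], it is cut at [0] to stay on the positive axis. *)
pose w := Num.max z 0; have wy : w < y by rewrite gt_max zy.
pose x := y - Num.min (Num.min d1 d2) (y - w) / 2.
have m0 : 0 < Num.min (Num.min d1 d2) (y - w) by rewrite !lt_min d10 d20 subr_gt0.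
have m2 : Num.min (Num.min d1 d2) (y - w) / 2 < Num.min (Num.min d1 d2) (y - w).
  by rewrite ltr_pdivrMr// ltr_pMr// ltr1n.
have xy : `|x - y| < Num.min (Num.min d1 d2) (y - w).
  by rewrite /x addrAC subrr add0r normrN gtr0_norm// divr_gt0.
move: (xy); rewrite !lt_min => /andP[/andP[xd1 xd2] xz].
have yx : x < y by rewrite /x gtrBl divr_gt0.
have wx : w < x by move: xz; rewrite ltr0_norm ?subr_lt0// opprB ltrD2l ltrN2.
have w0 : 0 <= w by rewrite le_max lexx orbT.
apply: (key x w y) => //; first exact: le_lt_trans wx.
  by rewrite wx.
move=> t /andP[wt ty]; split; first exact: le_lt_trans wt.
apply: (conv z y) => //; rewrite (ltW ty) andbT ltW//; apply: le_lt_trans wt.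
by rewrite le_max lexx.
Qed.

End Functional.
End Orthogonality.

(** * Symmetry on the upper half-plane *)

Section StripSymmetry.
Variable R : realType.
Implicit Types (z zeta tau p q : R[i]) (F : R[i] -> R[i]).

(** For the derivative entering [unique_continuation] only differentiability matters, so its own
    Wirtinger derivatives may stay unnamed. *)
Definition hasq F z := exists p q, qdiff F z p q.

Lemma hasqD F1 F2 z : hasq F1 z -> hasq F2 z -> hasq (fun z => F1 z + F2 z) z.
Proof. by move=> [p [q h]] [p' [q' h']]; exists (p + p'), (q + q'); exact: qdiffD. Qed.

Lemma hasqM F1 F2 z : hasq F1 z -> hasq F2 z -> hasq (fun z => F1 z * F2 z) z.
Proof. by move=> [p [q h]] [p' [q' h']]; eexists; eexists; exact: qdiffM h h'. Qed.

Lemma hasq_cst c z : hasq (fun=> c) z.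
Proof. by exists 0, 0; exact: qdiff_cst. Qed.

Lemma hasq_comp F1 F2 z : hasq F2 z -> hasq F1 (F2 z) -> hasq (fun z => F1 (F2 z)) z.
Proof. by move=> [p [q h]] [p' [q' h']]; eexists; eexists; exact: qdiff_comp h h'. Qed.

Lemma hasq_sum (I : Type) (s : seq I) (F : I -> R[i] -> R[i]) z :
  (forall i, hasq (F i) z) -> hasq (fun z => \sum_(i <- s) F i z) z.
Proof.
move=> h; have [p hp] := choice h; have [q hq] := choice hp.
by eexists; eexists; exact: qdiff_sum hq.
Qed.

Lemma qdiff_opp z : qdiff (fun z => - z) z (-1) 0.
Proof. by have := qdiffN (qdiff_id z); rewrite oppr0. Qed.

Lemma hasq_opp z : hasq (fun z => - z) z.
Proof. by exists (-1), 0; exact: qdiff_opp. Qed.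

Lemma qdiff_Im_powR (s : R) tau : 0 < Im tau ->
  qdiff (fun z => (Im z `^ s)%:C) tau ((s * Im tau `^ (s - 1))%:C / (2 * 'i%C))
    (- ((s * Im tau `^ (s - 1))%:C / (2 * 'i%C))).
Proof.
move=> v0; have [r [b [B [r0 _ h]]]] := ps_powR s v0.
have <- : b 1%N = (s * Im tau `^ (s - 1))%:C.
  apply: ps_real_coef1 r0 h _.
  have v0' : 0 < Im tau + 0 by rewrite addr0.
  have lin : is_derive (0 : R) 1 (fun y => Im tau + y) 1.
    apply: (@quad_is_derive _ _ _ _ 1 0) => // h' _.
    by rewrite (_ : _ - _ = 0) ?normr0 ?mul0r//; ring.
  have := @is_derive1_comp _ (fun x => x `^ s) (fun y => Im tau + y) _ _ _ (is_derive1_powR s v0') lin.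
  by rewrite addr0 mulr1.
apply: qdiff_shift; apply: qdiff_ext (qdiff_ps_Im r0 h) => z.
by rewrite ImD.
Qed.

Lemma hasq_Im_powR (s : R) tau : 0 < Im tau -> hasq (fun z => (Im z `^ s)%:C) tau.
Proof. by move=> v0; eexists; eexists; exact: qdiff_Im_powR. Qed.

Lemma qdiff_cexpZ (a : R[i]) z : qdiff (fun z => cexp (a * z)) z (a * cexp (a * z)) 0.
Proof.
have := qdiff_comp (qdiffZ a (qdiff_id z)) (qdiff_cexp (a * z)).
by rewrite mulr1 !mulr0 conjc_0 ?mulr0 mul0r !addr0 mulrC.
Qed.

Definition ei zeta : R[i] := 'i%C * cexp zeta.

Lemma qdiff_ei z : qdiff ei z (ei z) 0.
Proof. by have := qdiffZ 'i%C (qdiff_cexp z); rewrite mulr0. Qed.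

Lemma Im_ei z : Im (ei z) = expR (Re z) * cos (Im z).
Proof. by rewrite /ei ImM Re_cexp /= mul0r mul1r add0r. Qed.

Lemma ei_upper z : strip z -> 0 < Im (ei z).
Proof. by move=> /andP[h1 h2]; rewrite Im_ei mulr_gt0 ?expR_gt0// cos_gt0_pihalf// h1. Qed.

(** Reflection of the half-plane in the imaginary axis is complex conjugation in the strip; hence
    [G(- conj tau)] becomes a function of [conj zeta]. *)
Lemma ei_conj z : - (ei z)^*%C = ei z^*%C.
Proof. by rewrite /ei conjcM conjci cexp_conj mulNr opprK. Qed.

Lemma strip_conj z : strip z -> strip z^*%C.
Proof. by case: z => a b; rewrite /strip /= => /andP[h1 h2]; rewrite ltrNl opprK h2 ltrNl h1. Qed.

Lemma strip_opp z : strip z -> strip (- z).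
Proof. by rewrite /strip ImN => /andP[h1 h2]; rewrite ltrNl opprK h2 ltrNl h1. Qed.

Lemma strip_real (x : R) : strip x%:C.
Proof. by rewrite /strip /= oppr_lt0 divr_gt0 ?pi_gt0. Qed.

Section Data.
(** Here [P j] is the derivative of [f j] in [u], and [G j], with derivative [G1 j], is the
    holomorphic function through which the conjugate derivative of [f j] is expressed. The
    continuation argument sees the Fourier series only through these properties. *)
Variables (m : nat) (k : R) (f P G G1 : 'I_m -> R[i] -> R[i]) (A : 'M[R[i]]_m).
Hypothesis hf : forall j tau, 0 < Im tau ->
  let g := (Im tau `^ (- k))%:C * G j (- tau^*%C) in
  qdiff (f j) tau (P j tau + 'i%C / 2 * g) (- ('i%C / 2) * g).
Hypothesis hP : forall j tau, 0 < Im tau -> hasq (P j) tau.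
Hypothesis hG : forall j tau, 0 < Im tau -> qdiff (G j) tau (G1 j tau) 0.
Hypothesis hG1 : forall j tau, 0 < Im tau -> hasq (G1 j) tau.

Let iy (y : R) : R[i] := 0 +i* y.
(** This is [delta_k f] at [tau = iy], since [P] is the derivative in [u]. *)
Let g j (y : R) := (k / 2)%:C * f j (iy y) + P j (iy y) * iy y.
Hypothesis f_inv : forall j y, 0 < y ->
  f j (iy y) = \sum_i A j i * ((y `^ (- k))%:C * f i (iy y^-1)).
Hypothesis g_inv : forall j y, 0 < y ->
  g j y = - \sum_i A j i * ((y `^ (- k))%:C * g i y^-1).

Let kh : R[i] := (k / 2)%:C.
Let kc : R[i] := (1 - k / 2)%:C.
Let W j zeta := cexp (kh * zeta) * f j (ei zeta).
(** The analogue of [W] in the dual weight [2 - k], since [kc = (2 - k)/2]. *)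
Let V j zeta := cexp (kc * zeta) * G j (ei zeta).
Let V1 j zeta := kc * V j zeta + cexp (kc * zeta) * G1 j (ei zeta) * ei zeta.
Let pW j zeta := kh * W j zeta + cexp (kh * zeta) *
  (P j (ei zeta) + 'i%C / 2 * ((Im (ei zeta) `^ (- k))%:C * G j (- (ei zeta)^*%C))) * ei zeta.
Let qW j zeta := - 2^-1 * (cos (Im zeta) `^ (- k))%:C * V j zeta^*%C.

Let i2 : 'i%C * 'i%C = -1 :> R[i]. Proof. exact: ic_ic. Qed.

Let Wq j zeta : strip zeta -> qdiff (W j) zeta (pW j zeta) (qW j zeta).
Proof.
move=> sz; have v0 := ei_upper sz.
have := qdiffM (qdiff_cexpZ kh zeta) (qdiff_comp (qdiff_ei zeta) (hf j v0)).
rewrite conjc_0 !mulr0 !addr0 mul0r !add0r.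
set p := (X in qdiff _ _ X _); set q := (X in qdiff _ _ _ X).
have -> : p = pW j zeta by rewrite /p /pW /W; ring.
have -> : q = qW j zeta; last by [].
rewrite /q /qW ei_conj /V.
have -> : (ei zeta)^*%C = - 'i%C * cexp zeta^*%C.
  by rewrite mulNr -[LHS]opprK ei_conj.
(* [Im (i e^zeta) = e^(Re zeta) cos(Im zeta)] and [k zeta/2 - k Re zeta = - k conj(zeta)/2]: apart
   from the cosine everything depends on [conj zeta] only. *)
have E : cexp (kh * zeta) * (Im (ei zeta) `^ (- k))%:C * cexp zeta^*%C =
    (cos (Im zeta) `^ (- k))%:C * cexp (kc * zeta^*%C).
  have c0 : 0 < cos (Im zeta) by apply: cos_gt0_pihalf.
  rewrite Im_ei powRM ?expR_ge0 ?ltW// -expRM realcM -cexp_real.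
  rewrite mulrA (mulrAC _ _ (cexp zeta^*%C)) -!cexpD mulrC; congr (_ * cexp _).
  rewrite /kh /kc; case: (zeta) => s t.
  by apply: complex_ext; rewrite !(ReD, ImD, ReM, ImM) /=; field.
transitivity (('i%C * 'i%C) / 2 * (cexp (kh * zeta) * (Im (ei zeta) `^ (- k))%:C * cexp zeta^*%C) * G j (ei zeta^*%C)).
  by ring.
by rewrite E i2; ring.
Qed.

Let Vq j zeta : strip zeta -> qdiff (V j) zeta (V1 j zeta) 0.
Proof.
move=> sz; have v0 := ei_upper sz.
have := qdiffM (qdiff_cexpZ kc zeta) (qdiff_comp (qdiff_ei zeta) (hG j v0)).
rewrite conjc_0 !(mulr0, mul0r, addr0).
by set p := (X in qdiff _ _ X _); have -> : p = V1 j zeta by rewrite /p /V1 /V; ring.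
Qed.

Let hasq_ei z : hasq ei z. Proof. by exists (ei z), 0; exact: qdiff_ei. Qed.

Let V1q j zeta : strip zeta -> hasq (V1 j) zeta.
Proof.
move=> sz; apply: hasqD.
  apply: hasqM; first exact: hasq_cst.
  by exists (V1 j zeta), 0; exact: Vq.
apply: hasqM => //; apply: hasqM; last by apply: hasq_comp => //; exact: hG1 (ei_upper sz).
by eexists; eexists; exact: qdiff_cexpZ.
Qed.

Let pWq j zeta : strip zeta -> hasq (pW j) zeta.
Proof.
move=> sz; have v0 := ei_upper sz; apply: hasqD.
  apply: hasqM; first exact: hasq_cst.
  by exists (pW j zeta), (qW j zeta); exact: Wq.
apply: hasqM => //; apply: hasqM; first by eexists; eexists; exact: qdiff_cexpZ.
apply: hasqD; first by apply: hasq_comp => //; exact: hP.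
apply: hasqM; first exact: hasq_cst.
apply: hasqM; first by apply: (@hasq_comp (fun z => (Im z `^ (- k))%:C)) => //; exact: hasq_Im_powR.
apply: (@hasq_comp (G j) (fun z => - (ei z)^*%C)).
  apply: (@hasq_comp (fun z => - z) (fun z => (ei z)^*%C)); last exact: hasq_opp.
  apply: (@hasq_comp (fun z => z^*%C)) => //.
  by exists 0, 1; exact: qdiff_conj.
rewrite ei_conj; exists (G1 j (ei zeta^*%C)), 0; apply: hG.
exact: ei_upper (strip_conj sz).
Qed.

Let eiR (x : R) : ei x%:C = iy (expR x).
Proof. by rewrite /ei cexp_real /iy; apply: complex_ext; rewrite ?ReM ?ImM /=; ring. Qed.

Let flip (F p q : 'I_m -> R[i] -> R[i]) j zeta : (forall i, qdiff (F i) (- zeta) (p i (- zeta)) (q i (- zeta))) ->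
  qdiff (fun z => \sum_i A j i * F i (- z)) zeta (- \sum_i A j i * p i (- zeta))
    (- \sum_i A j i * q i (- zeta)).
Proof.
move=> h; rewrite -!sumrN; apply: qdiff_sum => i.
have := qdiffZ (A j i) (qdiff_comp (qdiff_opp zeta) (h i)).
by rewrite conjc_0 !mulr0 !add0r addr0 conjcN conjc1 !mulrN1 !mulrN.
Qed.

Let W_real j (x : R) : W j x%:C = \sum_i A j i * W i (- x%:C).
Proof.
rewrite /W eiR (f_inv j (expR_gt0 x)) mulr_sumr; apply: eq_bigr => i _.
rewrite -realcN eiR expRN mulrCA; congr (_ * _); rewrite mulrA; congr (_ * _).
rewrite -expRM -!realcM !cexp_real -realcM -expRD; congr (expR _)%:C; by field.
Qed.

Let Z j (x : R) := cexp (kh * x%:C) * g j (expR x).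

Let Z_real j (x : R) : Z j x = - \sum_i A j i * Z i (- x).
Proof.
rewrite /Z (g_inv j (expR_gt0 x)) mulrN mulr_sumr; congr (- _); apply: eq_bigr => i _.
rewrite expRN mulrCA; congr (_ * _); rewrite mulrA; congr (_ * _).
rewrite -expRM -!realcM !cexp_real -realcM -expRD; congr (expR _)%:C; by field.
Qed.

(** On the real line the two Wirtinger derivatives add up to [W']. Each of them contributes half of
    [- V], and what remains is [delta_k f] at [i e^x], weighted by [e^(kx/2)]. *)
Let pqW_real j (x : R) : pW j x%:C + qW j x%:C = Z j x - V j x%:C.
Proof.
rewrite /pW /qW /Z /g /W /V ei_conj conjc_real eiR /= cos0 powR1 mulr1.
have -> : cexp (kc * x%:C) = cexp (kh * x%:C) * (expR x `^ (- k))%:C * (expR x)%:C.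
  by rewrite -expRM -!realcM !cexp_real -!realcM -!expRD; congr (expR _)%:C; field.
have -> : iy (expR x) = 'i%C * (expR x)%:C.
  by apply: complex_ext; rewrite ?ReM ?ImM /=; ring.
rewrite -/kh; set a := f j _; set b := P j _; set c := G j _; set d := cexp _.
set e := (_ `^ _)%:C; set h := (expR x)%:C.
transitivity (kh * (d * a) + d * b * ('i%C * h) + ('i%C * 'i%C) / 2 * (d * e * h * c) - (d * e * h * c) / 2).
  by ring.
by rewrite i2; field.
Qed.

(** Compares the antisymmetry of [Z] with that of [W' = Z - V], the latter being the derivative of
    [W_real]. *)
Let V_real j (x : R) : V j x%:C = - \sum_i A j i * V i (- x%:C).
Proof.
have sx := strip_real x; have sNx := strip_opp sx.
have h1 := Wq j sx; have h2 := flip j (fun i => Wq i sNx).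
have := qdiff_real_line h1 h2 (fun t => _).
rewrite pqW_real -realcN => E.
have {}E : Z j x - V j x%:C = - \sum_i A j i * (Z i (- x) - V i (- x)%:C).
  rewrite E; first by rewrite -opprD -big_split /=; congr (- _); apply: eq_bigr => i _; rewrite -mulrDr pqW_real.
  by move=> t; rewrite -realcD W_real.
move: E; rewrite Z_real => E.
have -> : V j x%:C = - \sum_i A j i * Z i (- x) - (- \sum_i A j i * (Z i (- x) - V i (- x)%:C)).
  by rewrite -E; ring.
rewrite opprK -[- _ + _]addrC -sumrB -sumrN; apply: eq_bigr => i _; ring.
Qed.

Let V_strip j zeta : strip zeta -> V j zeta = - \sum_i A j i * V i (- zeta).
Proof.
move=> sz; apply/eqP; rewrite -addr_eq0; apply/eqP.
apply: (@unique_continuation R (fun z => V j z + \sum_i A j i * V i (- z))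
  (fun z => V1 j z + - \sum_i A j i * V1 i (- z))) sz.
- move=> z sz; have := qdiffD (Vq j sz) (flip (q := fun _ _ => 0) j (fun i => Vq i (strip_opp sz))).
  rewrite (_ : 0 + - _ = 0)//; rewrite big1 ?oppr0 ?addr0// => i _; exact: mulr0.
- move=> z sz; apply: hasqD; first exact: V1q.
  apply: (@hasq_comp (fun z => - z)); last exact: hasq_opp.
  apply: hasq_sum => i; apply: hasqM; first exact: hasq_cst.
  by apply: (@hasq_comp (V1 i)); [exact: hasq_opp|apply: V1q; exact: strip_opp].
- by move=> x; rewrite V_real addNr.
Qed.

Lemma strip_symmetry j zeta : strip zeta ->
  cexp (kh * zeta) * f j (ei zeta) = \sum_i A j i * (cexp (kh * - zeta) * f i (ei (- zeta))).
Proof.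
move=> sz; apply/eqP; rewrite -subr_eq0; apply/eqP.
apply: (@unique_continuation R (fun z => W j z - \sum_i A j i * W i (- z))
  (fun z => pW j z - - \sum_i A j i * pW i (- z))) sz.
(* The conjugate derivatives cancel by [V_strip] at [conj z], because the cosine factor is even. *)
- move=> z sz; have := qdiffB (Wq j sz) (flip j (fun i => Wq i (strip_opp sz))).
  rewrite (_ : qW j z - - _ = 0)// opprK /qW (V_strip j (strip_conj sz)).
  rewrite mulrN -mulNr !mulr_sumr -big_split big1//= => i _.
  rewrite conjcN ImN cosN; ring.
- move=> z sz; apply: hasqD; first exact: pWq.
  apply: (@hasq_comp (fun z => - z)); last exact: hasq_opp.
  apply: (@hasq_comp (fun z => - z)); last exact: hasq_opp.
  apply: hasq_sum => i; apply: hasqM; first exact: hasq_cst.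
  by apply: (@hasq_comp (pW i)); [exact: hasq_opp|apply: pWq; exact: strip_opp].
- by move=> x; rewrite W_real subrr.
Qed.

End Data.
End StripSymmetry.

(** * Invariance of the Fourier series *)

Section Assembly.
Variable R : realType.
Implicit Types (c : nat -> R[i]) (tau : R[i]).

Lemma normcE (z : R[i]) : `|z| = (cabs z)%:C.
Proof. by []. Qed.

(** Completing the square, [C sqrt n <= e n + C^2/(4e)]. The offset [b] compares [|idx l|] with [l],
    and the finitely many [l] below [N + b] are absorbed by the sum of their moduli. *)
Lemma subexp_of_growth (C : R) (D : set int) (c : int -> R[i]) (idx : nat -> int) (b : nat) :
  0 < C -> exp_sqrt_growth C D c -> (forall l, D (idx l)) ->
  (forall l, (absz (idx l) <= l + b)%N) -> (forall l, (l <= absz (idx l) + b)%N) ->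
  subexp (fun l => c (idx l)).
Proof.
move=> C0 [A [N hA]] hD h1 h2 e e0.
exists (`|A| * expR (e * b%:R + C ^+ 2 / (4 * e)) + \sum_(0 <= l < N + b) cabs (c (idx l))) => l.
rewrite mulrDl; have el : 1 <= expR (e * l%:R) by rewrite -expR0 ler_expR mulr_ge0// ltW.
have s0 : 0 <= \sum_(0 <= l < N + b) cabs (c (idx l)) by apply: sumr_ge0 => ? _; exact: cabs_ge0.
have [lN|Nl] := ltnP l (N + b).
  apply: ler_wpDl; first by rewrite !mulr_ge0 ?expR_ge0.
  apply: (@le_trans _ _ (\sum_(0 <= l < N + b) cabs (c (idx l)))); last by rewrite ler_peMr.
  rewrite (bigD1_seq l) ?mem_index_iota ?iota_uniq//= lerDl.
  by apply: sumr_ge0 => ? _; exact: cabs_ge0.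
apply: ler_wpDr; first by rewrite mulr_ge0// expR_ge0.
have := hA _ (hD l) _; rewrite -(leq_add2r b) => /(_ (leq_trans Nl (h2 l))).
rewrite normcE lecR => /le_trans; apply.
rewrite -mulrA -expRD.
apply: (@le_trans _ _ (`|A| * expR (C * Num.sqrt (absz (idx l))%:R))).
  by rewrite ler_wpM2r ?expR_ge0 ?ler_norm.
rewrite ler_wpM2l//.
  rewrite ler_expR; set n := absz _.
  have nl : n%:R <= l%:R + b%:R :> R by rewrite -natrD ler_nat; exact: h1.
  have sq : Num.sqrt n%:R ^+ 2 = n%:R :> R by rewrite sqr_sqrtr.
  have : 0 <= e * (Num.sqrt n%:R - C / (2 * e)) ^+ 2 by rewrite mulr_ge0 ?sqr_ge0// ltW.
  have -> : e * (Num.sqrt n%:R - C / (2 * e)) ^+ 2 = e * n%:R - C * Num.sqrt n%:R + C ^+ 2 / (4 * e).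
    by move: sq; move: (Num.sqrt n%:R) => t <-; field; rewrite gt_eqF.
  have : e * n%:R <= e * (l%:R + b%:R) by rewrite ler_wpM2l// ltW.
  rewrite mulrDr; move: (e * n%:R) (e * l%:R) (e * b%:R) (C ^+ 2 / (4 * e)) (C * _) => *; lra.
Qed.

Lemma eseries_has_sum beta c tau : subexp c -> 0 < Im tau ->
  has_sum (eterm beta c tau) (eseries beta c tau).
Proof. by move=> hc v0; have [? [? [? [_ _ _ _]]]] := eseries_dps beta hc v0. Qed.

Lemma nseries_has_sum k beta c tau : 0 < beta -> subexp c -> 0 < Im tau ->
  has_sum (nterm k beta c tau) (nseries k beta c tau).
Proof. by move=> b0 hc v0; have [? [? [? [_ _ _ _]]]] := nseries_dps k b0 hc v0. Qed.

Lemma eseriesZ beta c a tau : subexp c -> 0 < Im tau ->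
  eseries beta (fun l => a * c l) tau = a * eseries beta c tau.
Proof.
move=> hc v0; apply: has_sum_cseries; apply: has_sum_ext (has_sumZ a (eseries_has_sum beta hc v0)) => l.
by rewrite /eterm mulrA.
Qed.

Lemma nseriesZ k beta c a tau : 0 < beta -> subexp c -> 0 < Im tau ->
  nseries k beta (fun l => a * c l) tau = a * nseries k beta c tau.
Proof.
move=> b0 hc v0; apply: has_sum_cseries.
apply: has_sum_ext (has_sumZ a (nseries_has_sum k b0 hc v0)) => l.
by rewrite /nterm !mulrA.
Qed.

Lemma qdiff_ccont F tau p q (x : R) : tau = 0 +i* x -> qdiff F tau p q -> ccont (fun y => F (0 +i* y)) x.
Proof.
move=> -> h.
have [|h1 h2] := qdiff_is_derive (g := fun y => F (0 +i* y)) (x := x) h (cabs_i R) _.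
  by move=> t; congr F; apply: complex_ext; rewrite !(ReD, ImD, ReM, ImM) /=; ring.
split; apply: differentiable_continuous; apply/derivable1_diffP.
  by have [] := h1.
by have [] := h2.
Qed.

Lemma cexp_2piz (n : int) : cexp ((n%:~R * (2 * pi))%:C * 'i%C) = 1 :> R[i].
Proof.
have e1 : cexp ((2 * pi)%:C * 'i%C) = 1 :> R[i].
  apply: complex_ext; rewrite ?Re_cexp ?Im_cexp !(ReM, ImM) /= !(mulr0, mul0r, mulr1, subr0, addr0) expR0 mul1r.
    by rewrite mulr_natl cos2pi.
  by rewrite mulr_natl sin2pi.
have en (p : nat) : cexp ((p%:R * (2 * pi))%:C * 'i%C) = 1 :> R[i].
  by rewrite realcM realc_nat -mulrA cexpMn e1 expr1n.
case: (intP n) => [|p|p]; first exact: (en 0%N); first exact: (en p.+1).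
by rewrite mulrNz mulNr realcN mulNr cexpN (en p.+1) invr1.
Qed.

Section Main.
Variables (k : R) (chi : SL2Z -> R[i]) (m : nat) (rho : SL2Z -> 'M[R[i]]_m)
  (kappa : 'I_m -> R) (Sc : set (R -> R[i])) (n0 : int) (cp cm : 'I_m -> int -> R[i]).
Hypothesis hchi : unitary_multiplier k chi.
Hypothesis hrho : unitary_representation rho.
Hypothesis kappa1 : forall j, kappa j < 1.
Hypothesis hkappa : forall j, chi SL2ZT *: (rho SL2ZT *m delta_mx j 0) =
  cexp ((2 * pi * kappa j)%:C * 'i%C) *: (delta_mx j 0 : 'cV[R[i]]_m).
Hypothesis hSc : test_functions Sc.
Hypothesis subp : forall j, subexp (fun l => cp j (pos_index n0 l)).
Hypothesis subm : forall j, subexp (fun l => cm j (neg_index l)).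
Hypothesis hL : forall phi, Sc phi ->
  Lseries k kappa n0 cp cm phi =
  cpow 'i%C k *: (rho SL2ZS *m Lseries k kappa n0 cp cm (slash_test k chi phi)).
Hypothesis hLdelta : forall phi, Sc phi ->
  Lseries_delta k kappa n0 cp cm phi =
  - cpow 'i%C k *: (rho SL2ZS *m Lseries_delta k kappa n0 cp cm (slash_test k chi phi)).

Let bp := hpos kappa n0.
Let bn := hneg kappa.
Let c := cpos n0 cp.
Let d := cneg cm.
Let bn0 j : 0 < bn j. Proof. exact: hneg_gt0. Qed.

Let ff j tau := eseries (bp j) (c j) tau + nseries k (bn j) (d j) tau.

Let fourierE tau j : fourier_fun k kappa n0 cp cm tau j 0 = ff j tau.
Proof.
rewrite mxE; congr (cseries _ + cseries _); apply/funext => l.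
  by rewrite /holo_term /e2pi /eterm freq_pos.
rewrite /nonholo_term /e2pi /nterm freq_neg; congr (_ * (incomplete_gamma _ _)%:C * cexp (_%:C * _ * _)); rewrite /bn; ring.
Qed.

Let fourier_funE j : (fun tau => fourier_fun k kappa n0 cp cm tau j 0) = ff j.
Proof. by apply/funext => tau; exact: fourierE. Qed.

Let d2 j l := d j l * (2 * pi * (l%:R + bn j))%:C.
Let c2 j l := c j l * ((2 * pi)%:C * 'i%C * (l%:R + bp j)%:C).
(** The coefficients of [G], read off from the contribution of the gamma factor in
    [nseries_qdiff]. *)
Let dG j l := d j l * ((4 * pi * (l%:R + bn j)) `^ (1 - k))%:C.

Let sub_c2 j : subexp (c2 j).
Proof.
apply: subexpM (subp j) _; apply: subexpM; first exact: subexp_cst.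
exact: subexp_linear.
Qed.

Let sub_d2 j : subexp (d2 j).
Proof.
apply: subexpM (subm j) _ => e /(subexpM (subexp_cst (2 * pi)%:C) (subexp_linear (bn j))).
by move=> [A hA]; exists A => l; have := hA l; rewrite -realcM.
Qed.

Let sub_dG j : subexp (dG j).
Proof. by apply: subexpM (subm j) _; apply: subexp_powR => //; rewrite mulr_gt0 ?pi_gt0. Qed.

Let G j := eseries (bn j) (dG j).
(** The derivative of [ff j] in [u], being the sum of the two Wirtinger derivatives in [ffq]. *)
Let P j tau := eseries (bp j) (c2 j) tau - 'i%C * nseries k (bn j) (d2 j) tau.

Let ffq j tau : 0 < Im tau ->
  let g := (Im tau `^ (- k))%:C * G j (- tau^*%C) in
  qdiff (ff j) tau (P j tau + 'i%C / 2 * g) (- ('i%C / 2) * g).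
Proof.
move=> v0 g; have := qdiffD (eseries_qdiff (bp j) (subp j) v0) (nseries_qdiff k (bn0 j) (subm j) v0).
by rewrite add0r addrA mulNr.
Qed.

Let Gq j tau : 0 < Im tau -> qdiff (G j) tau
  (eseries (bn j) (fun l => dG j l * ((2 * pi)%:C * 'i%C * (l%:R + bn j)%:C)) tau) 0.
Proof. exact: eseries_qdiff. Qed.

Let real_analytic j tau : 0 < Im tau ->
  real_analytic_at (fun u v => Re (ff j (u +i* v))) (Re tau) (Im tau) /\
  real_analytic_at (fun u v => Im (ff j (u +i* v))) (Re tau) (Im tau).
Proof.
move=> v0; have [r1 [a1 [M1 [r10 _ h1 _ _]]]] := eseries_dps (bp j) (subp j) v0.
have [r2 [a2 [M2 [r20 _ h2 _ _]]]] := nseries_dps k (bn0 j) (subm j) v0.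
pose r := Num.min r1 r2; have r0 : 0 < r by rewrite lt_min r10.
have rr1 : r <= r1 by rewrite ge_min lexx.
have rr2 : r <= r2 by rewrite ge_min lexx orbT.
exact: dps_real_analytic r0 (dps_add (dps_sub (ltW r0) rr1 h1) (dps_sub (ltW r0) rr2 h2)).
Qed.

Let qconj tau : 0 < Im tau -> 0 < Im (- tau^*%C).
Proof. by case: tau => a b /=; rewrite opprK. Qed.

(** Since [G(- conj tau)] is antiholomorphic, the derivative in [tau] of the conjugate derivative
    falls on [v^(-k)] only; its factor [-k v^(-k-1)/(2i)], multiplied by [-4v^2], cancels against
    the first order term of [Delta]. *)
Let Delta0 j tau : 0 < Im tau -> Delta k (ff j) tau = 0.
Proof.
move=> v0; pose Q z := - ('i%C / 2) * ((Im z `^ (- k))%:C * G j (- z^*%C)).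
have tb z : 0 < Im z -> partial_taubar (ff j) z = Q z.
  by move=> z0; exact: qdiff_partial_taubar (ffq j z0).
have qc : qdiff (fun z => - z^*%C) tau 0 (-1).
  by have := qdiffN (qdiff_conj tau); rewrite oppr0.
have := qdiffZ (- ('i%C / 2)) (qdiffM (qdiff_Im_powR (- k) v0) (qdiff_comp qc (Gq j (qconj v0)))).
rewrite !mulr0 !mul0r !addr0; set p := (X in qdiff _ _ X _) => qQ.
(* The formula for the conjugate derivative is known only above the real axis; the disc of radius
   [Im tau] stays there. *)
have [q qt] : exists q, qdiff (partial_taubar (ff j)) tau p q.
  eexists; apply: qdiff_near v0 _ qQ => h hh; rewrite tb//.
  rewrite ImD -ltrBlDl sub0r; have := le_lt_trans (normr_Im_le h) hh.
  by rewrite ltr_norml => /andP[].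
rewrite /Delta (qdiff_partial_tau qt) tb// /p /Q.
set g := G j _; set v := Im tau.
have vk : (v `^ (- k))%:C = (v `^ (- k - 1))%:C * v%:C :> R[i].
  by rewrite -realcM -{3}[v]powRr1 ?ltW// -powRD ?subrK// (gt_eqF v0) implybT.
rewrite vk (realcM (- k)) realcN.
move: (v `^ (- k - 1))%:C v%:C k%:C => x y kk.
have n2 : 2 * 'i%C != 0 :> R[i] by rewrite mulf_neq0 ?pnatr_eq0 ?ic_neq0.
have -> : (2 * 'i%C)^-1 = - ('i%C / 2) :> R[i].
  apply: (mulIf n2); rewrite mulVf//; transitivity (- ('i%C * 'i%C) : R[i]); first by rewrite ic_ic opprK.
  by field.
by field.
Qed.

Let T_inv tau : 0 < Im tau ->
  slash k chi rho (fourier_fun k kappa n0 cp cm) SL2ZT tau = fourier_fun k kappa n0 cp cm tau.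
Proof.
move=> v0; rewrite /slash.
have -> : autj SL2ZT tau = 1 by rewrite /autj !mxE /= mul0r add0r.
rewrite cpow1 mul1r.
have -> : moebius SL2ZT tau = tau + 1.
  by rewrite /moebius /autj !mxE /= mul0r mul1r add0r divr1.
have v1 : 0 < Im (tau + 1) by rewrite ImD /= addr0.
have shift j : ff j (tau + 1) = cexp ((2 * pi * kappa j)%:C * 'i%C) * ff j tau.
  have sh (a : R) : cexp (a%:C * 'i%C * (tau + 1)) = cexp (a%:C * 'i%C) * cexp (a%:C * 'i%C * tau).
    by rewrite mulrDr mulr1 cexpD mulrC.
  (* All frequencies of the [j]-th component are congruent to [kappa_j] modulo [1], so
     [tau -> tau + 1] multiplies every term by the same constant. *)
  have fr (a : R) n : a = 2 * pi * freq kappa j n -> cexp (a%:C * 'i%C) = cexp ((2 * pi * kappa j)%:C * 'i%C).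
    move=> ->; rewrite /freq mulrDr realcD mulrDl cexpD.
    by rewrite (_ : 2 * pi * n%:~R = n%:~R * (2 * pi)) ?cexp_2piz ?mul1r//; ring.
  rewrite [RHS]mulrDr; congr (_ + _).
    apply: has_sum_cseries; apply: has_sum_ext (has_sumZ _ (eseries_has_sum (bp j) (subp j) v0)) => l.
    rewrite /eterm sh (fr _ (pos_index n0 l)) ?freq_pos//.
    by rewrite /c /cpos; ring.
  apply: has_sum_cseries; apply: has_sum_ext (has_sumZ _ (nseries_has_sum k (bn0 j) (subm j) v0)) => l.
  rewrite /nterm sh (fr _ (neg_index l)) ?freq_neg ?mulrN// ImD /= addr0.
  by rewrite /d /cneg; ring.
have E : fourier_fun k kappa n0 cp cm (tau + 1) =
    chi SL2ZT *: (rho SL2ZT *m fourier_fun k kappa n0 cp cm tau).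
  rewrite [X in _ *m X](_ : _ = \sum_j ff j tau *: (delta_mx j 0 : 'cV_m)); last first.
    apply/matrixP => i j; rewrite ord1 fourierE summxE (bigD1 i)//= !mxE !eqxx mulr1.
    by rewrite big1 ?addr0// => l li; rewrite !mxE (eq_sym i) (negbTE li) mulr0.
  rewrite mulmx_sumr scaler_sumr.
  apply/matrixP => i j; rewrite ord1 fourierE shift summxE (bigD1 i)//=.
  (* That constant is the eigenvalue of [chi(T) rho(T)] on the [l]-th basis vector. *)
  have H l : (chi SL2ZT *: (rho SL2ZT *m (ff l tau *: (delta_mx l 0 : 'cV_m)))) i 0 =
      ff l tau * (cexp ((2 * pi * kappa l)%:C * 'i%C) * (i == l)%:R).
    by rewrite -scalemxAr scalerA mulrC -scalerA hkappa !mxE eqxx andbT.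
  rewrite big1; last by move=> l li; rewrite H eq_sym (negbTE li) (mulr0 (cexp _)) (mulr0 (ff _ _)).
  by rewrite addr0 H eqxx mulr1 [RHS]mulrC.
rewrite E -scalemxAr scalerA (mulVf (chi_neq0 hchi _)) scale1r.
exact: (mulKmx (rho_unit hrho _)).
Qed.

Let A := (chi SL2ZS * cpow 'i%C k) *: rho SL2ZS.

Let P_iy j y : 0 < y -> P j (0 +i* y) = 'i%C * (2 * pi)%:C * dhfun k kappa n0 cp cm j y.
Proof.
move=> y0; have v0 : 0 < Im (0 +i* y : R[i]) by [].
have s1 : subexp (fun l => c j l * (l%:R + bp j)%:C).
  exact: subexpM (subp j) (subexp_linear _).
have s2 : subexp (fun l => d j l * (- (l%:R + bn j))%:C).
  apply: subexpM (subm j) _.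
  by move=> e /(subexp_linear (bn j)) [A' hA]; exists A' => l; rewrite realcN cabsN.
rewrite /dhfun mulrDr -/(c j) -/(d j) -/(bp j) -/(bn j); congr (_ + _).
  rewrite -(eseriesZ _ _ s1 v0).
  have -> // : c2 j = fun l => 'i%C * (2 * pi)%:C * (c j l * (l%:R + bp j)%:C).
  apply/funext => l; rewrite /c2.
  by move: (c j l) (l%:R + bp j)%:C (2 * pi)%:C => x y' z; ring.
have := nseriesZ k (2 * pi)%:C (bn0 j) s2 v0.
have := nseriesZ k (-1) (bn0 j) (sub_d2 j) v0.
have -> : (fun l => (2 * pi)%:C * (d j l * (- (l%:R + bn j))%:C)) = (fun l => -1 * d2 j l).
  apply/funext => l; rewrite /d2 realcN (realcM (2 * pi)).
  by move: (d j l) (l%:R + bn j)%:C (2 * pi)%:C => x y' z; ring.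
by move=> -> e; rewrite -[in RHS]mulrA -e; ring.
Qed.

Let hfunE j y : hfun k kappa n0 cp cm j y = ff j (0 +i* y). Proof. by []. Qed.

Let Pq j tau : 0 < Im tau -> hasq (P j) tau.
Proof.
move=> v0; rewrite /P.
have [p1 hp1] : exists p, qdiff (eseries (bp j) (c2 j)) tau p 0.
  by eexists; exact: eseries_qdiff (sub_c2 j) v0.
apply: hasqD; first by exists p1, 0.
have := qdiffZ (- 'i%C) (nseries_qdiff k (bn0 j) (sub_d2 j) v0).
set p := (X in qdiff _ _ X _); set q := (X in qdiff _ _ _ X) => h.
by exists p, q; apply: qdiff_ext h => z; rewrite mulNr.
Qed.

Let cont_hfun j x : 0 < x -> ccont (hfun k kappa n0 cp cm j) x.
Proof. by move=> x0; exact: (qdiff_ccont (F := ff j) erefl (ffq j (tau := 0 +i* x) x0)). Qed.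

Let cont_P j x : 0 < x -> ccont (fun y => P j (0 +i* y)) x.
Proof. by move=> x0; have [p [q h]] := @Pq j (0 +i* x) x0; exact: qdiff_ccont h. Qed.

Let nice_Sc phi : Sc phi -> nice phi.
Proof. by move=> s; have [hcs _ _] := hSc; have [h1 h2] := hcs _ s; exact: nice_of_pieces. Qed.

Let mpos : measurable (`]0, +oo[ : set R). Proof. exact: measurable_itv. Qed.

(** The scalar statement [functional_of_integrals] is applied to one component, the combination of
    all components by [i^k rho(S)] being put into its second function. *)
Let f_inv j y : 0 < y ->
  ff j (0 +i* y) = \sum_i A j i * ((y `^ (- k))%:C * ff i (0 +i* y^-1)).
Proof.
move=> y0; rewrite -hfunE.
rewrite (@functional_of_integrals _ k chi Sc (hfun k kappa n0 cp cm j)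
  (fun x => \sum_i cpow 'i%C k * rho SL2ZS j i * hfun k kappa n0 cp cm i x) hSc _ _ _ y y0).
- rewrite mulr_sumr; apply: eq_bigr => i _; rewrite /A mxE -hfunE; ring.
- exact: cont_hfun.
- move=> x x0; apply: ccont_sum => i; apply: ccontM; first exact: ccont_cst.
  exact: cont_hfun.
move=> phi sphi; have n1 := nice_Sc sphi; have n2 := nice_slash k chi n1.
have [_ e1] := LseriesE k kappa1 subp subm j n1; rewrite -e1.
rewrite (hL sphi) !mxE.
rewrite (@eq_cintegral _ _ _ (fun x => \sum_i cpow 'i%C k * rho SL2ZS j i *
   (hfun k kappa n0 cp cm i x * slash_test k chi phi x))); last first.
  by move=> x _; rewrite mulr_suml; apply: eq_bigr => i _; rewrite mulrA.
have [|_ ->] := @cint_sum _ _ (index_enum 'I_m) _ (fun i x => cpow 'i%C k * rho SL2ZS j i *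
   (hfun k kappa n0 cp cm i x * slash_test k chi phi x)) mpos.
  by move=> i; apply: cintZ mpos _; have [] := LseriesE k kappa1 subp subm i n2.
rewrite mulr_sumr; apply: eq_bigr => i _.
have [ci ->] := LseriesE k kappa1 subp subm i n2.
by rewrite (cintegralZ _ mpos ci) mulrA.
Qed.

Let Gq1 j tau : 0 < Im tau ->
  hasq (eseries (bn j) (fun l => dG j l * ((2 * pi)%:C * 'i%C * (l%:R + bn j)%:C))) tau.
Proof.
have s : subexp (fun l => dG j l * ((2 * pi)%:C * 'i%C * (l%:R + bn j)%:C)).
  apply: subexpM (sub_dG j) _; apply: subexpM; [exact: subexp_cst|exact: subexp_linear].
by move=> v0; eexists; eexists; exact: eseries_qdiff s v0.
Qed.

Let gfun j (y : R) := (k / 2)%:C * ff j (0 +i* y) + P j (0 +i* y) * (0 +i* y).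

Let gfun_integral phi j : nice phi ->
  cint `]0, +oo[ (fun x => gfun j x * phi x) /\
  Lseries_delta k kappa n0 cp cm phi j 0 = cintegral `]0, +oo[ (fun x => gfun j x * phi x).
Proof.
move=> hphi; have [i1 _] := LseriesE k kappa1 subp subm j hphi.
have [i2 ->] := Lseries_deltaE k kappa1 subp subm j hphi.
have E x : x \in `]0, +oo[ -> gfun j x * phi x =
    (k / 2)%:C * (hfun k kappa n0 cp cm j x * phi x) +
    - (2 * pi)%:C * (dhfun k kappa n0 cp cm j x * twist 2 phi x).
  rewrite in_itv /= andbT => x0; rewrite /gfun P_iy// -hfunE /twist.
  have -> : 2 - 1 = 1 :> R by ring.
  rewrite powRr1 ?ltW//.
  have -> : 0 +i* x = 'i%C * x%:C :> R[i].
    by apply: complex_ext; rewrite !(ReM, ImM) /=; ring.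
  have <- : 'i%C * 'i%C * (2 * pi)%:C = - (2 * pi)%:C :> R[i] by rewrite ic_ic mulN1r.
  ring.
have j1 := cintZ (k / 2)%:C mpos i1; have j2 := cintZ (- (2 * pi)%:C) mpos i2.
split; first by apply: (cint_ext mpos E); exact: cintD.
by rewrite (eq_cintegral E) (cintegralD mpos j1 j2) (cintegralZ _ mpos i1) (cintegralZ _ mpos i2) mulNr.
Qed.

Let cont_gfun j x : 0 < x -> ccont (gfun j) x.
Proof.
move=> x0; apply: ccontD; first by apply: ccontM; [exact: ccont_cst|exact: cont_hfun].
apply: ccontM; first exact: cont_P.
by split; [exact: cst_continuous|exact: id].
Qed.

Let g_inv j y : 0 < y ->
  gfun j y = - \sum_i A j i * ((y `^ (- k))%:C * gfun i y^-1).
Proof.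
move=> y0.
rewrite (@functional_of_integrals _ k chi Sc (gfun j)
  (fun x => \sum_i - cpow 'i%C k * rho SL2ZS j i * gfun i x) hSc _ _ _ y y0).
- by rewrite mulr_sumr -sumrN; apply: eq_bigr => i _; rewrite /A mxE; ring.
- exact: cont_gfun.
- move=> x x0; apply: ccont_sum => i; apply: ccontM; first exact: ccont_cst.
  exact: cont_gfun.
move=> phi sphi; have n1 := nice_Sc sphi; have n2 := nice_slash k chi n1.
have [_ <-] := gfun_integral j n1.
rewrite (hLdelta sphi) !mxE.
rewrite (@eq_cintegral _ _ _ (fun x => \sum_i - cpow 'i%C k * rho SL2ZS j i *
   (gfun i x * slash_test k chi phi x))); last first.
  by move=> x _; rewrite mulr_suml; apply: eq_bigr => i _; exact: (esym (mulrA _ _ _)).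
have [|_ ->] := @cint_sum _ _ (index_enum 'I_m) _ (fun i x => - cpow 'i%C k * rho SL2ZS j i *
   (gfun i x * slash_test k chi phi x)) mpos.
  by move=> i; apply: cintZ mpos _; have [] := gfun_integral i n2.
rewrite mulr_sumr; apply: eq_bigr => i _.
have [ci ->] := gfun_integral i n2.
by rewrite (cintegralZ _ mpos ci) mulrA.
Qed.

Let S_inv tau : 0 < Im tau ->
  slash k chi rho (fourier_fun k kappa n0 cp cm) SL2ZS tau = fourier_fun k kappa n0 cp cm tau.
Proof.
move=> /upper_polar[zeta sz ->]; rewrite /slash.
have -> : autj SL2ZS ('i%C * cexp zeta) = 'i%C * cexp zeta.
  by rewrite /autj !mxE /= mul1r addr0.
have i0 := @ic_neq0 R; have e0 : cexp zeta != 0 by exact: cexp_neq0.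
have -> : moebius SL2ZS ('i%C * cexp zeta) = ei (- zeta).
  rewrite /moebius /autj !mxE /= mul0r mul1r add0r addr0 /ei cexpN.
  have t0 : 'i%C * cexp zeta != 0 by exact: mulf_neq0.
  apply: (mulIf t0); rewrite divfK//.
  transitivity ('i%C * 'i%C * ((cexp zeta)^-1 * cexp zeta) : R[i]); last by ring.
  by rewrite mulVf// ic_ic mulr1.
rewrite -/(ei zeta); have key : fourier_fun k kappa n0 cp cm (ei (- zeta)) =
    (cpow (ei zeta) k * chi SL2ZS) *: (rho SL2ZS *m fourier_fun k kappa n0 cp cm (ei zeta)).
  apply/matrixP => j l; rewrite ord1 fourierE !mxE.
  (* Used at [- zeta], since [S] sends [i e^zeta] to [i e^(-zeta)]; two factors [e^(k zeta/2)]
     combine to the [e^(k zeta)] of the automorphy factor. *)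
  have := @strip_symmetry _ m k ff P G _ A ffq Pq Gq Gq1 f_inv g_inv j _ (strip_opp sz).
  rewrite opprK /ei (cpow_i_cexp k sz) => h.
  have n0' : cexp ((k / 2)%:C * - zeta) != 0 by exact: cexp_neq0.
  apply: (mulfI n0'); rewrite h !mulr_sumr; apply: eq_bigr => i _; rewrite fourierE mxE.
  have -> : cexp (k%:C * zeta) = cexp ((k / 2)%:C * zeta) * cexp ((k / 2)%:C * zeta).
    by rewrite -cexpD -mulrDl -realcD -splitr.
  transitivity (cexp ((k / 2)%:C * - zeta) * cexp ((k / 2)%:C * zeta) * (chi SL2ZS * cpow 'i%C k * rho SL2ZS j i *
     (cexp ((k / 2)%:C * zeta) * ff i ('i%C * cexp zeta)))); last by ring.
  by rewrite -cexpD -mulrDr addNr mulr0 cexp0 mul1r.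
rewrite key -scalemxAr scalerA (mulKmx (rho_unit hrho _)) cpowN -invfM.
rewrite mulVf ?scale1r//; apply: mulf_neq0; last exact: chi_neq0 hchi _.
by apply: cpow_neq0; exact: mulf_neq0.
Qed.

Lemma harmonic_fourier : harmonic_space k chi rho kappa (fourier_fun k kappa n0 cp cm).
Proof.
split.
- move=> tau j v0.
  rewrite (_ : (fun u v => Re (fourier_fun k kappa n0 cp cm (u +i* v) j 0)) = (fun u v => Re (ff j (u +i* v)))).
  rewrite (_ : (fun u v => Im (fourier_fun k kappa n0 cp cm (u +i* v) j 0)) = (fun u v => Im (ff j (u +i* v)))).
  + exact: real_analytic.
  + by apply/funext => u; apply/funext => v; rewrite fourierE.
  + by apply/funext => u; apply/funext => v; rewrite fourierE.
- exact: (@slash_invariant _ m k chi rho hchi hrho _ S_inv T_inv).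
- by move=> tau j v0; rewrite fourier_funE; exact: Delta0.
exists n0, cp, cm => tau j v0.
exists (eseries (bp j) (c j) tau), (nseries k (bn j) (d j) tau).
split; last exact: fourierE.
- apply: has_sum_cseries_cvg; apply: has_sum_ext (eseries_has_sum (bp j) (subp j) v0) => l.
  by rewrite /holo_term /e2pi /eterm freq_pos.
apply: has_sum_cseries_cvg; apply: has_sum_ext (nseries_has_sum k (bn0 j) (subm j) v0) => l.
rewrite /nonholo_term /e2pi /nterm freq_neg; congr (_ * (incomplete_gamma _ _)%:C * cexp (_%:C * _ * _)); rewrite /bn; ring.
Qed.

End Main.
End Assembly.

Theorem theorem3p4 (R : realType) (k : R) (chi : SL2Z -> R[i])
    (m : nat) (rho : SL2Z -> 'M[R[i]]_m) (kappa : 'I_m -> R)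
    (Sc : set (R -> R[i])) (n0 : int) (cp cm : 'I_m -> int -> R[i])
    (hk : 2 * k \is a Num.int)
    (hchi : unitary_multiplier k chi)
    (hm : (1 <= m)%N)
    (hrho : unitary_representation rho)
    (hkappa01 : forall j, 0 <= kappa j < 1)
    (hkappa : forall j, chi SL2ZT *: (rho SL2ZT *m delta_mx j 0) =
       cexp ((2 * pi * kappa j)%:C * 'i%C) *: (delta_mx j 0 : 'cV[R[i]]_m))
    (hSc : test_functions Sc)
    (hgrowth : exists2 C : R, 0 < C & forall j,
       exp_sqrt_growth C [set n | - n0 <= n] (cp j) /\
       exp_sqrt_growth C [set n | n%:~R + kappa j < 0] (cm j))
    (hL : forall phi, Sc phi ->
       Lseries k kappa n0 cp cm phi =
       cpow 'i%C k *: (rho SL2ZS *m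
         Lseries k kappa n0 cp cm (slash_test k chi phi)))
    (hLdelta : forall phi, Sc phi ->
       Lseries_delta k kappa n0 cp cm phi =
       - cpow 'i%C k *: (rho SL2ZS *m
         Lseries_delta k kappa n0 cp cm (slash_test k chi phi))) :
  harmonic_space k chi rho kappa (fourier_fun k kappa n0 cp cm).
Proof.
have [C C0 hg] := hgrowth.
have kappa1 j : kappa j < 1 by have /andP[] := hkappa01 j.
apply: harmonic_fourier (hSc) _ _ hL hLdelta => //.
(* [pos_index l = l - n0], so the offset is [|n0|]. *)
- move=> j; apply: (@subexp_of_growth _ C _ (cp j) (pos_index n0) (absz n0) C0 (hg j).1).
  + by move=> l; rewrite /= /pos_index lerBrDr addNr.
  + by move=> l; rewrite /pos_index; lia.
  + by move=> l; rewrite /pos_index; lia.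
(* [neg_index l = -(l + 1)] has offset [1], and [kappa_j < 1] makes [n + kappa_j] negative there. *)
- move=> j; apply: (@subexp_of_growth _ C _ (cm j) (@neg_index) 1 C0 (hg j).2).
  + move=> l; rewrite /= /neg_index; have := kappa1 j.
    rewrite mulrNz -(pmulrn 1 l.+1) -natr1; have : 0 <= l%:R :> R by []; lra.
  + by move=> l; rewrite /neg_index; lia.
  + by move=> l; rewrite /neg_index; lia.
Qed.
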